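(* For every $\lambda\in\mathbb Z^n$, the modules $\mathcal S_\lambda$ and $\mathcal S_{\rho-\lambda}^*\otimes K_\rho$ are in $\mathcal C_{\le\lambda}$. Moreover, $\mathcal S_\lambda$ is projective in $\mathcal C_{\le\lambda}$ and $\mathcal S_{\rho-\lambda}^*\otimes K_\rho$ is injective in $\mathcal C_{\le\lambda}$.
   Context: Fix a positive integer $n$ and a field $K$ of characteristic zero. $\mathfrak b$ is the Lie algebra of upper triangular $n\times n$ matrices over $K$, $\mathfrak h\subset\mathfrak b$ the diagonal matrices, $\mathcal U(\mathfrak b)$ the enveloping algebra, $e_{ij}$ the matrix units. For $\lambda\in\mathbb Z^n$, $h=\mathrm{diag}(h_1,\dots,h_n)$, put $\langle\lambda,h\rangle=\sum\lambda_ih_i$. The $\lambda$-weight space of a $\mathcal U(\mathfrak b)$-module $M$ is $M_\lambda=\{m: hm=\langle\lambda,h\rangle m\ \forall h\in\mathfrak h\}$; $\lambda$ is a weight of $M$ if $M_\lambda\ne0$. A weight module is a $\mathcal U(\mathfrak b)$-module that is the direct sum of its weight spaces, all finite-dimensional. $K_\lambda$ is the one-dimensional module on which $h\in\mathfrak h$ acts by $\langle\lambda,h\rangle$ and $e_{ij}$ ($i<j$) by $0$. $M^*$ is the dual module. $\rho=(n-1,n-2,\dots,0)$, $\mathbf 1=(1,\dots,1)\in\mathbb Z^n$, $|\lambda|=\sum_i\lambda_i$. A permutation is a bijection $w$ of $\mathbb Z_{>0}$ fixing all but finitely many points; $S_\infty^{(n)}$ is the set of permutations with $w(n+1)<w(n+2)<\cdots$.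 $I(w)=\{(i,j):i<j,\ w(i)>w(j)\}$. For $w\in S_\infty^{(n)}$, $\mathrm{code}(w)\in\mathbb Z_{\ge0}^n$ has $\mathrm{code}(w)_i=\#\{j:i<j,\ w(i)>w(j)\}$; every $\lambda\in\mathbb Z_{\ge0}^n$ is the code of a unique $w\in S_\infty^{(n)}$, written $\mathrm{perm}(\lambda)$. KP modules: let $K^n=\bigoplus_{i=1}^n Ku_i$ be the vector representation of $\mathfrak b$. For $w\in S_\infty^{(n)}$ and $j\ge1$ write $\{i:(i,j)\in I(w)\}=\{i_1<\cdots<i_{l_j}\}$, $u_w^{(j)}=u_{i_1}\wedge\cdots\wedge u_{i_{l_j}}\in\bigwedge^{l_j}K^n$ (equal to $1\in K$ if $l_j=0$), $u_w=u_w^{(1)}\otimes u_w^{(2)}\otimes\cdots$, and $\mathcal S_w=\mathcal U(\mathfrak b)u_w\subset\bigwedge^{l_1}K^n\otimes\bigwedge^{l_2}K^n\otimes\cdots$. For $\lambda\in\mathbb Z_{\ge0}^n$ put $\mathcal S_\lambda=\mathcal S_{\mathrm{perm}(\lambda)}$; for general $\lambda\in\mathbb Z^n$ choose $k$ with $\lambda+k\mathbf 1\in\mathbb Z_{\ge0}^n$ and put $\mathcal S_\lambda=K_{-k\mathbf 1}\otimes\mathcal S_{\lambda+k\mathbf 1}$ (independent of $k$). Order: for permutations $w,v$ write $w\le_{\mathrm{lex}}v$ if $w=v$ or there is $i$ with $w(j)=v(j)$ for all $j<i$ and $w(i)<v(i)$. For $\lambda,\mu\in\mathbb Z_{\ge0}^n$,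 $\lambda\ge\mu$ means $|\lambda|=|\mu|$ and $\mathrm{perm}(\lambda)^{-1}\le_{\mathrm{lex}}\mathrm{perm}(\mu)^{-1}$; for $\lambda,\mu\in\mathbb Z^n$, $\lambda\ge\mu$ means $\lambda+k\mathbf 1\ge\mu+k\mathbf 1$ for any $k$ making both nonnegative (independent of $k$). $\mathcal C_{\le\lambda}$ is the full subcategory of the category of weight modules consisting of those all of whose weights $\nu$ satisfy $\nu\le\lambda$. *)

(* Defs.v *)
From HB Require Import structures.
From mathcomp Require Import all_boot all_order all_algebra generic_quotient ring_quotient.
From mathcomp Require Import boolp classical_sets functions.
From mathcomp.multinomials Require Import freeg.

Set Implicit Arguments.
Unset Strict Implicit.
Unset Printing Implicit Defensive.

Import GRing.Theory.
Local Open Scope ring_scope.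
Local Open Scope quotient_scope.

Section Permutations.
Local Open Scope nat_scope.

(* Positions and values are numbered from 0, so that 'I_n indexes the first n of
   them. The field pbound is any bound on the support. *)
Record fperm := FPerm {
  pval :> nat -> nat;
  pvalV : nat -> nat;
  pbound : nat;
  pvalK : cancel pval pvalV;
  pvalVK : cancel pvalV pval;
  pfix : forall i, pbound <= i -> pval i = i }.

Definition increasing_from (n : nat) (w : fperm) : Prop :=
  forall i j, n <= i -> i < j -> w i < w j.

Definition inversion (w : fperm) (i j : nat) : bool := (i < j) && (w j < w i).

Lemma inversion_bound (w : fperm) i j : inversion w i j -> j < pbound w.
Proof.
case/andP=> ij wji; rewrite ltnNge; apply/negP => bj.
rewrite pfix // in wji; have bi := leq_trans bj (ltnW wji).
have /(can_inj (@pvalK w)) wi := pfix bi.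
by rewrite wi ltnNge (ltnW ij) in wji.
Qed.

Definition code (w : fperm) (i : nat) : nat :=
  count (inversion w i) (iota 0 (pbound w)).

Lemma codeE (w : fperm) (i N : nat) : pbound w <= N ->
  code w i = count (inversion w i) (iota 0 N).
Proof.
move=> bN; rewrite /code -(subnKC bN) iotaD count_cat add0n.
rewrite [X in _ + X](_ : _ = 0) ?addn0 //; apply/eqP; rewrite -leqn0 leqNgt -has_count.
apply/hasPn => j; rewrite mem_iota => /andP[bj _].
by apply/negP => /inversion_bound; rewrite ltnNge bj.
Qed.

Fixpoint decode (s : seq nat) (i : nat) : nat :=
  if s is c :: s' then if i is i'.+1 then bump c (decode s' i') else c else i.

Fixpoint decode_inv (s : seq nat) (x : nat) : nat :=
  if s is c :: s' then if x == c then 0 else (decode_inv s' (unbump c x)).+1 else x.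

Fixpoint decode_bound (s : seq nat) : nat :=
  if s is c :: s' then (maxn c (decode_bound s')).+1 else 0.

Lemma decodeK s : cancel (decode s) (decode_inv s).
Proof.
elim: s => //= c s IHs [|i]; first by rewrite eqxx.
by rewrite eq_sym (negPf (neq_bump _ _)) bumpK IHs.
Qed.

Lemma decode_invK s : cancel (decode_inv s) (decode s).
Proof.
elim: s => //= c s IHs x; have [->//|xc] := eqVneq x c.
by rewrite IHs unbumpK.
Qed.

Lemma decode_fix s i : decode_bound s <= i -> decode s i = i.
Proof.
elim: s i => //= c s IHs [//|i]; rewrite ltnS geq_max => /andP[ci bi].
by rewrite IHs // /bump ci.
Qed.

Definition permcode (s : seq nat) : fperm :=
  FPerm (decodeK s) (decode_invK s) (@decode_fix s).

Lemma permcode_increasing s : increasing_from (size s) (permcode s).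
Proof.
elim: s => [//|c s IHs] [|i] [|j] //= si ij.
have := IHs i j si ij; rewrite /= => lt_ij.
by rewrite ltnNge leq_bump2 -ltnNge.
Qed.

Lemma permcodeK s i : code (permcode s) i = nth 0 s i.
Proof.
elim: s i => [|c s IHs] i; first by rewrite nth_nil.
case: i => [|i] /=.
  rewrite /code /= add0n (iotaDl 1 0) count_map /=.
  set N := maxn c _.
  rewrite (eq_count (a2 := fun j => decode s j < c)); last first.
    move=> j; rewrite /= /inversion /= /bump; have [cj|jc] := leqP c (decode s j).
      by rewrite add1n ltnNge (leqW cj).
    by rewrite add0n jc.
  rewrite -size_filter -(size_map (decode s)) -[RHS](size_iota 0).
  apply/perm_size/uniq_perm; rewrite ?iota_uniq //.
    rewrite map_inj_uniq ?filter_uniq ?iota_uniq //; exact: can_inj (@decodeK s).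
  move=> x; rewrite mem_iota /= add0n; apply/mapP/idP => [[j]|xc].
    by rewrite mem_filter => /andP[jc _] ->.
  exists (decode_inv s x); last by rewrite decode_invK.
  rewrite mem_filter decode_invK xc mem_iota /= add0n ltnNge; apply/negP.
  rewrite geq_max => /andP[cx bx].
  have := decode_fix bx; rewrite decode_invK => xE.
  by rewrite -xE leqNgt xc in cx.
rewrite -IHs (@codeE (permcode s) _ (maxn c (decode_bound s))) ?leq_maxr //.
rewrite {1}/code /= (iotaDl 1 0) count_map /=; apply: eq_count => j /=.
by rewrite /inversion /= ltnS; congr (_ && _); rewrite ltnNge leq_bump2 -ltnNge.
Qed.

(* The permutation increasing from n on whose code is lam, see perm_of_codeP. *)
Definition perm_of_code (n : nat) (lam : 'I_n -> nat) : fperm := permcode (codom lam).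

Lemma perm_of_codeP (n : nat) (lam : 'I_n -> nat) :
  increasing_from n (perm_of_code lam) /\
  forall i : 'I_n, code (perm_of_code lam) i = lam i.
Proof.
split=> [|i]; last by rewrite permcodeK codomE (nth_map i) ?size_enum_ord // nth_ord_enum.
by have := @permcode_increasing (codom lam); rewrite size_codom card_ord.
Qed.

Definition lex_le (f g : nat -> nat) : Prop :=
  f =1 g \/ exists2 i, (forall j, j < i -> f j = g j) & f i < g i.

End Permutations.

Section Weights.
Variable n : nat.
Implicit Types lam mu : 'rV[int]_n.

Definition nonneg lam : Prop := forall i, 0 <= lam 0 i.

(* Only meaningful when lam is nonnegative. *)
Definition perm_of_wt lam : fperm := perm_of_code (fun i : 'I_n => `|(lam 0 i)%R|%N).

Definition wt_le mu lam : Prop :=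
  forall k : int, nonneg (mu + const_mx k) -> nonneg (lam + const_mx k) ->
    \sum_i (lam + const_mx k) 0 i = \sum_i (mu + const_mx k) 0 i /\
    lex_le (pvalV (perm_of_wt (lam + const_mx k))) (pvalV (perm_of_wt (mu + const_mx k))).

Definition rho : 'rV[int]_n := \row_i (n.-1 - i)%N%:Z.

End Weights.

Section LinearAlgebra.
Variables (K : fieldType).

Inductive lspan (L : lmodType K) (G : L -> Prop) : L -> Prop :=
| lspan0 : lspan G 0
| lspan_gen x : G x -> lspan G x
| lspanD x y : lspan G x -> lspan G y -> lspan G (x + y)
| lspanZ a x : lspan G x -> lspan G (a *: x).

Definition lspanp (L : lmodType K) (G : L -> Prop) : {pred L} :=
  fun x => `[< lspan G x >].

Lemma lspanp_closed (L : lmodType K) (G : L -> Prop) : submod_closed (lspanp G).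
Proof.
split; first exact/asboolP/lspan0.
by move=> a x y /asboolP Hx /asboolP Hy; apply/asboolP/lspanD => //; apply/lspanZ.
Qed.

HB.instance Definition _ (L : lmodType K) (G : L -> Prop) :=
  GRing.isSubmodClosed.Build K L (lspanp G) (lspanp_closed G).

Lemma lspanp_gen (L : lmodType K) (G : L -> Prop) x : G x -> x \in lspanp G.
Proof. by move=> Gx; apply/asboolP/lspan_gen. Qed.

Lemma lspan_stable (L : lmodType K) (G : L -> Prop) (f : {linear L -> L}) :
  (forall x, G x -> f x \in lspanp G) -> forall x, x \in lspanp G -> f x \in lspanp G.
Proof.
move=> Hf x /asboolP; elim=> [|y /Hf //|y z _ Hy _ Hz|a y _ Hy].
- by rewrite linear0 rpred0.
- by rewrite linearD rpredD.
- by rewrite linearZ rpredZ.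
Qed.

Section Quot.
Variables (L : lmodType K) (G : L -> Prop).

Definition lquot := Quotient.quot (lspanp G : {pred L}).
HB.instance Definition _ := GRing.Zmodule.on lquot.

Definition toq (x : L) : lquot := \pi_(Quotient.quot (lspanp G)) x.

Lemma toqE x y : (toq x = toq y) <-> x - y \in lspanp G.
Proof. by rewrite Quotient.idealrBE; split=> [/eqP|/eqP]. Qed.

Lemma toqD : {morph toq : x y / x + y}.
Proof. by move=> x y; rewrite /toq !piE. Qed.

Lemma toqK q : toq (repr q) = q. Proof. exact: reprK. Qed.

Definition qscale (a : K) (q : lquot) : lquot := toq (a *: repr q).

Lemma qscaleE a x : qscale a (toq x) = toq (a *: x).
Proof. by apply/toqE; rewrite -scalerBr rpredZ //; apply/toqE; rewrite toqK. Qed.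

Lemma qscaleA a b v : qscale a (qscale b v) = qscale (a * b) v.
Proof. by rewrite -[v]toqK !qscaleE scalerA. Qed.
Lemma qscale1 : left_id 1 qscale.
Proof. by move=> v; rewrite -[v]toqK !qscaleE scale1r. Qed.
Lemma qscaleDr : right_distributive qscale +%R.
Proof. by move=> a u v; rewrite -[v]toqK -[u]toqK !(qscaleE, =^~ toqD) scalerDr. Qed.
Lemma qscaleDl v : {morph qscale^~ v : a b / a + b}.
Proof. by move=> a b; rewrite -[v]toqK !(qscaleE, =^~ toqD) scalerDl. Qed.

HB.instance Definition _ :=
  GRing.Zmodule_isLmodule.Build K lquot qscaleA qscale1 qscaleDr qscaleDl.

Lemma toq_linear : linear toq.
Proof. by move=> a x y; rewrite toqD -qscaleE. Qed.
HB.instance Definition _ := GRing.isLinear.Build K L lquot _ toq toq_linear.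

End Quot.
End LinearAlgebra.

Section FreeModule.
Variables (K : fieldType) (X : choiceType) (L : lmodType K).

Definition fgen (x : X) : {freeg X / K} := [freeg [:: (1, x)]].

Lemma fglift_linear (f : X -> L) : linear (fglift f : {freeg X / K} -> L).
Proof.
have liftD := lift_is_additive f.
pose F := GRing.isZmodMorphism.Build _ _ (fglift f) liftD.
pose g : {additive {freeg X / K} -> L} := HB.pack (fglift f) F.
have gE : fglift f = g by [].
move=> a u v; rewrite gE raddfD; congr (_ + _).
rewrite -[in RHS](freeg_sumE u) [a *: u](_ : _ = fgscale a u) // /fgscale.
rewrite !raddf_sum; apply: eq_bigr => x _ /=.
by rewrite !liftU scalerA.
Qed.
HB.instance Definition _ (f : X -> L) :=
  GRing.isLinear.Build K {freeg X / K} L _ (fglift f) (fglift_linear f).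

Lemma fglift_gen (f : X -> L) x : fglift f (fgen x) = f x.
Proof. by rewrite liftU scale1r. Qed.

Lemma fgen_sum (D : {freeg X / K}) : D = \sum_(x <- dom D) coeff x D *: fgen x.
Proof.
rewrite -[LHS]freeg_sumE; apply: eq_bigr => x _.
by apply/eqP/freeg_eqP => y; rewrite coeffZ !coeffU mul1r.
Qed.

End FreeModule.

(* Modules over the enveloping algebra of the Lie algebra b of upper triangular
   matrices are given as representations of b. *)
Section BModules.
Variables (K : fieldType) (n : nat).

Definition upper : {pred 'M[K]_n} :=
  fun A => [forall i : 'I_n, forall j : 'I_n, (j < i)%N ==> (A i j == 0)].

Lemma upperP (A : 'M[K]_n) : reflect (forall i j : 'I_n, (j < i)%N -> A i j = 0) (A \in upper).
Proof.
apply: (iffP forallP) => [H i j ji|H i]; last first.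
  by apply/forallP => j; apply/implyP => /H ->.
by move/forallP: (H i) => /(_ j) /implyP /(_ ji) /eqP.
Qed.

Lemma upper_closed : submod_closed upper.
Proof.
split=> [|a A B /upperP HA /upperP HB]; apply/upperP => i j ji; rewrite !mxE //.
by rewrite HA // HB // mulr0 addr0.
Qed.
HB.instance Definition _ := GRing.isSubmodClosed.Build K 'M[K]_n upper upper_closed.

Lemma upperM (A B : 'M[K]_n) : A \in upper -> B \in upper -> A *m B \in upper.
Proof.
move=> /upperP HA /upperP HB; apply/upperP => i j ji; rewrite mxE big1 // => k _.
case: (ltnP k i) => [/HA ->|ik]; first by rewrite mul0r.
by rewrite (HB k j) ?mulr0 // (leq_trans ji).
Qed.

Record borel := Borel { bval :> 'M[K]_n; _ : bval \in upper }.
HB.instance Definition _ := [isSub for bval].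
HB.instance Definition _ := [Choice of borel by <:].
HB.instance Definition _ := [SubChoice_isSubLmodule of borel by <:].

Lemma bvalP (x : borel) : bval x \in upper. Proof. by case: x. Qed.

Lemma lieb_subproof (x y : borel) : bval x *m bval y - bval y *m bval x \in upper.
Proof. by rewrite rpredB ?upperM ?bvalP. Qed.

Definition lieb (x y : borel) : borel := Borel (lieb_subproof x y).

Record bmodule := BModule {
  bcar :> lmodType K;
  bact : borel -> bcar -> bcar;
  bact_linear : forall x, linear (bact x);
  bact_linearl : forall m, linear (bact^~ m);
  bact_lie : forall x y m,
    bact (lieb x y) m = bact x (bact y m) - bact y (bact x m) }.

HB.instance Definition _ (M : bmodule) (x : borel) :=
  GRing.isLinear.Build K M M _ (@bact M x) (@bact_linear M x).

Definition vecb : bmodule.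
Proof.
refine (@BModule ('cV[K]_n) (fun x v => bval x *m v) _ _ _).
- by move=> x a u v; rewrite mulmxDr -scalemxAr.
- by move=> v a x y /=; rewrite mulmxDl -scalemxAl.
- by move=> x y v /=; rewrite mulmxBl !mulmxA.
Defined.

Definition pairing (lam : 'rV[int]_n) (x : borel) : K :=
  \sum_i (lam 0 i)%:~R * bval x i i.

Lemma pairing_linear lam a x y :
  pairing lam (a *: x + y) = a * pairing lam x + pairing lam y.
Proof.
rewrite /pairing mulr_sumr -big_split; apply: eq_bigr => i _ /=.
by rewrite !mxE mulrDr mulrCA.
Qed.

Lemma pairing_lie lam x y : pairing lam (lieb x y) = 0.
Proof.
have diagM (A B : borel) i : (bval A *m bval B) i i = bval A i i * bval B i i.
  rewrite mxE (bigD1 i) //= big1 ?addr0 // => k ki.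
  have /upperP HA := bvalP A; have /upperP HB := bvalP B.
  case: (ltngtP k i) => [/HA ->|/HB ->|/val_inj ki']; rewrite ?mul0r ?mulr0 //.
  by rewrite ki' eqxx in ki.
apply: big1 => i _; rewrite [X in _ * X]mxE diagM mxE diagM.
by rewrite [X in X - _]mulrC subrr mulr0.
Qed.

(* K_lam: an upper triangular x acts through its diagonal part. *)
Definition charb (lam : 'rV[int]_n) : bmodule.
Proof.
refine (@BModule K^o (fun x m => pairing lam x *: m) _ _ _).
- by move=> x a u v; rewrite scalerDr !scalerA mulrC.
- by move=> v a x y /=; rewrite pairing_linear scalerDl scalerA.
- by move=> x y v /=; rewrite pairing_lie scale0r !scalerA mulrC subrr.
Defined.

Section Cyclic.
Variables (M : bmodule) (u : M).

(* U(b)u, that is, the smallest b-submodule containing u. *)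
Inductive Ugen : M -> Prop :=
| Ugen_base : Ugen u
| Ugen0 : Ugen 0
| UgenD v w : Ugen v -> Ugen w -> Ugen (v + w)
| UgenZ a v : Ugen v -> Ugen (a *: v)
| Ugen_act x v : Ugen v -> Ugen (bact x v).

Definition Ugenp : {pred M} := fun v => `[< Ugen v >].

Lemma Ugenp_closed : submod_closed Ugenp.
Proof.
split; first exact/asboolP/Ugen0.
by move=> a x y /asboolP Hx /asboolP Hy; apply/asboolP/UgenD => //; apply/UgenZ.
Qed.
HB.instance Definition _ := GRing.isSubmodClosed.Build K M Ugenp Ugenp_closed.

Record cyclic_car := CyclicCar { cval : M; _ : cval \in Ugenp }.
HB.instance Definition _ := [isSub for cval].
HB.instance Definition _ := [Choice of cyclic_car by <:].
HB.instance Definition _ := [SubChoice_isSubLmodule of cyclic_car by <:].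

Lemma cact_subproof (x : borel) (v : cyclic_car) : bact x (cval v) \in Ugenp.
Proof. by case: v => v /= /asboolP Hv; apply/asboolP/Ugen_act. Qed.

Definition cact (x : borel) (v : cyclic_car) := CyclicCar (cact_subproof x v).

Definition cyclicb : bmodule.
Proof.
refine (@BModule cyclic_car cact _ _ _).
- by move=> x a v w; apply: val_inj; rewrite /= bact_linear.
- by move=> v a x y; apply: val_inj; rewrite /= bact_linearl.
- by move=> x y v; apply: val_inj; rewrite /= bact_lie.
Defined.

End Cyclic.

Section Dual.
Variable (M : bmodule).

Definition dualp : {pred M -> K^o} := fun f => `[< linear f >].

Lemma dualp_closed : submod_closed dualp.
Proof.
split; first by apply/asboolP => a v w; rewrite /= scaler0 addr0.
move=> a f g /asboolP Hf /asboolP Hg; apply/asboolP => b v w.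
rewrite !fctE Hf Hg !scalerDr !scalerA addrACA mulrC //.
Qed.
HB.instance Definition _ := GRing.isSubmodClosed.Build K (M -> K^o) dualp dualp_closed.

Record dual_car := DualCar { dval : M -> K^o; _ : dval \in dualp }.
HB.instance Definition _ := [isSub for dval].
HB.instance Definition _ := [Choice of dual_car by <:].
HB.instance Definition _ := [SubChoice_isSubLmodule of dual_car by <:].

Lemma dact_subproof (x : borel) (f : dual_car) :
  (fun m => - dval f (bact x m)) \in dualp.
Proof.
case: f => f /= /asboolP Hf; apply/asboolP => a v w.
by rewrite bact_linear Hf opprD scalerN.
Qed.

Definition dact (x : borel) (f : dual_car) := DualCar (dact_subproof x f).

Definition dualb : bmodule.
Proof.
refine (@BModule dual_car dact _ _ _).
- by move=> x a f g; apply: val_inj; apply/funext => m; rewrite /= !fctE opprD scalerN.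
- move=> f a x y; apply: val_inj; apply/funext => m; rewrite /= !fctE bact_linearl.
  by case: f => f /= /asboolP ->; rewrite opprD scalerN.
- move=> x y f; apply: val_inj; apply/funext => m; rewrite /= !fctE bact_lie /=.
  case: f => f /= /asboolP Hf.
  have HfB u v : f (u - v) = f u - f v.
    by rewrite -[- v]scaleN1r addrC Hf scaleN1r addrC.
  by rewrite HfB opprB !opprK.
Defined.

End Dual.

Section Tensor.
Variables (M N : bmodule).

Local Notation F := {freeg (M * N)%type / K}.

Inductive tens_rel : F -> Prop :=
| tens_rell a (m m' : M) (v : N) :
    tens_rel (fgen K (a *: m + m', v) - (a *: fgen K (m, v) + fgen K (m', v)))
| tens_relr a (m : M) (v v' : N) :
    tens_rel (fgen K (m, a *: v + v') - (a *: fgen K (m, v) + fgen K (m, v'))).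

Definition tens_car : lmodType K := lquot tens_rel.

Definition tpure (m : M) (v : N) : tens_car := toq tens_rel (fgen K (m, v)).

Lemma tpure_linearl v : linear (tpure^~ v).
Proof.
move=> a m m'; rewrite -linearP; apply/toqE/lspanp_gen; exact: tens_rell.
Qed.

Lemma tpure_linearr m : linear (tpure m).
Proof.
move=> a v v'; rewrite -linearP; apply/toqE/lspanp_gen; exact: tens_relr.
Qed.

HB.instance Definition _ m := GRing.isLinear.Build K N tens_car _ (tpure m) (tpure_linearr m).

Lemma tpureBl m m' v : tpure (m - m') v = tpure m v - tpure m' v.
Proof. by rewrite addrC -scaleN1r tpure_linearl scaleN1r addrC. Qed.

Lemma tens_ind (P : tens_car -> Prop) :
  P 0 -> (forall t t', P t -> P t' -> P (t + t')) -> (forall m v, P (tpure m v)) ->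
  forall t, P t.
Proof.
move=> P0 PD Pp t; rewrite -[t]toqK [repr t]fgen_sum linear_sum.
elim/big_rec: _ => // -[m v] t' _ Pt'; apply: PD => //.
rewrite linearZ /=; set c := coeff _ _.
suff <- : tpure m (c *: v) = c *: toq tens_rel (fgen K (m, v)) by [].
by rewrite linearZ.
Qed.

Definition tact0 (x : borel) : F -> F :=
  fglift (fun p => fgen K (bact x p.1, p.2) + fgen K (p.1, bact x p.2)).
HB.instance Definition _ x := GRing.Linear.on (tact0 x).

Lemma tact0_gen x m v :
  tact0 x (fgen K (m, v)) = fgen K (bact x m, v) + fgen K (m, bact x v).
Proof. exact: fglift_gen. Qed.

Lemma tact0_stable x z : z \in lspanp tens_rel -> tact0 x z \in lspanp tens_rel.
Proof.
apply: lspan_stable => {}z [a m m' v|a m v v'].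
- rewrite linearB linearP /= !tact0_gen bact_linear.
  rewrite scalerDr [in X in _ - X]addrACA opprD addrACA.
  by apply: rpredD; apply: lspanp_gen; constructor.
- rewrite linearB linearP /= !tact0_gen bact_linear.
  rewrite scalerDr [in X in _ - X]addrACA opprD addrACA.
  by apply: rpredD; apply: lspanp_gen; constructor.
Qed.

Definition tact (x : borel) (t : tens_car) : tens_car :=
  toq tens_rel (tact0 x (repr t)).

Lemma tactE x z : tact x (toq tens_rel z) = toq tens_rel (tact0 x z).
Proof.
apply/toqE; rewrite -linearB; apply: tact0_stable.
by apply/toqE; rewrite toqK.
Qed.

Lemma tact_linear x : linear (tact x).
Proof.
move=> a s t; rewrite -[s]toqK -[t]toqK -linearP !tactE.
by rewrite -!linearP.
Qed.
HB.instance Definition _ x :=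
  GRing.isLinear.Build K tens_car tens_car _ (tact x) (tact_linear x).

Lemma tact_pure x m v : tact x (tpure m v) = tpure (bact x m) v + tpure m (bact x v).
Proof. by rewrite tactE tact0_gen linearD. Qed.

Definition tens : bmodule.
Proof.
refine (@BModule tens_car tact tact_linear _ _).
- move=> t a x y; elim/tens_ind: t => [|s t /= IHs IHt|m v] /=.
  + by rewrite !linear0 addr0.
  + by rewrite !linearD /= IHs IHt addrACA.
  + by rewrite !tact_pure !bact_linearl (tpure_linearl v) (tpure_linearr m) scalerDr addrACA.
- move=> x y t; elim/tens_ind: t => [|s t /= IHs IHt|m v] /=.
  + by rewrite !linear0 addr0.
  + by rewrite !linearD /= IHs IHt addrACA.
  + rewrite !(tact_pure, linearD) /= !tact_pure !bact_lie.
    rewrite tpureBl linearB /=.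
    set a := tpure _ v; set e := tpure _ v; set d := tpure m _; set f := tpure m _.
    set b := tpure (bact x m) _; set c := tpure (bact y m) _.
    rewrite -opprD (addrACA e b) [- (_ + _)]opprD [RHS]addrACA.
    by rewrite [e + c]addrC [b + d]addrC !addrKA.
Defined.

End Tensor.

Section Exterior.
Variable V : bmodule.

(* l-th tensor power V (x) (V (x) ... (V (x) K)). *)
Definition tpow (l : nat) : bmodule := iter l (tens V) (charb 0).

Fixpoint tpure_seq (l : nat) (v : nat -> V) : tpow l :=
  if l is l'.+1 return tpow l then tpure (v 0%N) (tpure_seq l' (fun a => v a.+1))
  else (1 : K).

Inductive alt_rel (l : nat) : tpow l -> Prop :=
| AltRel (v : nat -> V) (a b : nat) :
    (a < b < l)%N -> v a = v b -> alt_rel (tpure_seq l v).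

Definition upd (v : nat -> V) (a : nat) (p : V) : nat -> V :=
  fun c => if c == a then p else v c.

Lemma upd_id v a : upd v a (v a) = v.
Proof. by apply/funext => c; rewrite /upd; case: eqP => [->|]. Qed.

Lemma updC v a b p q : a != b -> upd (upd v a p) b q = upd (upd v b q) a p.
Proof.
move=> ab; apply/funext => c; rewrite /upd.
by have [->|//] := eqVneq c b; rewrite eq_sym (negPf ab).
Qed.

Lemma tpure_seqP l v a c p q : (a < l)%N ->
  tpure_seq l (upd v a (c *: p + q)) =
  c *: tpure_seq l (upd v a p) + tpure_seq l (upd v a q).
Proof.
elim: l v a => // l IHl v [|a] al /=; first exact: tpure_linearl.
by rewrite -linearP /=; congr (tpure _ _); exact: (IHl (fun b => v b.+1)).
Qed.

Lemma tpure_seqD l v a p q : (a < l)%N ->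
  tpure_seq l (upd v a (p + q)) =
  tpure_seq l (upd v a p) + tpure_seq l (upd v a q).
Proof. by move=> al; rewrite -[p in LHS]scale1r tpure_seqP // scale1r. Qed.

Lemma bact_tpure_seq x l v :
  bact x (tpure_seq l v) = \sum_(a < l) tpure_seq l (upd v a (bact x (v a))).
Proof.
elim: l v => [|l IHl] v.
  rewrite big_ord0 /= /pairing big1 ?scale0r // => i _.
  by rewrite mxE mul0r.
rewrite big_ord_recl [LHS]tact_pure; congr (_ + _).
by rewrite IHl linear_sum.
Qed.

Lemma alt_stable l x z :
  z \in lspanp (@alt_rel l) -> bact x z \in lspanp (@alt_rel l).
Proof.
apply: lspan_stable => {}z [v a b /andP[ab bl] vab] /=.
have al := ltn_trans ab bl; have nab : a != b by rewrite neq_ltn ab.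
rewrite bact_tpure_seq (bigD1 (Ordinal al)) //= (bigD1 (Ordinal bl)) /=; last first.
  by rewrite -val_eqE /= eq_sym.
rewrite addrA rpredD //; last first.
  apply: rpred_sum => c /andP[ca cb]; apply/lspanp_gen/(@AltRel _ _ a b).
    by rewrite ab bl.
  by rewrite /upd !(inj_eq val_inj, eq_sym _ (c : nat)) -!val_eqE in ca cb *; rewrite (negPf ca) (negPf cb).
set u := v a; set w := bact x u.
pose B p q := tpure_seq l (upd (upd v a p) b q).
have BB p : B p p \in lspanp (@alt_rel l).
  apply/lspanp_gen/(@AltRel _ _ a b); first by rewrite ab bl.
  by rewrite /upd eqxx (negPf nab) eqxx.
have -> : tpure_seq l (upd v a w) = B w u.
  by rewrite /B updC // /u vab upd_id.
have -> : tpure_seq l (upd v b (bact x (v b))) = B u w.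
  by rewrite /B /u upd_id -vab.
suff -> : B w u + B u w = B (w + u) (w + u) - B w w - B u u.
  by rewrite !rpredB.
have BDr p q q' : B p (q + q') = B p q + B p q' by exact: tpure_seqD.
have BDl p p' q : B (p + p') q = B p q + B p' q.
  by rewrite /B !(updC _ _ _ nab) tpure_seqD.
rewrite BDl !BDr [B w w + B w u]addrC addrACA.
by rewrite -[RHS]addrA -opprD addrK.
Qed.

(* V^{(x) l} modulo the span of the v_0 (x) ... (x) v_{l-1} with two equal entries. *)
Definition extpow_car (l : nat) : lmodType K := lquot (@alt_rel l).

Definition extact l (x : borel) (t : extpow_car l) : extpow_car l :=
  toq _ (bact x (repr t)).

Lemma extactE l x z : extact x (toq (@alt_rel l) z) = toq (@alt_rel l) (bact x z).
Proof.
apply/toqE; rewrite -linearB; apply: alt_stable.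
by apply/toqE; rewrite toqK.
Qed.

Definition extpow (l : nat) : bmodule.
Proof.
refine (@BModule (extpow_car l) (@extact l) _ _ _).
- move=> x a s t; rewrite -[s]toqK -[t]toqK -linearP !extactE.
  by rewrite -!linearP.
- by move=> t a x y; rewrite -[t]toqK /= !extactE bact_linearl linearP.
- by move=> x y t; rewrite -[t]toqK !extactE bact_lie linearB.
Defined.

Definition wedge (l : nat) (v : nat -> V) : extpow l :=
  toq (@alt_rel l) (tpure_seq l v).

End Exterior.

Definition diagonal (h : borel) : Prop := is_diag_mx (bval h).

Definition wtspace (M : bmodule) (lam : 'rV[int]_n) (m : M) : Prop :=
  forall h, diagonal h -> bact h m = pairing lam h *: m.

Definition is_weight (M : bmodule) (lam : 'rV[int]_n) : Prop :=
  exists2 m : M, wtspace lam m & m != 0.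

Definition fin_dim_wtspace (M : bmodule) (lam : 'rV[int]_n) : Prop :=
  exists s : seq M, forall m, wtspace lam m <-> lspan (fun v => v \in s) m.

Record weight_module (M : bmodule) : Prop := WeightModule {
  wt_sum : forall m : M, exists s : seq 'rV[int]_n, exists v : 'rV[int]_n -> M,
    (forall mu, wtspace mu (v mu)) /\ m = \sum_(mu <- s) v mu;
  wt_direct : forall (s : seq 'rV[int]_n) (v : 'rV[int]_n -> M),
    uniq s -> (forall mu, wtspace mu (v mu)) -> \sum_(mu <- s) v mu = 0 ->
    forall mu, mu \in s -> v mu = 0;
  wt_fin : forall mu, fin_dim_wtspace M mu }.

Definition is_bhom (M N : bmodule) (f : M -> N) : Prop :=
  linear f /\ forall x m, f (bact x m) = bact x (f m).

(* The categories considered below are full and closed under subquotients, so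
   their epimorphisms (resp. monomorphisms) are the surjective (resp. injective)
   homomorphisms. *)
Definition projective_in (C : bmodule -> Prop) (P : bmodule) : Prop :=
  forall (M N : bmodule) (g : M -> N) (f : P -> N), C M -> C N ->
  is_bhom g -> (forall y, exists x, g x = y) -> is_bhom f ->
  exists2 h : P -> M, is_bhom h & forall p, g (h p) = f p.

Definition injective_in (C : bmodule -> Prop) (I : bmodule) : Prop :=
  forall (M N : bmodule) (g : M -> N) (f : M -> I), C M -> C N ->
  is_bhom g -> injective g -> is_bhom f ->
  exists2 h : N -> I, is_bhom h & forall m, h (g m) = f m.

(* The increasing sequence of the u_i with (i, j) an inversion of w.  Restricting
   to i < n loses nothing when w increases from n on: then i < n for every
   inversion (i, j). *)
Definition KPcol (w : fperm) (j : nat) : seq vecb :=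
  [seq (delta_mx i 0 : vecb) | i : 'I_n <- enum 'I_n & inversion w i j].

Definition KPext (w : fperm) (j : nat) : bmodule := extpow vecb (size (KPcol w j)).

Definition KPwedge (w : fperm) (j : nat) : KPext w j :=
  wedge (size (KPcol w j)) (nth 0 (KPcol w j)).

Fixpoint KPamb (w : fperm) (js : seq nat) : bmodule :=
  if js is j :: js' then tens (KPext w j) (KPamb w js') else charb 0.

Fixpoint KPvec (w : fperm) (js : seq nat) : KPamb w js :=
  if js is j :: js' return KPamb w js then tpure (KPwedge w j) (KPvec w js')
  else (1 : K).

(* The factors with j >= pbound w are all the trivial module, with vector 1 (see
   inversion_bound), and are dropped. *)
Definition KPperm (w : fperm) : bmodule := cyclicb (KPvec w (iota 0 (pbound w))).

(* S_lam computed with the shift k, for any k such that lam + k(1, ..., 1) is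
   nonnegative. *)
Definition KP (k : int) (lam : 'rV[int]_n) : bmodule :=
  tens (charb (const_mx (- k))) (KPperm (perm_of_wt (lam + const_mx k))).

Definition in_catle (lam : 'rV[int]_n) (M : bmodule) : Prop :=
  weight_module M /\ forall nu, is_weight M nu -> wt_le nu lam.

End BModules.

(* Main.v *)
(* Let w = perm(lambda) and m_ij(w) = #{c : w(i) < c < w(j), w^-1(c) > j}.  The generator u_w of
   S_lambda satisfies e_ij^(m_ij(w) + 1) u_w = 0 for i < j, and the heart of the matter is that
   these relations present S_lambda over the strictly upper triangular matrices.  In the Fock space
   of K^n (x) K^N, u_w is a multiple of the basis vector given by the diagram of w.  If r is the
   last descent of w, s > r is the position of the largest value below w(r), and v = w t_rs, then a
   vector x satisfying the relations of w also satisfies those of v modulo the submodules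
   generated by the vectors e_lr^(m_lr(w)) x, l < r, and the l-th of these vectors satisfies the
   relations of v t_lr modulo the previous ones.  By induction this bounds the module generated by
   x by a filtration which is realized in Fock space, where the graded pieces are separated by
   operators commuting with the action.
   In C_{<= lambda} every vector of weight lambda satisfies the relations of w, since
   lambda + (m_ij(w) + 1)(eps_i - eps_j) is never <= lambda; so such vectors lift along
   surjections and receive maps from S_lambda.  Dually, a map from M to S_{rho-lambda}^* (x) K_rho
   is given by a linear form on M_lambda; this form extends along injections, and the extension is
   a vector of weight -lambda satisfying the relations of perm(rho - lambda), which up to a shift
   is w with the values reversed. *)

Require Import Defs.
From HB Require Import structures.
From mathcomp Require Import all_boot all_order all_algebra.
From mathcomp Require Import boolp functions zify ring.
From mathcomp.multinomials Require Import freeg.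

Set Implicit Arguments.
Unset Strict Implicit.
Unset Printing Implicit Defensive.

Import GRing.Theory.
Local Open Scope ring_scope.

(** * Heisenberg relations *)

(** The number m_ij(w) counts the columns of the Rothe diagram of w with a box in row j and none in
    row i, so e_ij has order exactly m_ij(w) + 1 on u_w. The filtration lifts the transition formula
    of Lascoux and Schuetzenberger for Schubert polynomials, S_w = x_r S_v + sum of the S_(v t_lr)
    over the l for which v t_lr covers v in Bruhat order. The obstacle is that no map is given
    between Fock space and the module of x: an element p of U(n) with p u_w = 0 has to be shown to
    kill x. The induction therefore runs on the module generated by (x, u_w) in the direct sum of
    both modules, and shows that its projection to Fock space is injective. All nilpotency estimates
    come from Heisenberg triples: if e_ij and e_jk have orders a and b on a vector, then e_ik has
    order at most a + b - 1 on it. On the dual side the order on weights is used only for pairs (i,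
    j) without an intermediate value at an intermediate position; the same estimate yields the other
    relations. Words in the e_ij suffice to describe U(b) on a weight vector, since the diagonal
    matrices act on such words by scalars. *)

Section Heisenberg.
Variables (K : fieldType) (charK0 : [pchar K] =i pred0).

Lemma natr_neq0 k : (k.+1)%:R != 0 :> K.
Proof. by have /pcharf0P -> := charK0. Qed.

Variables (V : lmodType K) (X Y Z : {linear V -> V}) (c : K).
Hypothesis c0 : c != 0.
Hypothesis XY : forall v, X (Y v) = Y (X v) + c *: Z v.
Hypothesis XZ : forall v, X (Z v) = Z (X v).
Hypothesis YZ : forall v, Y (Z v) = Z (Y v).

Lemma iter_linear0 (f : {linear V -> V}) k : iter k f 0 = 0.
Proof. by elim: k => //= k ->; rewrite linear0. Qed.

Lemma iter_eq0_le (f : {linear V -> V}) k l v : (k <= l)%N ->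
  iter k f v = 0 -> iter l f v = 0.
Proof. by move=> kl kv; rewrite -(subnK kl) iterD kv iter_linear0. Qed.

Lemma iterZlin (f : {linear V -> V}) k a v : iter k f (a *: v) = a *: iter k f v.
Proof. by elim: k => //= k ->; rewrite linearZ. Qed.

Lemma iterDlin (f : {linear V -> V}) k u v : iter k f (u + v) = iter k f u + iter k f v.
Proof. by elim: k => //= k ->; rewrite linearD. Qed.

Lemma iter_comm (f g : {linear V -> V}) k l v : (forall v, f (g v) = g (f v)) ->
  iter k f (iter l g v) = iter l g (iter k f v).
Proof.
move=> fg; have fgl u : f (iter l g u) = iter l g (f u).
  by elim: l => //= l <-.
by elim: k => //= k ->; rewrite fgl.
Qed.

Lemma heis_iterY k v : X (iter k Y v) = iter k Y (X v) + (k%:R * c) *: Z (iter k.-1 Y v).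
Proof.
elim: k => [|k IH]; first by rewrite mul0r scale0r addr0.
have ZY m u : Z (iter m Y u) = iter m Y (Z u) by exact: (@iter_comm _ _ 1).
rewrite iterS XY IH linearD linearZ /= YZ -addrA; congr (_ + _).
case: k {IH} => [|k] /=; first by rewrite mul0r scale0r add0r mul1r.
by rewrite -scalerDl -[in RHS]natr1 mulrDl mul1r.
Qed.

Lemma heis_iterX k v : iter k X (Y v) = Y (iter k X v) + (k%:R * c) *: Z (iter k.-1 X v).
Proof.
elim: k => [|k IH]; first by rewrite mul0r scale0r addr0.
rewrite iterS IH linearD XY linearZ /= XZ -addrA; congr (_ + _).
case: k {IH} => [|k] /=; first by rewrite mul0r scale0r addr0 mul1r.
by rewrite -scalerDl -[in RHS]natr1 mulrDl mul1r addrC.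
Qed.

(** Up to the factor (q+1)c, invertible in characteristic zero, Z Y^q v equals X Y^(q+1) v - Y^(q+1)
    X v. Under Z^(p-1) the first term has one Z fewer and one Y more; in the second, X v has X-order
    a - 1 and Y-order at most b + 1. Both keep the inequality. *)
Lemma heis_ZY a b p q v : iter a X v = 0 -> iter b Y v = 0 -> (a + b <= (p + q).+1)%N ->
  iter p Z (iter q Y v) = 0.
Proof.
elim: a b p q v => [|a IHa] b p q v Xv Yv; first by rewrite [v]Xv !iter_linear0.
have [k] := ubnP (b - q); elim: k p q => // k IHk p q bqk abpq.
have [bq|qb] := leqP b q; first by rewrite (iter_eq0_le bq Yv) iter_linear0.
case: p abpq => [|p] abpq; first by lia.
have C : q.+1%:R * c != 0 by rewrite mulf_neq0 ?natr_neq0.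
apply: (scalerI C); rewrite scaler0.
have E : Z (iter q Y v) = iter q Y (Z v) by exact: (@iter_comm _ _ 1).
rewrite iterSr -iterZlin.
have -> : (q.+1%:R * c) *: Z (iter q Y v) = X (iter q.+1 Y v) - iter q.+1 Y (X v).
  by rewrite heis_iterY addrAC subrr add0r.
have ZX u : iter p Z (X u) = X (iter p Z u).
  by apply: (@iter_comm _ _ p 1) => {}u; rewrite XZ.
rewrite -scaleN1r iterDlin iterZlin ZX IHk; [|lia|lia].
rewrite linear0 add0r (IHa b.+1) ?scaler0 //; last by lia.
  by rewrite -iterSr.
have := heis_iterY b.+1 v; rewrite /= Yv !linear0.
by rewrite addr0 => <-.
Qed.

(** Carrying X^(k+1) across one Y leaves Y X^(k+1) v and (k+1)c Z X^k v, so each Y raises the order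
    of X by at most one. *)
Lemma heis_XYpow k m v : iter k X v = 0 -> iter (k + m) X (iter m Y v) = 0.
Proof.
elim: m k v => [|m IH] k v Xv; first by rewrite addn0.
rewrite iterSr addnS -addSn; apply: IH; rewrite heis_iterX /= Xv.
by rewrite !linear0 addr0.
Qed.

(** As X v = 0, each X applied to Y^m v turns one Y into a multiple of Z, and Z^k v = 0. *)
Lemma heis_kill k m v : X v = 0 -> iter k Z v = 0 -> iter k X (iter m Y v) = 0.
Proof.
elim: k m v => [|k IH] m v Xv Zv; first by rewrite [v]Zv iter_linear0.
have ZY u : Z (iter m.-1 Y u) = iter m.-1 Y (Z u) by exact: (@iter_comm _ _ 1).
rewrite iterSr heis_iterY Xv iter_linear0 add0r iterZlin ZY IH ?scaler0 //.
- by rewrite XZ Xv linear0.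
- by rewrite -iterSr.
Qed.

End Heisenberg.

(** * Representations and noncommutative polynomials *)

Section MatrixUnits.
Variables (K : fieldType) (n : nat).

(** Indexed by all of nat and zero unless i < j < n, so that the brackets of [lieb_unit] carry no
    bound by n. *)
Definition unit_mx (i j : nat) : 'M[K]_n := \matrix_(a, b) ((i < j)%N && ((a == i :> nat) && (b == j :> nat)))%:R.

Lemma unit_mx_upper i j : unit_mx i j \in upper (K:=K) (n:=n).
Proof.
apply/upperP => a b ba; rewrite mxE; case: ltnP => //= ij.
by case: eqP => //= ai; case: eqP => //= bj; lia.
Qed.

Definition E (i j : nat) : borel K n := Borel (unit_mx_upper i j).

Lemma unit_mxM i j k l : (i < j)%N -> (k < l)%N ->
  unit_mx i j *m unit_mx k l = (j == k)%:R *: unit_mx i l.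
Proof.
move=> ij kl; apply/matrixP => a b; rewrite !mxE.
have [jn|jn] := ltnP j n; last first.
  rewrite big1 => [|c _]; last first.
    rewrite !mxE; suff -> : (c == j :> nat) = false by rewrite !andbF mul0r.
    by have := ltn_ord c; lia.
  case: eqP => [jk|_]; last by rewrite mul0r.
  by suff -> : (b == l :> nat) = false; [rewrite !andbF mulr0 | have := ltn_ord b; lia].
rewrite (bigD1 (Ordinal jn)) //= big1 => [|c cj]; last first.
  rewrite !mxE; suff -> : (c == j :> nat) = false by rewrite !andbF mul0r.
  by apply: contraNF cj => /eqP cj; apply/eqP/val_inj.
rewrite addr0 !mxE /= eqxx ij kl.
have [jk|] := eqVneq j k; last by rewrite mulr0 mul0r.
have -> : (i < l)%N by lia.
by rewrite !andbT mul1r -natrM mulnb.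
Qed.

Lemma lieb_unit i j k l : (i < j)%N -> (k < l)%N ->
  lieb (E i j) (E k l) = (j == k)%:R *: E i l - (l == i)%:R *: E k j.
Proof. by move=> ij kl; apply: val_inj; rewrite /= !unit_mxM. Qed.

Definition eps (i : nat) : 'rV[int]_n := \row_a (a == i :> nat)%:Z.

Lemma pairingDl (lam mu : 'rV[int]_n) (h : borel K n) :
  pairing (lam + mu) h = pairing lam h + pairing mu h.
Proof.
by rewrite /pairing -big_split; apply: eq_bigr => i _; rewrite /= mxE intrD mulrDl.
Qed.

Lemma pairingNl (lam : 'rV[int]_n) (h : borel K n) : pairing (- lam) h = - pairing lam h.
Proof.
by rewrite /pairing -sumrN; apply: eq_bigr => i _; rewrite /= mxE intrN mulNr.
Qed.

Lemma diag_unit (h : borel K n) i j : diagonal h -> (i < j)%N ->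
  lieb h (E i j) = pairing (eps i - eps j) h *: E i j.
Proof.
move=> /is_diag_mxP hd ij; apply: val_inj; apply/matrixP => a b /=.
have hE (c d : 'I_n) : bval h c d = bval h c c *+ (c == d).
  by case: eqVneq => [<-|/hd] //.
rewrite !mxE ij /=.
rewrite (bigD1 a) //= big1 => [|c ca]; last first.
  by rewrite hE eq_sym (negPf ca) mul0r.
rewrite [X in _ - X](bigD1 b) //= [X in _ - (_ + X)]big1 => [|c cb]; last first.
  by rewrite (hE c) (negPf cb) mulr0.
rewrite !mxE ij /= !addr0.
have [ai|] := eqVneq (a : nat) i; last by rewrite /= mulr0 mul0r subr0 mulr0.
have [bj|] := eqVneq (b : nat) j; last by rewrite /= mulr0 mul0r subr0 mulr0.
rewrite /= mulr1 mul1r mulr1 pairingDl pairingNl.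
by congr (_ - _); rewrite /pairing; [rewrite (bigD1 a) // | rewrite (bigD1 b) //];
  rewrite /= big1 => [|c cN]; rewrite ?mxE ?ai ?bj ?eqxx ?mul1r ?addr0 //;
  [rewrite -ai | rewrite -bj]; rewrite (inj_eq val_inj) (negPf cN) mul0r.
Qed.

Lemma bvalD (x y : borel K n) : bval (x + y) = bval x + bval y. Proof. by []. Qed.
Lemma bval_sum I (r : seq I) (F : I -> borel K n) :
  bval (\sum_(i <- r) F i) = \sum_(i <- r) bval (F i).
Proof. by elim/big_rec2: _ => // i y x _ <-. Qed.

Lemma bval_units (y : 'I_n -> 'I_n -> K) :
  bval (\sum_(a < n) \sum_(b < n) y a b *: E a b) =
  \sum_(a < n) \sum_(b < n) y a b *: unit_mx a b.
Proof. by rewrite bval_sum; apply: eq_bigr => a _; rewrite bval_sum. Qed.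

Lemma borel_decomp (x : borel K n) :
  exists2 h : borel K n, diagonal h &
    x = h + \sum_(a < n) \sum_(b < n) bval x a b *: E a b.
Proof.
pose h := \matrix_(a, b) (bval x a b *+ (a == b)).
have hu : h \in upper (K:=K) (n:=n).
  by apply/upperP => a b ba; rewrite mxE; case: eqP ba => // ->; rewrite ltnn.
exists (Borel hu); first by apply/is_diag_mxP => a b ab; rewrite mxE -val_eqE /= (negPf ab).
apply: val_inj; rewrite -[LHS]/(bval x) -[RHS]/(bval _) bvalD bval_units.
apply/matrixP => i j; rewrite !mxE summxE (bigD1 i) //=.
rewrite [X in _ = _ + (_ + X)]big1 => [|a ai]; last first.
  rewrite summxE big1 // => b _; rewrite !mxE [i == a :> nat](_ : _ = false) ?andbF ?mulr0 //.
  by apply: contraNF ai => /eqP/val_inj->.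
rewrite addr0 summxE (bigD1 j) //= [X in _ = _ + (_ + X)]big1 => [|a ai]; last first.
  rewrite !mxE [j == a :> nat](_ : _ = false) ?andbF ?mulr0 //.
  by apply: contraNF ai => /eqP/val_inj->.
rewrite addr0 !mxE !eqxx !andbT.
have [ij|ji|/val_inj ->] := ltngtP i j.
- by rewrite -val_eqE /= ltn_eqF // mulr0n add0r mulr1.
- have /upperP -> := bvalP x => //; by rewrite mul0r mul0rn addr0.
- by rewrite eqxx mulr0 addr0.
Qed.

End MatrixUnits.

(* Representations of the Lie algebra of strictly upper triangular matrices of arbitrary size. *)
Record nrep (K : fieldType) := NRep {
  ncar :> lmodType K;
  nop : nat -> nat -> ncar -> ncar;
  nop_linear : forall i j, linear (nop i j);
  nop_ge : forall i j m, (j <= i)%N -> nop i j m = 0;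
  nop_swap : forall i j k l m, (i < j)%N -> (k < l)%N ->
    nop i j (nop k l m) =
    nop k l (nop i j m) + ((j == k)%:R *: nop i l m - (l == i)%:R *: nop k j m) }.

HB.instance Definition _ (K : fieldType) (M : nrep K) (i j : nat) :=
  GRing.isLinear.Build K M M _ (@nop K M i j) (@nop_linear K M i j).

Local Notation e i j := (nop i j).

Section NilpotentAction.
Variables (K : fieldType) (M : nrep K).

Lemma e_comm (i j k l : nat) (m : M) : (i < j)%N -> (k < l)%N -> j != k -> l != i ->
  e i j (e k l m) = e k l (e i j m).
Proof.
by move=> ij kl jk li; rewrite nop_swap // (negPf jk) (negPf li) !scale0r subrr addr0.
Qed.

Lemma e_heis (i j k : nat) (m : M) : (i < j)%N -> (j < k)%N ->
  e i j (e j k m) = e j k (e i j m) + (1 : K) *: e i k m.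
Proof.
move=> ij jk; rewrite nop_swap // eqxx; suff /negPf -> : k != i by rewrite scale0r subr0.
by apply/eqP; lia.
Qed.

Lemma e_heisN (i j k : nat) (m : M) : (i < j)%N -> (j < k)%N ->
  e j k (e i j m) = e i j (e j k m) + (-1 : K) *: e i k m.
Proof. by move=> ij jk; rewrite (e_heis m ij jk) scale1r scaleN1r addrK. Qed.

Definition evw (q : seq (nat * nat)) (m : M) : M := foldr (fun ij v => e ij.1 ij.2 v) m q.

Lemma evw_linear q : linear (evw q).
Proof. by move=> a u v; elim: q => //= ij q ->; rewrite linearP. Qed.
HB.instance Definition _ q := GRing.isLinear.Build K M M _ (evw q) (@evw_linear q).

Lemma evw_cons ij q m : evw (ij :: q) m = e ij.1 ij.2 (evw q m). Proof. by []. Qed.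

Lemma evw_cat q q' (m : M) : evw (q ++ q') m = evw q (evw q' m).
Proof. by rewrite /evw foldr_cat. Qed.

(* Noncommutative polynomials in the [e i j], standing for elements of U(n). *)
Definition ncpoly := seq (K * seq (nat * nat)).

Definition ev (p : ncpoly) (m : M) : M := \sum_(q <- p) q.1 *: evw q.2 m.

Lemma ev_linear p : linear (ev p).
Proof.
move=> a u v; rewrite /ev scaler_sumr -big_split; apply: eq_bigr => q _ /=.
by rewrite linearP scalerDr !scalerA mulrC.
Qed.
HB.instance Definition _ p := GRing.isLinear.Build K M M _ (ev p) (ev_linear p).

Lemma ev_cat (p p' : ncpoly) (m : M) : ev (p ++ p') m = ev p m + ev p' m.
Proof. by rewrite /ev big_cat. Qed.

Definition pscale (a : K) (p : ncpoly) : ncpoly := [seq (a * q.1, q.2) | q <- p].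

Lemma ev_scale a (p : ncpoly) (m : M) : ev (pscale a p) m = a *: ev p m.
Proof. by rewrite /ev big_map scaler_sumr; apply: eq_bigr => q _; rewrite scalerA. Qed.

Definition pmulw (s : seq (nat * nat)) (p : ncpoly) : ncpoly := [seq (q.1, s ++ q.2) | q <- p].

Lemma ev_mulw s (p : ncpoly) (m : M) : ev (pmulw s p) m = evw s (ev p m).
Proof.
rewrite /ev big_map linear_sum; apply: eq_bigr => q _ /=.
by rewrite evw_cat linearZ.
Qed.

End NilpotentAction.

Section Action.
Variables (K : fieldType) (n : nat).
Implicit Types M : bmodule K n.

Lemma bactDl M (x y : borel K n) (m : M) : bact (x + y) m = bact x m + bact y m.
Proof. by rewrite -[x]scale1r bact_linearl scale1r scale1r. Qed.

Lemma bactZl M a (x : borel K n) (m : M) : bact (a *: x) m = a *: bact x m.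
Proof.
have bact0 : bact (0 : borel K n) m = 0.
  have := bact_linearl m 1 0 0; rewrite !scale1r addr0.
  by rewrite -[LHS]addr0 => /addrI <-.
by rewrite -[a *: x]addr0 bact_linearl bact0 addr0.
Qed.

Lemma bact_suml M I (r : seq I) (P : pred I) (F : I -> borel K n) (m : M) :
  bact (\sum_(i <- r | P i) F i) m = \sum_(i <- r | P i) bact (F i) m.
Proof.
elim/big_rec2: _ => [|i y x _ <-]; last by rewrite bactDl.
by rewrite -(scale0r (0 : borel K n)) bactZl scale0r.
Qed.

Lemma bact_swap M (x y : borel K n) (m : M) :
  bact x (bact y m) = bact y (bact x m) + bact (lieb x y) m.
Proof. by rewrite bact_lie addrC subrK. Qed.

Lemma bact_unit_swap M (i j k l : nat) (m : M) : (i < j)%N -> (k < l)%N ->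
  bact (E K n i j) (bact (E K n k l) m) = bact (E K n k l) (bact (E K n i j) m) +
    ((j == k)%:R *: bact (E K n i l) m - (l == i)%:R *: bact (E K n k j) m).
Proof.
by move=> ij kl; rewrite bact_swap lieb_unit // bactDl -[- (_ *: E _ _ _ _)]scaleN1r !bactZl scaleN1r.
Qed.

Lemma unit_mx_le (i j : nat) : (j <= i)%N -> E K n i j = 0.
Proof.
move=> ji; apply: val_inj; apply/matrixP => a b; rewrite !mxE.
by rewrite ltnNge ji.
Qed.

Lemma unit_mx_ge (i j : nat) : (n <= j)%N -> E K n i j = 0.
Proof.
move=> ji; apply: val_inj; apply/matrixP => a b; rewrite !mxE.
by rewrite [b == j :> nat]ltn_eqF ?andbF // (leq_trans (ltn_ord b)).
Qed.

Lemma bact0l M (m : M) : bact (0 : borel K n) m = 0.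
Proof. by rewrite -(scale0r (0 : borel K n)) bactZl scale0r. Qed.

Lemma bact_unit_ge M i j (m : M) : (j <= i)%N -> bact (E K n i j) m = 0.
Proof. by move=> ji; rewrite unit_mx_le // bact0l. Qed.

(** Made canonical, so that [e i j m] and [ev p m] can be written for m in a module over the Borel
    algebra. *)
Definition nrep_of M : nrep K :=
  NRep (fun i j => bact_linear (E K n i j)) (@bact_unit_ge M) (@bact_unit_swap M).
Canonical nrep_of.

Lemma eE M i j (m : M) : e i j m = bact (E K n i j) m. Proof. by []. Qed.

Lemma wtspace0 M mu : wtspace mu (0 : M).
Proof. by move=> h _; rewrite linear0 scaler0. Qed.

Lemma wtspaceD M mu (u v : M) : wtspace mu u -> wtspace mu v -> wtspace mu (u + v).
Proof. by move=> Hu Hv h hd; rewrite linearD /= Hu // Hv // scalerDr. Qed.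

Lemma wtspaceZ M mu a (u : M) : wtspace mu u -> wtspace mu (a *: u).
Proof. by move=> Hu h hd; rewrite linearZ /= Hu // !scalerA mulrC. Qed.

Lemma e_wt M mu (i j : nat) (m : M) : wtspace mu m -> wtspace (mu + (eps n i - eps n j)) (e i j m).
Proof.
move=> Hm h hd; rewrite eE; have [ij|ji] := ltnP i j; last by rewrite unit_mx_le // bact0l scaler0 linear0.
by rewrite bact_swap diag_unit // Hm // linearZ /= bactZl -scalerDl -pairingDl.
Qed.

Definition wtw (q : seq (nat * nat)) : 'rV[int]_n := \sum_(ij <- q) (eps n ij.1 - eps n ij.2).

Lemma evw_wt M mu q (m : M) : wtspace mu m -> wtspace (mu + wtw q) (evw q m).
Proof.
move=> Hm; elim: q => [|ij q IH]; first by rewrite /wtw big_nil addr0.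
by rewrite /wtw big_cons [_ + \sum_(_ <- _) _]addrC addrA; exact: e_wt.
Qed.

(** The polynomial whose value at a vector m of weight mu is x applied to [ev p m]: the diagonal of
    x scales a monomial q by its weight mu + [wtw q], and each other entry of x prepends one letter.
    Letters (a, b) with b <= a act by zero. *)
Definition pact (mu : 'rV[int]_n) (x : borel K n) (p : ncpoly K) : ncpoly K :=
  flatten [seq (pairing (mu + wtw q.2) x * q.1, q.2) ::
    [seq (bval x ab.1 ab.2 * q.1, (ab.1 : nat, ab.2 : nat) :: q.2) | ab <- enum [set: 'I_n * 'I_n]]
    | q <- p].

Lemma pairing_diag (mu : 'rV[int]_n) (x h : borel K n) :
  (forall i, bval x i i = bval h i i) -> pairing mu x = pairing mu h.
Proof. by move=> xh; apply: eq_bigr => i _; rewrite xh. Qed.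

Lemma ev_pact M mu x (p : ncpoly K) (m : M) : wtspace mu m -> ev (pact mu x p) m = bact x (ev p m).
Proof.
move=> Hm; rewrite /ev big_flatten big_map linear_sum; apply: eq_bigr => q _.
rewrite linearZ /= big_cons big_map /=.
have [h hd xE] := borel_decomp x.
rewrite [in RHS]xE bactDl scalerDr; congr (_ + _).
  have -> : pairing (mu + wtw q.2) x = pairing (mu + wtw q.2) h.
    apply: pairing_diag => i; rewrite xE bvalD bval_units mxE summxE big1 ?addr0 // => a _.
    rewrite summxE big1 // => b _; rewrite !mxE.
    case: (ltnP a b) => [ab|_]; last by rewrite mulr0.
    have [ia|_] := eqVneq (i : nat) a; last by rewrite mulr0.
    by rewrite ia ltn_eqF // mulr0.
  by rewrite (evw_wt q.2 Hm) // scalerA mulrC.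
rewrite bact_suml scaler_sumr big_enum /= (eq_bigl xpredT) => [|ab]; last by rewrite inE.
rewrite -(pair_big_dep xpredT (fun _ => xpredT)
  (fun (a b : 'I_n) => (bval x a b * q.1) *: e a b (evw q.2 m))) /=.
apply: eq_bigr => a _; rewrite bact_suml scaler_sumr; apply: eq_bigr => b _.
by rewrite bactZl scalerA mulrC.
Qed.

(** On a weight vector the diagonal matrices act on each monomial by a scalar, so U(b)u is already
    swept out by words in the e_ij. *)
Lemma Ugen_ev M mu (u z : M) : wtspace mu u -> Ugen u z -> exists p, z = ev p u.
Proof.
move=> Hu; elim=> [||v w _ [p ->] _ [p' ->]|a v _ [p ->]|x v _ [p ->]].
- by exists [:: (1, [::])]; rewrite /ev big_seq1 scale1r.
- by exists [::]; rewrite /ev big_nil.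
- by exists (p ++ p'); rewrite ev_cat.
- by exists (pscale a p); rewrite ev_scale.
- by exists (pact mu x p); rewrite (ev_pact _ _ Hu).
Qed.

End Action.

Lemma linear_at0 (K : fieldType) (L L' : lmodType K) (f : L -> L') : linear f -> f 0 = 0.
Proof. by move=> lin; have := lin (-1) 0 0; rewrite !scaleN1r !addNr. Qed.

Lemma ev_hom (K : fieldType) (M M' : nrep K) (f : M -> M') : linear f ->
  (forall i j v, f (e i j v) = e i j (f v)) -> forall p m, f (ev p m) = ev p (f m).
Proof.
move=> lin fe p m; rewrite /ev; elim: p => [|q p IH]; first by rewrite !big_nil linear_at0.
rewrite !big_cons lin IH; congr (_ *: _ + _).
by elim: q.2 => //= ij s <-.
Qed.

(** * Defining relations and transitions *)

Section UnitPowers.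
Variables (K : fieldType) (charK0 : [pchar K] =i pred0) (M : nrep K).
Implicit Types x : M.

Lemma e_iter_comm i j k l p q x : (i < j)%N -> (k < l)%N -> j != k -> l != i ->
  iter p (e i j) (iter q (e k l) x) = iter q (e k l) (iter p (e i j) x).
Proof. by move=> ij kl jk li; apply: iter_comm => v; exact: e_comm. Qed.

Section Triple.
Variables (i j k : nat) (ij : (i < j)%N) (jk : (j < k)%N).

Let ik : (i < k)%N. Proof. exact: ltn_trans jk. Qed.
Let ijk (v : M) : e i j (e i k v) = e i k (e i j v).
Proof. by apply: e_comm => //; apply/eqP; lia. Qed.
Let jki (v : M) : e j k (e i k v) = e i k (e j k v).
Proof. by apply: e_comm => //; apply/eqP; lia. Qed.
Let one0 : (1 : K) != 0. Proof. exact: oner_neq0. Qed.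
Let mone0 : (-1 : K) != 0. Proof. by rewrite oppr_eq0 oner_neq0. Qed.

Lemma e_heis_r a b p q x : iter a (e i j) x = 0 -> iter b (e j k) x = 0 ->
  (a + b <= (p + q).+1)%N -> iter p (e i k) (iter q (e j k) x) = 0.
Proof. exact: (heis_ZY charK0 one0 (fun v => e_heis v ij jk) ijk jki). Qed.

Lemma e_heis_l a b p q x : iter a (e i j) x = 0 -> iter b (e j k) x = 0 ->
  (a + b <= (p + q).+1)%N -> iter p (e i k) (iter q (e i j) x) = 0.
Proof.
move=> xa xb ab; apply: (heis_ZY charK0 mone0 (fun v => e_heisN v ij jk) jki ijk xb xa).
by rewrite addnC.
Qed.

(** The case q = 0 of [e_heis_r]: orders a and b of e_ij and e_jk bound the order of their
    commutator e_ik by a + b - 1. *)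
Lemma e_heis0 a b p x : iter a (e i j) x = 0 -> iter b (e j k) x = 0 ->
  (a + b <= p.+1)%N -> iter p (e i k) x = 0.
Proof. by move=> xa xb ab; apply: (@e_heis_r a b p 0) => //; rewrite addn0. Qed.

Lemma e_pow_shift q m x : iter q (e i j) x = 0 ->
  iter (q + m) (e i j) (iter m (e j k) x) = 0.
Proof. exact: (heis_XYpow (fun v => e_heis v ij jk) ijk). Qed.

Lemma e_kill_l q m x : e i j x = 0 -> iter q (e i k) x = 0 ->
  iter q (e i j) (iter m (e j k) x) = 0.
Proof. exact: (heis_kill (fun v => e_heis v ij jk) ijk jki). Qed.

Lemma e_kill_r q m x : e j k x = 0 -> iter q (e i k) x = 0 ->
  iter q (e j k) (iter m (e i j) x) = 0.
Proof. exact: (heis_kill (fun v => e_heisN v ij jk) jki ijk). Qed.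

End Triple.
End UnitPowers.

Section Counting.
Implicit Types P Q R : pred nat.

Lemma count_leU P Q R s : (forall c, P c -> Q c || R c) ->
  (count P s <= count Q s + count R s)%N.
Proof.
move=> PQR; rewrite -count_predUI; apply: leq_trans (leq_addr _ _).
exact: sub_count.
Qed.

Lemma count_geD P Q R s : (forall c, Q c -> P c) -> (forall c, R c -> P c) ->
  (forall c, Q c -> ~~ R c) -> (count Q s + count R s <= count P s)%N.
Proof.
move=> QP RP QR; rewrite -count_predUI [X in (_ + X)%N](_ : _ = 0%N) ?addn0; last first.
  apply/eqP; rewrite -leqn0 leqNgt -has_count -all_predC; apply/allP => c _ /=.
  by apply/negP => /andP[/QR/negP].
by apply: sub_count => c /orP[/QP|/RP].
Qed.

End Counting.

(** * Exchanging two values of a permutation *)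

Section Swaps.
Local Open Scope nat_scope.

Definition tp (a b x : nat) : nat := if x == a then b else if x == b then a else x.

Lemma tpK a b : cancel (tp a b) (tp a b).
Proof.
move=> x; rewrite /tp; have [->|xa] := eqVneq x a; first by rewrite eqxx; case: eqP.
by have [->|xb] := eqVneq x b; rewrite ?eqxx // (negPf xa) (negPf xb).
Qed.

Lemma tpP a b x : [\/ x = a /\ tp a b x = b, x = b /\ tp a b x = a | [/\ x <> a, x <> b & tp a b x = x]].
Proof.
rewrite /tp; have [->|/eqP xa] := eqVneq x a; first by constructor.
by have [->|/eqP xb] := eqVneq x b; [constructor 2|constructor 3].
Qed.

Variable (w : fperm) (a b : nat).

Lemma fswap_fix i : maxn (pbound w) (maxn a b).+1 <= i -> w (tp a b i) = i.
Proof. by move=> H; rewrite /tp !gtn_eqF ?pfix //; lia. Qed.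

Lemma fswapK : cancel (fun i => w (tp a b i)) (fun c => tp a b (pvalV w c)).
Proof. by move=> x; rewrite pvalK tpK. Qed.

Lemma fswapVK : cancel (fun c => tp a b (pvalV w c)) (fun i => w (tp a b i)).
Proof. by move=> x; rewrite tpK pvalVK. Qed.

(** Packaged as an opaque existence statement, so that [fswap] is not unfolded by simplification and
    is used only through its three equations. *)
Lemma fswap_exists : {u : fperm | [/\ forall i, u i = w (tp a b i),
  forall c, pvalV u c = tp a b (pvalV w c) & pbound u = maxn (pbound w) (maxn a b).+1]}.
Proof. by exists (FPerm fswapK fswapVK fswap_fix). Qed.

Definition fswap : fperm := sval fswap_exists.

Lemma fswapE i : fswap i = w (tp a b i).
Proof. by rewrite /fswap; case: fswap_exists => u /= []. Qed.

Lemma fswapVE c : pvalV fswap c = tp a b (pvalV w c).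
Proof. by rewrite /fswap; case: fswap_exists => u /= []. Qed.

Lemma fswap_bound : pbound fswap = maxn (pbound w) (maxn a b).+1.
Proof. by rewrite /fswap; case: fswap_exists => u /= []. Qed.

(** These case views record positions and values together, so that each branch of a case analysis on
    w t_ab becomes linear arithmetic. *)
Variant fswap_spec i : nat -> Prop :=
| FSwapL of i = a & w i = w a : fswap_spec i (w b)
| FSwapR of i = b & w i = w b : fswap_spec i (w a)
| FSwapO of i <> a & i <> b & w i <> w a & w i <> w b : fswap_spec i (w i).

Lemma fswapP i : fswap_spec i (fswap i).
Proof.
have winj : injective w := can_inj (@pvalK w).
by rewrite fswapE; have [[-> ->]|[-> ->]|[ia ib ->]] := tpP a b i; constructor=> // /winj.
Qed.

Variant fswapV_spec c : nat -> nat -> Prop :=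
| FSwapVL of c = w a : fswapV_spec c a b
| FSwapVR of c = w b : fswapV_spec c b a
| FSwapVO p of c = w p & p <> a & p <> b & c <> w a & c <> w b : fswapV_spec c p p.

Lemma fswapVP c : fswapV_spec c (pvalV w c) (pvalV fswap c).
Proof.
have cE := pvalVK w c; rewrite fswapVE.
have [[pa ->]|[pb ->]|[pa pb ->]] := tpP a b (pvalV w c).
- by rewrite pa; constructor; rewrite -pa cE.
- by rewrite pb; constructor; rewrite -pb cE.
- by constructor=> // cw; [apply: pa|apply: pb]; rewrite cw pvalK.
Qed.

Lemma posP c k : (pvalV w c = k /\ c = w k) \/ (pvalV w c <> k /\ c <> w k).
Proof.
have [<-|/eqP ck] := eqVneq (pvalV w c) k; first by rewrite pvalVK; left.
by right; split=> // cE; apply: ck; rewrite cE pvalK.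
Qed.

End Swaps.

Lemma pval_inj (w : fperm) : injective w. Proof. exact: can_inj (@pvalK w). Qed.

(** * How the relations of w pass to the terms of its transition *)

Section Relations.
Variable N : nat.

(** The cut-off N is only a bound for the values: every N >= w j gives the same number
    ([mm_bound]). *)
Definition mm (w : fperm) (i j : nat) : nat :=
  count (fun c => [&& w i < c, c < w j & j < pvalV w c]%N) (iota 0 N).

Definition kprel (K : fieldType) (M : nrep K) (w : fperm) (x : M) : Prop :=
  forall i j, (i < j)%N -> iter (mm w i j).+1 (e i j) x = 0.

Lemma count_iota_eq x : count (fun c => c == x) (iota 0 N) = (x < N)%N.
Proof. by rewrite (@count_uniq_mem _ _ x) ?iota_uniq // mem_iota. Qed.

Lemma mm_eq0 (w : fperm) i j : (forall k, j < k -> ~ (w i < w k < w j))%N -> mm w i j = 0%N.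
Proof.
move=> H; apply/eqP; rewrite -leqn0 leqNgt -has_count; apply/hasPn => c _.
by apply/negP => /and3P[ic cj /H]; rewrite pvalVK; lia.
Qed.

(* w s is the value exchanged with the last descent r in the transition formula for w. *)
Record transition (w : fperm) (r s : nat) : Prop := Transition {
  tr_rs : (r < s)%N;
  tr_ws : (w s < w r)%N;
  tr_inc : forall a b, (r < a)%N -> (a < b)%N -> (w a < w b)%N;
  tr_max : forall k, (r < k)%N -> (w k < w r)%N -> (w k <= w s)%N }.

(** With v = w t_rs, so that v r = w s, these are the i < r for which v t_ir covers v in Bruhat
    order: the terms of the transition formula. *)
Definition covers (w : fperm) (r s i : nat) : Prop :=
  [/\ i < r, w i < w s & forall k, i < k -> k < r -> ~ (w i < w k < w s)]%N.

Section Upper.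
Variables (K : fieldType) (charK0 : [pchar K] =i pred0) (M : nrep K).
Variables (w : fperm) (r s : nat) (tr : transition w r s).
Variables (x : M) (Rx : kprel w x).

Let rs : (r < s)%N. Proof. exact: tr_rs tr. Qed.
Let ws : (w s < w r)%N. Proof. exact: tr_ws tr. Qed.
Let inc a b : (r < a)%N -> (a < b)%N -> (w a < w b)%N. Proof. exact: tr_inc tr _ _. Qed.
Let wmax k : (r < k)%N -> (w k < w r)%N -> (w k <= w s)%N. Proof. exact: tr_max tr _. Qed.

Lemma rel_eq0 i j : (i < j)%N -> (forall k, j < k -> ~ (w i < w k < w j))%N -> e i j x = 0.
Proof. by move=> ij H; have := Rx ij; rewrite (mm_eq0 H). Qed.

(** An a that is not itself a cover has some k between a and r with w a < w k < w s. For the k of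
    least value, the values counted by m_ak lie beyond position r, so m_ak + m_kr <= m_ar; as e_ar =
    [e_ak, e_kr], the order of e_kr, known by induction on r - a, gives that of e_ar. The condition
    on the k >= i0 keeps the chain among positions below i0. *)
Lemma chain i0 : (i0 <= r)%N ->
  (forall l, covers w r s l -> (l < i0)%N -> iter (mm w l r) (e l r) x = 0) ->
  forall a, (a < i0)%N -> (w a < w s)%N ->
    (forall k, i0 <= k -> k < r -> ~ (w a < w k < w s))%N ->
  iter (mm w a r) (e a r) x = 0.
Proof.
move=> i0r Hl a; have [d] := ubnP (r - a); elim: d a => // d IH a rad ai0 was Ha.
have [[k [ak kr wk]]|nk] := pselect (exists k, [/\ a < k, k < r & w a < w k < w s]%N); last first.
  by apply: Hl => //; split=> [||k ak kr wk]; [lia|done|apply: nk; exists k].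
have [k0] : exists k, ([/\ a < k, k < r & w a < w k < w s] /\
    forall l, a < l -> l < r -> w a < w l < w s -> w k <= w l)%N.
  have exv : exists c, [&& a < pvalV w c, pvalV w c < r & w a < c < w s]%N.
    by exists (w k); rewrite pvalK ak kr wk.
  exists (pvalV w (ex_minn exv)); case: ex_minnP => c /and3P[ac cr wc] cmin.
  rewrite pvalVK; split=> [//|l al lr wl]; apply: cmin.
  by rewrite pvalK al lr wl.
case=> -[ak0 k0r wk0] kmin.
have k0i0 : (k0 < i0)%N by rewrite ltnNge; apply/negP => /Ha /(_ k0r); apply.
have Hk : iter (mm w k0 r) (e k0 r) x = 0.
  apply: IH => //; [lia|lia|] => l il lr wl; apply: (Ha l) => //; lia.
apply: (e_heis0 charK0 ak0 k0r (Rx ak0) Hk).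
rewrite addSn ltnS; apply: count_geD => c.
- move=> /and3P[]; rewrite -{1 2}(pvalVK w c); set p := pvalV w c => h1 h2 h3.
  have : (r < p)%N.
    rewrite ltnNge; apply/negP => pr; have [pE|pr'] := eqVneq p r; first by move: h2; rewrite pE; lia.
    have := kmin p; lia.
  rewrite -(pvalVK w c) -/p; lia.
- move=> /and3P[h1 h2 h3]; lia.
- move=> /and3P[h1 h2 h3]; lia.
Qed.

Let v := fswap w r s.

(** Only the pairs (a, r) with w a < w s are delicate: by the maximality of w s, replacing w r by w
    s loses at most the value w s, so m_ar drops by at most one, and [chain] supplies that one. For
    b > r the operator e_ab kills x, and for the other pairs m_ab does not drop. *)
Lemma transition_rel : (forall l, covers w r s l -> iter (mm w l r) (e l r) x = 0) ->
  kprel v x.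
Proof.
move=> Hl a b ab.
have [/andP[/eqP br was]|ne] := boolP ((b == r) && (w a < w s)%N).
  rewrite br; apply: (@iter_eq0_le _ _ _ (mm w a r)); last first.
    apply: (chain (leqnn r)) => //; [by move=> l /Hl|by rewrite -br|]; move=> k; lia.
  have V1 : (count (fun c => c == w s) (iota 0 N) <= 1)%N.
    by rewrite count_iota_eq leq_b1.
  apply: leq_trans (_ : _ <= mm v a r + 1)%N _; last by rewrite addn1.
  apply: leq_trans (leq_add (leqnn _) V1); apply: count_leU => c /and3P[h1 h2 h3] /=.
  have := @wmax (pvalV w c) h3; rewrite pvalVK => /(_ h2) cs.
  rewrite /v; case: (fswapP w r s a) => *; try lia.
  case: (fswapP w r s r) => *; try lia.
  by move: h3; case: (fswapVP w r s c) => *; lia.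
have [rb|br] := ltnP r b.
  apply: (@iter_eq0_le _ _ _ 1) => //; apply: rel_eq0 => // k bk.
  have := inc rb bk; lia.
apply: (@iter_eq0_le _ _ _ (mm w a b).+1); last exact: Rx.
rewrite ltnS; apply: sub_count => c /and3P[h1 h2 h3] /=.
have cs : (r <= pvalV w c -> b = r -> c <= w s)%N.
  by move=> _ bE; have := @wmax (pvalV w c); rewrite pvalVK -bE; apply=> //; rewrite bE in h2.
rewrite /v; case: (fswapP w r s a) => *; try lia.
by case: (fswapP w r s b) => *; move: h3 cs; case: (fswapVP w r s c) => *; lia.
Qed.

Variables (i : nat) (ci : covers w r s i).
Let ir : (i < r)%N. Proof. by case: ci. Qed.
Let wis : (w i < w s)%N. Proof. by case: ci. Qed.
Let cov k : (i < k)%N -> (k < r)%N -> ~ (w i < w k < w s)%N. Proof. by case: ci => _ _; apply. Qed.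
Let u := fswap v r i.
Let m := mm w i r.
Let y := iter m (e i r) x.
Hypothesis Hl : forall l, covers w r s l -> (l < i)%N -> iter (mm w l r) (e l r) x = 0.

Lemma top_i : u i = w s.
Proof. by rewrite /u !fswapE /tp (ltn_eqF ir) !eqxx. Qed.

Lemma top_r : u r = w i.
Proof. by rewrite /u !fswapE /tp eqxx (ltn_eqF ir) (ltn_eqF (ltn_trans ir rs)). Qed.

Lemma top_s : u s = w r.
Proof. by rewrite /u !fswapE /tp (gtn_eqF rs) (gtn_eqF (ltn_trans ir rs)) eqxx (gtn_eqF rs). Qed.

Lemma topE k : k != i -> k != r -> k != s -> u k = w k.
Proof. by move=> /negPf ki /negPf kr /negPf ks; rewrite /u !fswapE /tp ki kr kr ks. Qed.

Variant top_spec c : nat -> nat -> Prop :=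
| UVi of c = w i : top_spec c i r
| UVr of c = w r : top_spec c r s
| UVs of c = w s : top_spec c s i
| UVo p of c = w p & p <> i & p <> r & p <> s & c <> w i & c <> w r & c <> w s : top_spec c p p.

Lemma topVP c : top_spec c (pvalV w c) (pvalV u c).
Proof.
have cE := pvalVK w c; rewrite /u !fswapVE; set p := pvalV w c in cE *.
rewrite /tp; have [pr|/eqP pr] := eqVneq p r.
  rewrite pr (gtn_eqF rs) (gtn_eqF (ltn_trans ir rs)); constructor.
  by rewrite -pr cE.
have [ps|/eqP ps] := eqVneq p s.
  by rewrite ps eqxx; constructor; rewrite -ps cE.
have [pi|/eqP pi] := eqVneq p i.
  by rewrite (negPf (introN eqP pr)) pi; constructor; rewrite -pi cE.
rewrite (negPf (introN eqP pr)); constructor; rewrite -?cE //;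
  by move/pval_inj.
Qed.

Let uwmax c : (r < pvalV w c)%N -> (c < w r)%N -> (c <= w s)%N.
Proof. by move=> H1 H2; have := @wmax _ H1; rewrite pvalVK => /(_ H2). Qed.

Let ucov c : (i < pvalV w c)%N -> (pvalV w c < r)%N -> ~ (w i < c < w s)%N.
Proof. by move=> H1 H2; have := cov H1 H2; rewrite pvalVK. Qed.

Let U_big a b : (a < b)%N -> (r < b)%N -> e a b y = 0.
Proof.
move=> ab rb; have xb a' : (a' < b)%N -> e a' b x = 0.
  by move=> a'b; apply: rel_eq0 => // k bk; have := inc rb bk; lia.
have [->|/eqP ar] := eqVneq a r.
  by apply: (e_kill_r (q := 1) ir rb); apply: xb => //; exact: ltn_trans rb.
rewrite -[e a b y]/(iter 1 (e a b) y) /y e_iter_comm ?[iter 1 _ _]xb ?iter_linear0 //; apply/eqP; lia.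
Qed.

Let ycomm a b p : (a < b)%N -> b != i -> a != r ->
  iter p (e a b) y = iter m (e i r) (iter p (e a b) x).
Proof. by move=> ab bi ar; rewrite /y e_iter_comm // eq_sym. Qed.

Let ycomm0 a b p : (a < b)%N -> b != i -> a != r -> iter p (e a b) x = 0 -> iter p (e a b) y = 0.
Proof. by move=> ab bi ar xp; rewrite ycomm // xp iter_linear0. Qed.

Let y_kill : iter 1 (e i r) y = 0.
Proof. by rewrite /y -iterD add1n; apply: Rx. Qed.

(** If w a > w i then w a > w s, as i is a cover, and e_ar kills x by the maximality of w s. If w a
    < w i then e_ia kills x and e_ir = [e_ia, e_ar], so the Heisenberg estimate applies to powers of
    e_ir and e_ar, with m_ar(w) <= m_ar(u) + m. *)
Let U_r_right a : (i < a)%N -> (a < r)%N -> iter (mm u a r).+1 (e a r) y = 0.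
Proof.
move=> ia ar; have [wia|wai] := ltnP (w i) (w a).
  apply: (@iter_eq0_le _ _ _ 1) => //; apply: ycomm0 => //; try by apply/eqP; lia.
  apply: rel_eq0 => // k rk H; have := cov ia ar; have := @wmax k rk; lia.
have wai' : (w a < w i)%N by rewrite ltn_neqAle wai andbT (inj_eq (@pval_inj w)) gtn_eqF.
have e0 : e i a x = 0 by apply: rel_eq0 => // k ak; lia.
rewrite /y -e_iter_comm // ?(gtn_eqF ar) ?(ltn_eqF ir) //; try (by apply/eqP; lia).
apply: (@e_heis_r _ charK0 _ i a r ia ar 1 _ _ _ _ e0 (Rx ar)).
suff : (mm w a r <= mm u a r + m)%N by lia.
have as_ : a != s by apply/eqP; have := rs; lia.
rewrite /mm top_r (topE _ _ as_) ?(gtn_eqF ia) ?(ltn_eqF ar) //.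
apply: count_leU => c /and3P[h1 h2 h3].
have := uwmax h3 h2; move: h3; case: topVP => *; have := rs; lia.
Qed.

(** Here u r = w i. The commutator e_ar = [e_ai, e_ir] is enough if w a > w i, or if no value
    between w a and w i sits at a position between i and r. Otherwise the least such value, at
    position k, gives e_ar = [e_ak, e_kr] acting on y, where e_kr is handled by [U_r_right]. *)
Let U_r_left a : (a < i)%N -> iter (mm u a r).+1 (e a r) y = 0.
Proof.
move=> ai; have ar : (a < r)%N by apply: ltn_trans ir.
have as_ : (a < s)%N by apply: ltn_trans rs.
have uar : mm u a r = count (fun c => [&& w a < c, c < w i & r < pvalV u c]%N) (iota 0 N).
  by rewrite /mm top_r topE ?(ltn_eqF ai) ?(ltn_eqF ar) ?(ltn_eqF as_).
have [wia|wai] := ltnP (w i) (w a).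
  have e0 : e a i x = 0 by apply: rel_eq0 => // k ak; lia.
  apply: (@e_heis_r _ charK0 _ a i r ai ir 1 _ _ _ _ e0 (Rx ir)); rewrite -/m; lia.
have wai' : (w a < w i)%N by rewrite ltn_neqAle wai andbT (inj_eq (@pval_inj w)) ltn_eqF.
have [exv|nk] := pselect (exists c, [&& i < pvalV w c, pvalV w c < r & w a < c < w i]%N); last first.
  apply: (@e_heis_r _ charK0 _ a i r ai ir _ _ _ _ _ (Rx ai) (Rx ir)); rewrite -/m.
  suff : (mm w a i <= mm u a r)%N by lia.
  rewrite uar; apply: sub_count => c /and3P[h1 h2 h3].
  have : ~ (pvalV w c < r)%N by move=> cr; apply: nk; exists c; rewrite h3 cr h1.
  move: h3; case: topVP; have := rs; have := ir; move=> *; lia.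
pose c := ex_minn exv; pose k := pvalV w c.
have [ik kr wk kmin] : [/\ (i < k)%N, (k < r)%N, (w a < w k < w i)%N &
    forall l, (i < l)%N -> (l < r)%N -> (w a < w l < w i)%N -> (w k <= w l)%N].
  rewrite /k /c; case: ex_minnP => d /and3P[h1 h2 h3] dmin; rewrite pvalVK; split=> // l il lr wl.
  by apply: dmin; rewrite pvalK il lr wl.
have ak : (a < k)%N by apply: ltn_trans ik.
have Yak : iter (mm w a k).+1 (e a k) y = 0.
  by apply: ycomm0 => //; rewrite ?(gtn_eqF ik) ?(ltn_eqF ar) //; exact: Rx.
apply: (e_heis0 charK0 ak kr Yak (U_r_right ik kr)).
rewrite addSn ltnS addnS ltnS uar; apply: count_geD => d.
- move=> /and3P[h1 h2 h3]; have dr : (r < pvalV w d)%N.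
    rewrite ltnNge; apply/negP => dr; have [dE|/eqP dr'] := eqVneq (pvalV w d) r.
      by have := ws; rewrite -dE pvalVK; lia.
    have := kmin (pvalV w d); rewrite pvalVK; lia.
  move: dr h3; case: topVP; have := rs; have := ir; move=> *; lia.
- rewrite top_r topE ?(gtn_eqF ik) ?(ltn_eqF kr) ?(ltn_eqF (ltn_trans kr rs)) //; lia.
- rewrite top_r topE ?(gtn_eqF ik) ?(ltn_eqF kr) ?(ltn_eqF (ltn_trans kr rs)) //; lia.
Qed.

Let U_r a : (a < r)%N -> iter (mm u a r).+1 (e a r) y = 0.
Proof.
move=> ar; have [ai|ia|->] := ltngtP a i; [exact: U_r_left|exact: U_r_right|].
exact: (@iter_eq0_le _ _ _ 1).
Qed.

(** Here the hypothesis on the earlier covers l < i enters. As i is a cover and w i < w a, no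
    position from i to r - 1 carries a value between w a and w s, so [chain] applies with i0 = i. *)
Let chain_left a : (a < i)%N -> (w i < w a)%N -> (w a < w s)%N -> iter (mm w a r) (e a r) x = 0.
Proof.
move=> ai wia was; apply: (chain (ltnW ir) Hl) => // k.
rewrite leq_eqVlt => /orP[/eqP <-|ik kr H]; first by lia.
by apply: (cov ik kr); lia.
Qed.

(** Now u i = w s. For w a < w i the m factors e_ir raise the order of e_ai by at most m, and
    m_ai(u) >= m_ai(w) + m. For w a > w i the operator e_ai kills x, and e_ai^q e_ir^m x vanishes as
    soon as e_ar^q x does: [chain_left] provides q if w a < w s, and q = 1 works otherwise. *)
Let U_i a : (a < i)%N -> iter (mm u a i).+1 (e a i) y = 0.
Proof.
move=> ai; have ar : (a < r)%N by apply: ltn_trans ir.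
have as_ : (a < s)%N by apply: ltn_trans rs.
have uai : mm u a i = count (fun c => [&& w a < c, c < w s & i < pvalV u c]%N) (iota 0 N).
  by rewrite /mm top_i topE ?(ltn_eqF ai) ?(ltn_eqF ar) ?(ltn_eqF as_).
have [wai|wia] := ltnP (w a) (w i).
  apply: (@iter_eq0_le _ _ _ ((mm w a i).+1 + m)); last exact: (e_pow_shift ai ir _ (Rx ai)).
  rewrite addSn ltnS uai; pose R c := [&& w i < c, c < w s & r < pvalV w c]%N.
  (* The value w s, counted by m, is lost for u, but w i, which u has at position r, is gained in
     its place. *)
  have mR : (m <= count R (iota 0 N) + count (fun c => c == w i) (iota 0 N))%N.
    apply: leq_trans (_ : _ <= count R (iota 0 N) + count (fun c => c == w s) (iota 0 N))%N _.
      apply: count_leU => c /and3P[h1 h2 h3]; have := uwmax h3 h2; rewrite /R; lia.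
    by rewrite leq_add2l !count_iota_eq; case: ltnP => // wsN; rewrite (ltn_trans wis).
  apply: leq_trans (leq_add (leqnn _) mR) _.
  apply: leq_trans (leq_add (leqnn _) (_ : _ <= count (fun c => R c || (c == w i)) (iota 0 N))%N) _.
    by apply: count_geD => c; rewrite /R; lia.
  apply: count_geD => c; rewrite /R.
  - by move=> /and3P[h1 h2]; case: topVP; have := rs; have := ir; have := wis; move=> *; lia.
  - by case: topVP; have := rs; have := ir; have := wis; move=> *; lia.
  - move=> /and3P[h1 h2 h3]; lia.
have wia' : (w i < w a)%N by rewrite ltn_neqAle wia andbT (inj_eq (@pval_inj w)) gtn_eqF.
have e0 : e a i x = 0 by apply: rel_eq0 => // k ak; lia.
have [was|wsa] := ltnP (w a) (w s).
  apply: (@iter_eq0_le _ _ _ (mm w a r)); last exact: (e_kill_l ai ir _ e0 (chain_left _ _ _)).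
  have V1 : (count (fun c => c == w s) (iota 0 N) <= 1)%N.
    by rewrite count_iota_eq leq_b1.
  apply: leq_trans (_ : _ <= mm u a i + 1)%N _; last by rewrite addn1.
  apply: leq_trans (leq_add (leqnn _) V1); rewrite uai; apply: count_leU => c /and3P[h1 h2 h3].
  have := uwmax h3 h2; move: h3; case: topVP; have := rs; have := ir; move=> *; lia.
apply: (@iter_eq0_le _ _ _ 1) => //; apply: (e_kill_l ai ir _ e0).
apply: rel_eq0 => // k rk H; have := @wmax k rk; lia.
Qed.

Let U_lt a b : (a < b)%N -> (b < i)%N -> iter (mm u a b).+1 (e a b) y = 0.
Proof.
move=> ab bi; have br := ltn_trans bi ir; have bs := ltn_trans br rs.
apply: (@iter_eq0_le _ _ _ (mm w a b).+1); last first.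
  by apply: ycomm0; rewrite ?(ltn_eqF bi) ?(ltn_eqF (ltn_trans ab br)) //; exact: Rx.
rewrite ltnS; apply: sub_count => c /and3P[h1 h2 h3].
rewrite !topE ?(ltn_eqF bi) ?(ltn_eqF br) ?(ltn_eqF bs) ?(ltn_eqF (ltn_trans ab _)) //.
by move: h3; case: topVP; have := rs; have := ir; move=> *; lia.
Qed.

(* Here e_{ab} = [e_{ai}, e_{ib}], while y is killed by e_{ai}^(m_a) (where m_a = mm w a r) and
   by e_{ib}^(M + 1 - m_a) (where M = mm w a b); the latter comes from e_{ir} = [e_{ib}, e_{br}]. *)
Let U_mid_cross a b : (a < i)%N -> (i < b)%N -> (b < r)%N ->
  (w i < w a)%N -> (w a < w s)%N -> (w s < w b)%N ->
  iter (mm w a b) (e a b) y = 0.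
Proof.
move=> ai ib br wia was wsb; have ab := ltn_trans ai ib.
have ea : e a i x = 0 by apply: rel_eq0 => // k ak; lia.
have eb : iter 1 (e b r) x = 0.
  by apply: rel_eq0 => // k rk H; have := @wmax k rk; lia.
have Xy : iter (mm w a r) (e a i) y = 0 by exact: (e_kill_l ai ir _ ea (chain_left ai wia was)).
pose d := count (fun c => [&& w i < c, c < w a & r < pvalV w c]%N) (iota 0 N).
have dpos c : (i < pvalV w c)%N -> (w i < c < w a)%N -> (r < pvalV w c)%N.
  move=> ic wc; rewrite ltnNge; apply/negP => cr.
  have [cE|/eqP cE] := eqVneq (pvalV w c) r; first by have := ws; rewrite -cE pvalVK; lia.
  have := @ucov c ic; lia.
have md : (mm w a r + d <= m)%N.
  by apply: count_geD => c; rewrite /=; lia.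
have mb : (mm w i b <= mm w a b + d)%N.
  apply: count_leU => c /and3P[h1 h2 h3]; have := dpos c; have := posP w c a; move=> *; lia.
pose q := ((mm w a b).+1 - mm w a r)%N.
have Yy : iter q (e i b) y = 0.
  rewrite ycomm ?(gtn_eqF ib) ?(ltn_eqF ir) //.
  apply: (e_heis_l charK0 ib br (Rx ib) eb); rewrite -/m /q; lia.
have [qM|qM] := leqP (mm w a r) (mm w a b).+1.
  apply: (e_heis0 charK0 ai ib Xy Yy); rewrite /q; lia.
have q0 : q = 0%N by rewrite /q; lia.
by move: Yy; rewrite q0 /= => ->; rewrite iter_linear0.
Qed.

(** From w to u only the values w i, w r and w s change position. If w i < w a < w s < w b, the
    value w s alone is lost and [U_mid_cross] makes up for it; if w a < w i and w s < w b, its loss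
    is balanced by w i; in the other cases with a <> i the number m_ab does not drop. For a = i and
    w i < w b the estimate runs through e_ir = [e_ib, e_br], where e_br kills x. *)
Let U_mid a b : (a < b)%N -> (i < b)%N -> (b < r)%N -> iter (mm u a b).+1 (e a b) y = 0.
Proof.
move=> ab ib br; have bs := ltn_trans br rs.
have ub : u b = w b by rewrite topE ?(gtn_eqF ib) ?(ltn_eqF br) ?(ltn_eqF bs).
have covb := cov ib br.
have wib : w i != w b by rewrite (inj_eq (@pval_inj w)) ltn_eqF.
have wsb : w s != w b by rewrite (inj_eq (@pval_inj w)) gtn_eqF.
have [aE|ai] := eqVneq a i.
  have [wbi|] := ltnP (w b) (w i).
    apply: (@iter_eq0_le _ _ _ 1) => //; rewrite aE.
    apply: ycomm0; rewrite ?(gtn_eqF ib) ?(ltn_eqF ir) //.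
    by apply: rel_eq0 => // k bk; lia.
  move=> wib'; have eb : iter 1 (e b r) x = 0.
    apply: rel_eq0 => // k rk H; have := @wmax k rk; lia.
  rewrite aE ycomm ?(gtn_eqF ib) ?(ltn_eqF ir) //.
  apply: (e_heis_l charK0 ib br (Rx ib) eb); rewrite -/m.
  suff : (mm w i b <= mm u i b + m)%N by lia.
  rewrite /mm top_i ub; apply: count_leU => c /and3P[h1 h2 h3].
  have := @ucov c; move: h3; case: topVP; have := rs; have := ws; have := ir; move=> *; lia.
have ar := ltn_trans ab br; have as_ := ltn_trans ar rs.
have ua : u a = w a by rewrite topE ?(ltn_eqF ar) ?(ltn_eqF as_).
have wai : w a != w i by rewrite (inj_eq (@pval_inj w)).
have was : w a != w s by rewrite (inj_eq (@pval_inj w)) ltn_eqF.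
have cova : (i < a)%N -> ~ (w i < w a < w s)%N by move=> ia; exact: cov.
have [/and3P[h1 h2 h3]|hn] := boolP [&& w i < w a, w a < w s & w s < w b]%N.
  have ai' : (a < i)%N by lia.
  apply: (@iter_eq0_le _ _ _ (mm w a b)); last exact: U_mid_cross.
  have V1 : (count (fun c => c == w s) (iota 0 N) <= 1)%N by rewrite count_iota_eq leq_b1.
  apply: leq_trans (_ : _ <= mm u a b + 1)%N _; last by rewrite addn1.
  apply: leq_trans (leq_add (leqnn _) V1).
  rewrite /mm ua ub; apply: count_leU => c /and3P[g1 g2].
  case: topVP; have := rs; have := ir; move=> *; lia.
have Rab : iter (mm w a b).+1 (e a b) y = 0.
  by apply: ycomm0; rewrite ?(gtn_eqF ib) ?(ltn_eqF ar) //; exact: Rx.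
have [h1|h1] := boolP ((w a < w i) && (w s < w b))%N.
  apply: (@iter_eq0_le _ _ _ (mm w a b).+1) => //; rewrite ltnS.
  pose A c := [&& w a < c, c < w b & b < pvalV w c]%N && (c != w s).
  apply: leq_trans (_ : _ <= count A (iota 0 N) + count (fun c => c == w i) (iota 0 N))%N _.
    apply: leq_trans (_ : _ <= count A (iota 0 N) + count (fun c => c == w s) (iota 0 N))%N _.
      by apply: count_leU => c; rewrite /A; case: (c == w s) => /and3P[-> -> ->].
    by rewrite leq_add2l !count_iota_eq; case: ltnP => // wsN; rewrite (ltn_trans wis).
  rewrite /mm ua ub; apply: count_geD => c; rewrite /A.
  - by case: topVP; have := rs; have := ir; move=> *; lia.
  - by case: topVP; have := rs; have := ir; move=> *; lia.
  - by have := posP w c i; move=> *; lia.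
apply: (@iter_eq0_le _ _ _ (mm w a b).+1) => //; rewrite ltnS.
rewrite /mm ua ub; apply: sub_count => c /and3P[g1 g2].
case: topVP; have := rs; have := ws; have := ir; move=> *; lia.
Qed.

Lemma transition_rel_top : kprel u y.
Proof.
move=> a b ab; have [br|rb|bE] := ltngtP b r.
- have [bi|ib|bE] := ltngtP b i; [exact: U_lt|exact: U_mid|by move: ab; rewrite bE; exact: U_i].
- by apply: (@iter_eq0_le _ _ _ 1) => //; exact: U_big.
- by move: ab; rewrite bE; exact: U_r.
Qed.

End Upper.
End Relations.

(** * Fock space *)

Section CommutingFamily.
Variables (K : fieldType) (V : lmodType K) (I : eqType) (O : I -> {linear V -> V}).
Hypothesis OC : forall i j v, O i (O j v) = O j (O i v).
Hypothesis O2 : forall i v, O i (O i v) = 0.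

Definition sumop (s : seq I) (v : V) : V := \sum_(i <- s) O i v.

Lemma sumop_linear s : linear (sumop s).
Proof.
move=> a u v; rewrite /sumop scaler_sumr -big_split.
by apply: eq_bigr => i _; rewrite linearP.
Qed.
HB.instance Definition _ s := GRing.isLinear.Build K V V _ (sumop s) (sumop_linear s).

Lemma sumopC i s k v : O i (iter k (sumop s) v) = iter k (sumop s) (O i v).
Proof.
elim: k => //= k <-; rewrite /sumop linear_sum.
by apply: eq_bigr => j _; rewrite OC.
Qed.

Lemma sumop_filter (J : pred I) s k u : (forall i, i \in s -> ~~ J i -> O i u = 0) ->
  iter k (sumop s) u = iter k (sumop (filter J s)) u.
Proof.
move=> Ou; elim: k => //= k ->; rewrite {1}/sumop (bigID J) /=.
have -> : \sum_(i <- s | ~~ J i) O i (iter k (sumop (filter J s)) u) = 0.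
  rewrite big_seq_cond big1 // => i /andP[si Ji].
  by rewrite sumopC (Ou i si Ji) iter_linear0.
by rewrite addr0 /sumop big_filter.
Qed.

Lemma sumop_cons i s k v :
  iter k (sumop (i :: s)) v = iter k (sumop s) v + k%:R *: O i (iter k.-1 (sumop s) v).
Proof.
elim: k => [|k IH]; first by rewrite scale0r addr0.
rewrite iterS IH {1}/sumop big_cons !linearD !linearZ /= O2 scaler0 addr0.
rewrite -[\sum_(_ <- _) _]/(sumop s _) linearD linearZ /= addrCA; congr (_ + _).
case: k {IH} => [|k]; first by rewrite scale0r addr0 scale1r.
have SO u : sumop s (O i u) = O i (sumop s u) by exact: esym (sumopC i s 1 u).
by rewrite /= SO -[X in X + _]scale1r -scalerDl -[in RHS]natr1 addrC.
Qed.

(** For commuting operators of square zero the k-th power of the sum is k! times their elementary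
    symmetric function of degree k; so the top power is a factorial times the product and the next
    one is zero. *)
Lemma sumop_pow s v : iter (size s) (sumop s) v = (size s)`!%:R *: foldr (fun i u => O i u) v s /\
  iter (size s).+1 (sumop s) v = 0.
Proof.
elim: s v => [|i s IH] v; first by split; rewrite /= ?scale1r // /sumop big_nil.
have [IH1 IH2] := IH v.
have Z : iter (size s).+2 (sumop s) v = 0 by rewrite iterS IH2 linear0.
rewrite [size _]/=; split; rewrite sumop_cons [_.-1]/=.
  by rewrite IH2 add0r IH1 linearZ /= scalerA factS natrM.
by rewrite Z IH2 linear0 scaler0 addr0.
Qed.

End CommutingFamily.

Section Fock.
Variables (K : fieldType) (X : finType).

(** The exterior algebra of K^X, with a basis [st D] indexed by the subsets D of X, ordered by
    [enum_rank]. *)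
Definition fock : Type := {ffun {set X} -> K^o}.
HB.instance Definition _ := GRing.Lmodule.on fock.

Implicit Types (f : fock) (D : {set X}) (x y z : X).

Let lt x y := (enum_rank x < enum_rank y)%N.
Let s y x : K := (-1) ^+ lt y x.
(** The sign of moving x past the smaller elements of D. As x is not counted, adding x to D or
    removing it does not change the sign. *)
Definition sg x D : K := (-1) ^+ #|[set y in D | lt y x]|.

Lemma s_anti x y : x != y -> s y x = - s x y.
Proof.
rewrite /s /lt -(inj_eq enum_rank_inj) -val_eqE /=.
by case: ltngtP => // _ _; rewrite ?expr1 ?expr0 ?opprK.
Qed.

Lemma s_sq x y : s x y * s x y = 1.
Proof. by rewrite /s -expr2 sqrr_sign. Qed.

Lemma sg_sq x D : sg x D * sg x D = 1.
Proof. by rewrite /sg -expr2 sqrr_sign. Qed.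

Lemma sgU x y D : y \notin D -> sg x (y |: D) = s y x * sg x D.
Proof.
move=> yD; rewrite /sg /s -exprD; congr (_ ^+ _).
have -> : [set z in y |: D | lt z x] = (if lt y x then [set y] else set0) :|: [set z in D | lt z x].
  apply/setP => z; rewrite !inE; case: ifP => yx; rewrite !inE.
    by have [->|] := eqVneq z y; rewrite ?yx ?(negPf yD).
  by have [->|] := eqVneq z y; rewrite ?yx ?(negPf yD).
case: ifP => yx; last by rewrite set0U.
by rewrite cardsU1 !inE (negPf yD).
Qed.

Lemma sgD x y D : y \in D -> sg x (D :\ y) = s y x * sg x D.
Proof.
move=> yD; have yD' : y \notin D :\ y by rewrite !inE eqxx.
have := sgU x yD'; rewrite setD1K // => ->.
by rewrite mulrA s_sq mul1r.
Qed.

Lemma s_refl x : s x x = 1. Proof. by rewrite /s /lt ltnn. Qed.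

Lemma sgD_self x D : x \in D -> sg x (D :\ x) = sg x D.
Proof. by move=> xD; rewrite sgD // s_refl mul1r. Qed.

Lemma sgU_self x D : x \notin D -> sg x (x |: D) = sg x D.
Proof. by move=> xD; rewrite sgU // s_refl mul1r. Qed.

Definition cr x f : fock := [ffun D : {set X} => if x \in D then sg x D * f (D :\ x) else 0].
Definition an x f : fock := [ffun D : {set X} => if x \in D then 0 else sg x D * f (x |: D)].

Lemma cr_linear x : linear (cr x).
Proof.
move=> a f g; apply/ffunP => D; rewrite !ffunE; case: ifP => _; rewrite ?scaler0 ?addr0 //.
by rewrite mulrDr /GRing.scale /= mulrCA.
Qed.
HB.instance Definition _ x := GRing.isLinear.Build K fock fock _ (cr x) (cr_linear x).

Lemma an_linear x : linear (an x).
Proof.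
move=> a f g; apply/ffunP => D; rewrite !ffunE; case: ifP => _; rewrite ?scaler0 ?addr0 //.
by rewrite mulrDr /GRing.scale /= mulrCA.
Qed.
HB.instance Definition _ x := GRing.isLinear.Build K fock fock _ (an x) (an_linear x).

Lemma cr_cr x y f : cr x (cr y f) = - cr y (cr x f).
Proof.
apply/ffunP => D; rewrite !ffunE; have [<-|xy] := eqVneq x y.
  by rewrite !inE eqxx /=; case: ifP; rewrite ?mulr0 oppr0.
rewrite !inE xy eq_sym xy /=.
case: (boolP (x \in D)) => xD; case: (boolP (y \in D)) => yD; rewrite ?mulr0 ?oppr0 //.
rewrite !sgD // (s_anti xy) setDDl setDDl (setUC [set x]); ring.
Qed.

Lemma an_an x y f : an x (an y f) = - an y (an x f).
Proof.
apply/ffunP => D; rewrite !ffunE; have [<-|xy] := eqVneq x y.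
  by rewrite !inE eqxx /=; case: ifP; rewrite ?mulr0 oppr0.
rewrite !inE (negPf xy) eq_sym (negPf xy) /=.
case: (boolP (x \in D)) => xD; case: (boolP (y \in D)) => yD; rewrite ?mulr0 ?oppr0 //.
rewrite !sgU // (s_anti xy) setUCA; ring.
Qed.

Lemma an_cr x y f : an x (cr y f) = (x == y)%:R *: f - cr y (an x f).
Proof.
apply/ffunP => D; rewrite !ffunE /GRing.scale /=; have [<-|xy] := eqVneq x y.
  rewrite !inE eqxx /= mul1r; case: (boolP (x \in D)) => xD.
    by rewrite sgD_self // mulrA sg_sq mul1r setD1K // subrr.
  by rewrite sgU_self // mulrA sg_sq mul1r setU1K // subr0.
rewrite !inE (negPf xy) eq_sym (negPf xy) mul0r /= sub0r.
case: (boolP (x \in D)) => xD; case: (boolP (y \in D)) => yD; rewrite ?mulr0 ?oppr0 //.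
rewrite sgU // sgD // (s_anti xy).
have -> : (x |: D) :\ y = x |: D :\ y.
  by apply/setP => z; rewrite !inE; have [->|//] := eqVneq z x; rewrite xy.
ring.
Qed.

Definition st D : fock := [ffun D' : {set X} => (D' == D)%:R].

Lemma cr_st x D : x \notin D -> exists2 b : K, b != 0 & cr x (st D) = b *: st (x |: D).
Proof.
move=> xD; exists (sg x D); first by rewrite signr_eq0.
apply/ffunP => D'; rewrite !ffunE /GRing.scale /=; case: ifP => xD'; last first.
  by case: eqP xD' => [->|_ _]; rewrite ?mulr0 // !inE eqxx.
have -> : (D' :\ x == D) = (D' == x |: D).
  apply/eqP/eqP => [<-|->]; by rewrite ?setD1K ?setU1K.
by case: eqP => [->|_]; rewrite ?mulr0 // sgU_self //.
Qed.

Lemma cr_st0 x D : x \in D -> cr x (st D) = 0.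
Proof.
move=> xD; apply/ffunP => D'; rewrite !ffunE; case: ifP => // xD'.
by case: eqP xD => [<-|]; rewrite ?mulr0 // !inE eqxx.
Qed.

Lemma an_st x D : x \in D -> exists2 b : K, b != 0 & an x (st D) = b *: st (D :\ x).
Proof.
move=> xD; exists (sg x D); first by rewrite signr_eq0.
apply/ffunP => D'; rewrite !ffunE /GRing.scale /=; case: ifP => xD'.
  by case: eqP xD' => [->|_ _]; rewrite ?mulr0 // !inE eqxx.
have -> : (x |: D' == D) = (D' == D :\ x).
  by apply/eqP/eqP => [<-|->]; rewrite ?setD1K ?setU1K ?xD'.
by case: eqP => [->|_]; rewrite ?mulr0 // sgD_self //.
Qed.

Lemma an_st0 x D : x \notin D -> an x (st D) = 0.
Proof.
move=> xD; apply/ffunP => D'; rewrite !ffunE; case: ifP => // xD'.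
by case: eqP xD => [<-|]; rewrite ?mulr0 // !inE eqxx.
Qed.

Lemma st_neq0 D : st D != 0.
Proof.
by apply/eqP => /ffunP /(_ D); rewrite !ffunE eqxx => /eqP; rewrite oner_eq0.
Qed.

(** The matrix unit E_xy of gl(X), acting on the exterior algebra as a derivation. *)
Definition hop x y f : fock := cr x (an y f).
Lemma hop_linear x y : linear (hop x y).
Proof. by move=> a f g; rewrite /hop !linearP. Qed.
HB.instance Definition _ x y := GRing.isLinear.Build K fock fock _ (hop x y) (hop_linear x y).

Lemma hop_comm a b c d f : hop a b (hop c d f) =
  hop c d (hop a b f) + ((b == c)%:R *: hop a d f - (d == a)%:R *: hop c b f).
Proof.
have L p q t u : hop p q (hop t u f) = (q == t)%:R *: hop p u f + cr t (cr p (an q (an u f))).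
  by rewrite /hop an_cr linearB linearZ /= (cr_cr p t) opprK.
rewrite !L (cr_cr a c) (an_an d b) linearN /= linearN opprK.
by rewrite addrAC addrCA subrr addr0 addrC.
Qed.

Lemma hop_st x y D : x != y -> y \in D -> x \notin D ->
  exists2 b : K, b != 0 & hop x y (st D) = b *: st (x |: (D :\ y)).
Proof.
move=> xy yD xD; rewrite /hop; have [b b0 ->] := an_st yD; rewrite linearZ /=.
have [|c c0 ->] := @cr_st x (D :\ y); first by rewrite !inE (negPf xD) andbF.
by exists (b * c); rewrite ?mulf_neq0 // scalerA.
Qed.

Lemma hop_st0 x y D : x != y -> ~~ ((y \in D) && (x \notin D)) -> hop x y (st D) = 0.
Proof.
move=> xy; rewrite negb_and negbK => /orP[yD|xD]; rewrite /hop; first by rewrite an_st0 ?linear0.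
have [yD|yD] := boolP (y \in D); last by rewrite an_st0 ?linear0.
have [b _ ->] := an_st yD; rewrite linearZ /= cr_st0 ?scaler0 //.
by rewrite !inE xD xy.
Qed.

Section Moves.
Variables (charK0 : [pchar K] =i pred0) (I : finType) (src tgt : I -> X).
Hypotheses (src_inj : injective src) (tgt_inj : injective tgt).
Hypothesis src_tgt : forall i j, src i != tgt j.

Definition moves f : fock := \sum_i hop (tgt i) (src i) f.
Definition movable D : {set I} := [set i | (src i \in D) && (tgt i \notin D)].
Definition moved D : {set X} := tgt @: movable D :|: (D :\: src @: movable D).

Let O i : {linear fock -> fock} := hop (tgt i) (src i).

Let OC i j f : O i (O j f) = O j (O i f).
Proof.
rewrite /O /= hop_comm (negPf (src_tgt _ _)) (negPf (src_tgt _ _)).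
by rewrite !scale0r subrr addr0.
Qed.

Let an2 x f : an x (an x f) = 0.
Proof. by apply/ffunP => D; rewrite !ffunE !inE eqxx /=; case: ifP; rewrite ?mulr0. Qed.

Let O2 i f : O i (O i f) = 0.
Proof.
rewrite /O /= /hop an_cr (negPf (src_tgt _ _)) scale0r sub0r !linearN /=.
by rewrite an2 !linear0.
Qed.

(** No source is a target, so the hops commute and square to zero. Those that are not movable kill
    [st D] and drop out, and the top power of the sum of the others is a factorial times their
    product. With I the set of columns this gives the exact order of e_ij, with I the set of rows
    that of a column operator. *)
Lemma moves_pow D : (exists2 b : K, b != 0 & iter #|movable D| moves (st D) = b *: st (moved D)) /\
  iter #|movable D|.+1 moves (st D) = 0.
Proof.
have mE : moves = sumop O (index_enum I) by [].
pose J := [pred i | i \in movable D]; pose js := filter J (index_enum I).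
have szjs : #|movable D| = size js by rewrite /js size_filter -sum1_card sum1_count.
have Ou i : i \in index_enum I -> ~~ J i -> O i (st D) = 0.
  by move=> _ Ji; apply: hop_st0; [rewrite eq_sym|rewrite /= inE in Ji].
rewrite mE !(sumop_filter OC _ Ou) -/js szjs.
have [-> ->] := sumop_pow OC O2 js (st D); split => //.
have mem_js i : (i \in js) = (i \in movable D) by rewrite mem_filter mem_index_enum andbT.
pose mv (l : seq I) : {set X} := [set tgt i | i in l] :|: (D :\: [set src i | i in l]).
suff [b b0 ->] : exists2 b : K, b != 0 & foldr (fun i => O i) (st D) js = b *: st (mv js).
  exists ((size js)`!%:R * b); rewrite ?mulf_neq0 // ?scalerA.
    by have /pcharf0P -> := charK0; rewrite -lt0n fact_gt0.
  congr (_ *: st _); rewrite /mv /moved.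
  have eim (f : I -> X) : [set f i | i in js] = [set f i | i in movable D].
    by apply/setP => x; apply/imsetP/imsetP => -[i]; [rewrite mem_js|rewrite -mem_js]; exists i.
  by rewrite !eim.
have : {subset js <= movable D} by move=> i; rewrite mem_js.
have : uniq js by rewrite filter_uniq // index_enum_uniq.
elim: js {szjs mem_js} => [|i l IH] /=.
  exists 1; rewrite ?oner_neq0 // scale1r; congr st.
  by apply/setP => x; rewrite /mv !inE; apply/idP/orP => [xD|[/imsetP[]|/andP[]]] //;
    right; rewrite xD andbT; apply/imsetP => -[].
move=> /andP[il ul] sl; have [|b b0 ->] := IH ul.
  by move=> j jl; apply: sl; rewrite inE jl orbT.
have := sl i (mem_head _ _); rewrite inE => /andP[si ti].
rewrite linearZ /=.
have [| | |c c0 ->] := @hop_st (tgt i) (src i) (mv l).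
- by rewrite eq_sym.
- rewrite !inE si andbT; apply/orP; right; apply/imsetP => -[j jl /src_inj ij].
  by rewrite ij jl in il.
- rewrite !inE (negPf ti) andbF orbF; apply/imsetP => -[j jl /tgt_inj ij].
  by rewrite ij jl in il.
exists (b * c); rewrite ?mulf_neq0 // scalerA; congr (_ *: st _).
apply/setP => x; rewrite !inE.
have tE : (x \in [set tgt j | j in i :: l]) = (x == tgt i) || (x \in [set tgt j | j in l]).
  apply/imsetP/orP => [[j]|[/eqP ->|/imsetP[j jl ->]]].
  - by rewrite inE => /orP[/eqP -> ->|jl ->]; [left|right; apply: imset_f].
  - by exists i; rewrite // mem_head.
  - by exists j; rewrite // inE jl orbT.
have sE : (x \in [set src j | j in i :: l]) = (x == src i) || (x \in [set src j | j in l]).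
  apply/imsetP/orP => [[j]|[/eqP ->|/imsetP[j jl ->]]].
  - by rewrite inE => /orP[/eqP -> ->|jl ->]; [left|right; apply: imset_f].
  - by exists i; rewrite // mem_head.
  - by exists j; rewrite // inE jl orbT.
rewrite tE sE negb_or; have [->|_] := eqVneq x (tgt i) => //=.
have [->|//] := eqVneq x (src i) => /=.
by rewrite orbF; apply/esym/negP => /imsetP[j _ /eqP]; apply/negP.
Qed.

(** Written additively to avoid subtraction; with the row index as weight it controls [measure]. *)
Lemma moved_sum D (phi : X -> nat) :
  (\sum_(x in moved D) phi x + \sum_(i in movable D) phi (src i) =
   \sum_(x in D) phi x + \sum_(i in movable D) phi (tgt i))%N.
Proof.
have tD x : x \in tgt @: movable D -> x \notin D.
  by case/imsetP => i; rewrite inE => /andP[_ ti] ->.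
have sD : D :&: src @: movable D = src @: movable D.
  by apply/setIidPr/subsetP => x /imsetP[i]; rewrite inE => /andP[si _] ->.
rewrite (big_setID (tgt @: movable D)) /= (_ : moved D :&: _ = tgt @: movable D); last first.
  by apply/setIidPr; rewrite subsetUl.
rewrite (_ : moved D :\: _ = D :\: src @: movable D); last first.
  apply/setP => x; rewrite !in_setD !in_setU; have [/tD/negPf xD|_] := boolP (x \in tgt @: _).
    by rewrite !in_setD xD andbF.
  by rewrite /= in_setD.
have -> : (\sum_(x in D) phi x = \sum_(x in src @: movable D) phi x +
    \sum_(x in D :\: src @: movable D) phi x)%N by rewrite (big_setID (src @: movable D)) /= sD.
rewrite (big_imset _ (in2W tgt_inj)) (big_imset _ (in2W src_inj)) /=.
by rewrite addnC -[RHS]addnA; congr (_ + _)%N; rewrite addnC.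
Qed.

End Moves.
End Fock.

Section FockModule.
Variables (K : fieldType) (n N : nat).

Local Notation X := ('I_n * 'I_N)%type.
Local Notation F := (fock K X).
Implicit Types (f : F) (a b p q : 'I_n) (c d : 'I_N).

(** [rowop] and [colop] are the matrix units of gl_n and gl_N acting on the exterior algebra of the
    tensor product of K^n and K^N. *)
Definition rowop a b f : F := \sum_c hop (a, c) (b, c) f.
Definition colop c d f : F := \sum_a hop (a, c) (a, d) f.

Lemma rowop_linear a b : linear (rowop a b).
Proof.
move=> k u v; rewrite /rowop scaler_sumr -big_split.
by apply: eq_bigr => c _; rewrite linearP.
Qed.
HB.instance Definition _ a b := GRing.isLinear.Build K F F _ (rowop a b) (rowop_linear a b).

Lemma colop_linear c d : linear (colop c d).
Proof.
move=> k u v; rewrite /colop scaler_sumr -big_split.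
by apply: eq_bigr => a _; rewrite linearP.
Qed.
HB.instance Definition _ c d := GRing.isLinear.Build K F F _ (colop c d) (colop_linear c d).

Lemma sum_delta (I : finType) (i : I) (V : lmodType K) (G : I -> V) :
  \sum_j (i == j)%:R *: G j = G i.
Proof.
rewrite (bigD1 i) //= eqxx scale1r big1 ?addr0 // => j ji.
by rewrite eq_sym (negPf ji) scale0r.
Qed.

Lemma rowop_comm a b p q f : rowop a b (rowop p q f) = rowop p q (rowop a b f) +
  ((b == p)%:R *: rowop a q f - (q == a)%:R *: rowop p b f).
Proof.
have -> : rowop a b (rowop p q f) = \sum_c \sum_d hop (a, c) (b, c) (hop (p, d) (q, d) f).
  by rewrite {1}/rowop; apply: eq_bigr => c _; rewrite linear_sum.
have -> : rowop p q (rowop a b f) = \sum_c \sum_d hop (p, d) (q, d) (hop (a, c) (b, c) f).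
  by rewrite exchange_big {1}/rowop; apply: eq_bigr => c _; rewrite linear_sum.
rewrite /rowop !scaler_sumr -sumrB -big_split; apply: eq_bigr => c _ /=.
rewrite -[X in _ + (_ *: X - _)](sum_delta c (fun d => hop (a, c) (q, d) f)).
rewrite -[X in _ + (_ - _ *: X)](sum_delta c (fun d => hop (p, d) (b, c) f)).
rewrite !scaler_sumr -sumrB -big_split; apply: eq_bigr => d _ /=.
rewrite hop_comm !scalerA -!natrM !mulnb !xpair_eqE; congr (_ + (_ - (_%:R *: _))).
by rewrite (eq_sym d).
Qed.

(** The easy half of skew Howe duality: both parts of the commutator reduce to the single hop from
    (b, d) to (a, c), with opposite signs. *)
Lemma row_colop a b c d f : rowop a b (colop c d f) = colop c d (rowop a b f).
Proof.
have -> : rowop a b (colop c d f) = \sum_e \sum_p hop (a, e) (b, e) (hop (p, c) (p, d) f).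
  by rewrite {1}/rowop; apply: eq_bigr => e _; rewrite linear_sum.
have -> : colop c d (rowop a b f) = \sum_e \sum_p hop (p, c) (p, d) (hop (a, e) (b, e) f).
  by rewrite exchange_big {1}/colop; apply: eq_bigr => p _; rewrite linear_sum.
under eq_bigr => e _ do under eq_bigr => p _ do rewrite hop_comm.
under eq_bigr => e _ do rewrite big_split /=; rewrite big_split /= [X in _ + X](_ : _ = 0) ?addr0 //=.
under eq_bigr => e _ do rewrite sumrB; rewrite sumrB; apply/eqP; rewrite subr_eq0; apply/eqP.
transitivity (hop (a, c) (b, d) f).
  rewrite -(sum_delta c (fun e => hop (a, e) (b, d) f)); apply: eq_bigr => e _.
  rewrite -(sum_delta b (fun p => hop (a, e) (p, d) f)) scaler_sumr; apply: eq_bigr => p _.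
  by rewrite scalerA -natrM mulnb xpair_eqE andbC (eq_sym e).
rewrite -(sum_delta d (fun e => hop (a, c) (b, e) f)); apply: eq_bigr => e _.
rewrite -(sum_delta a (fun p => hop (p, c) (b, e) f)) scaler_sumr; apply: eq_bigr => p _.
by rewrite scalerA -natrM mulnb xpair_eqE andbC (eq_sym p).
Qed.

Definition fact (x : borel K n) f : F := \sum_a \sum_b bval x a b *: rowop a b f.

Lemma fact_linear x : linear (fact x).
Proof.
move=> k u v; rewrite /fact scaler_sumr -big_split; apply: eq_bigr => a _ /=.
rewrite scaler_sumr -big_split; apply: eq_bigr => b _ /=.
by rewrite linearP scalerDr !scalerA mulrC.
Qed.
HB.instance Definition _ x := GRing.isLinear.Build K F F _ (fact x) (fact_linear x).

Lemma rowop_fact a b x f : rowop a b (fact x f) = fact x (rowop a b f) +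
  (\sum_q bval x b q *: rowop a q f - \sum_p bval x p a *: rowop p b f).
Proof.
have -> : rowop a b (fact x f) = \sum_p \sum_q bval x p q *: rowop a b (rowop p q f).
  rewrite linear_sum; apply: eq_bigr => p _; rewrite linear_sum.
  by apply: eq_bigr => q _; rewrite linearZ.
under eq_bigr => p _ do under eq_bigr => q _ do rewrite rowop_comm scalerDr scalerBr !scalerA.
under eq_bigr => p _ do rewrite big_split /=; rewrite big_split /=; congr (_ + _) => /=.
under eq_bigr => p _ do rewrite sumrB; rewrite sumrB; congr (_ - _).
  rewrite exchange_big; apply: eq_bigr => q _.
  rewrite -(sum_delta b (fun p => bval x p q *: rowop a q f)); apply: eq_bigr => p _.
  by rewrite scalerA mulrC.
apply: eq_bigr => p _.
rewrite -(sum_delta a (fun q => bval x p q *: rowop p b f)); apply: eq_bigr => q _.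
by rewrite scalerA mulrC (eq_sym q).
Qed.

Lemma fact_lie x y f : fact (lieb x y) f = fact x (fact y f) - fact y (fact x f).
Proof.
apply/esym/eqP; rewrite subr_eq addrC; apply/eqP.
have -> : fact x (fact y f) = \sum_a \sum_b bval x a b *: rowop a b (fact y f) by [].
under eq_bigr => a _ do under eq_bigr => b _ do rewrite rowop_fact scalerDr.
under eq_bigr => a _ do rewrite big_split /=; rewrite big_split /=; congr (_ + _) => /=.
  by rewrite linear_sum; apply: eq_bigr => a _; rewrite linear_sum; apply: eq_bigr => b _; rewrite linearZ.
under eq_bigr => a _ do under eq_bigr => b _ do rewrite scalerBr.
under eq_bigr => a _ do rewrite sumrB; rewrite sumrB.
rewrite [fact (lieb x y) f](_ : _ = \sum_a \sum_b (bval x *m bval y) a b *: rowop a b f -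
    \sum_a \sum_b (bval y *m bval x) a b *: rowop a b f); last first.
  rewrite -sumrB; apply: eq_bigr => a _; rewrite -sumrB; apply: eq_bigr => b _.
  by rewrite -scalerBl; congr (_ *: _); rewrite /= !mxE.

congr (_ - _).
  apply: eq_bigr => a _; under eq_bigr => b _ do rewrite scaler_sumr.
  rewrite exchange_big; apply: eq_bigr => q _; rewrite mxE scaler_suml.
  by apply: eq_bigr => b _; rewrite scalerA.
under eq_bigr => a _ do under eq_bigr => b _ do rewrite scaler_sumr.
under eq_bigr => a _ do rewrite exchange_big.
rewrite exchange_big; apply: eq_bigr => p _; rewrite exchange_big; apply: eq_bigr => b _.
by rewrite mxE scaler_suml; apply: eq_bigr => a _; rewrite scalerA mulrC.
Qed.

Definition fockb : bmodule K n.
Proof.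
refine (@BModule K n F fact fact_linear _ fact_lie).
move=> f k x y; rewrite /fact scaler_sumr -big_split; apply: eq_bigr => a _ /=.
rewrite scaler_sumr -big_split; apply: eq_bigr => b _ /=.
by rewrite !mxE scalerDl scalerA.
Defined.

Lemma e_rowop (a b : 'I_n) (f : fockb) : (a < b)%N -> e a b f = rowop a b f.
Proof.
move=> ab; rewrite /= /fact (bigD1 a) //= [X in _ + X]big1 => [|p pa]; last first.
  rewrite big1 // => q _; rewrite !mxE [p == a :> nat](_ : _ = false) ?andbF ?scale0r //.
  by apply: contraNF pa => /eqP/val_inj->.
rewrite addr0 (bigD1 b) //= [X in _ + X]big1 => [|p pa]; last first.
  rewrite !mxE [p == b :> nat](_ : _ = false) ?andbF ?scale0r //.
  by apply: contraNF pa => /eqP/val_inj->.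
by rewrite addr0 !mxE ab !eqxx scale1r.
Qed.

Lemma e_fock0 i j (f : fockb) : ~~ ((i < j) && (j < n))%N -> e i j f = 0.
Proof.
rewrite eE negb_and -!leqNgt => /orP[ji|nj].
  by rewrite unit_mx_le // bact0l.
by rewrite unit_mx_ge // bact0l.
Qed.

Lemma fact_diag (x : borel K n) f (D : {set X}) : Defs.diagonal x ->
  (fact x f) D = (\sum_a bval x a a * #|[set c | (a, c) \in D]|%:R) * f D.
Proof.
move=> /is_diag_mxP xd; rewrite /fact sum_ffunE mulr_suml; apply: eq_bigr => a _.
rewrite (bigD1 a) //= big1 ?addr0 => [|b ba]; last by rewrite xd ?scale0r // eq_sym.
rewrite !ffunE /GRing.scale /= -mulrA; congr (_ * _).
rewrite /rowop sum_ffunE (eq_bigr (fun c => if (a, c) \in D then f D else 0)) => [|c _].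
  by rewrite -big_mkcond sumr_const mulr_natl; congr (_ *+ _); apply: eq_card => c; rewrite inE.
rewrite !ffunE; case: ifP => // cD.
by rewrite !inE eqxx /= sgD_self // mulrA sg_sq mul1r setD1K.
Qed.

Lemma an_rowop a b x f : an x (rowop a b f) = rowop a b (an x f) +
  (x.1 == a)%:R *: an (b, x.2) f.
Proof.
rewrite /rowop !linear_sum -[X in _ *: X](sum_delta x.2 (fun c => an (b, c) f)).
rewrite scaler_sumr -big_split; apply: eq_bigr => c _ /=.
rewrite /hop an_cr an_an linearN opprK addrC; congr (_ + _).
by rewrite scalerA -natrM mulnb -xpair_eqE -surjective_pairing.
Qed.

Lemma rowop_cr a b p c f : rowop a b (cr (p, c) f) = cr (p, c) (rowop a b f) +
  (b == p)%:R *: cr (a, c) f.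
Proof.
rewrite /rowop !linear_sum -[X in _ *: X](sum_delta c (fun d => cr (a, d) f)).
rewrite scaler_sumr -big_split; apply: eq_bigr => d _ /=.
rewrite /hop an_cr linearB linearZ /= (cr_cr (a, d)) opprK addrC; congr (_ + _).
by rewrite scalerA -natrM mulnb xpair_eqE (eq_sym d).
Qed.

End FockModule.

(** * Quotients and direct sums of representations *)

Section QuotientAndSum.
Variables (K : fieldType) (M : nrep K) (G : M -> Prop).
Hypothesis Gstable : forall i j z, G z -> e i j z \in lspanp G.

Definition qop i j (q : lquot G) : lquot G := toq G (e i j (repr q)).

Lemma qopE i j z : qop i j (toq G z) = toq G (e i j z).
Proof.
apply/toqE; rewrite -linearB; apply: lspan_stable => [v Gv|]; first exact: Gstable.
by apply/toqE; rewrite toqK.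
Qed.

Lemma qop_linear i j : linear (qop i j).
Proof. by move=> a s t; rewrite -[s]toqK -[t]toqK -linearP !qopE -!linearP. Qed.

Lemma qop_swap i j k l q : (i < j)%N -> (k < l)%N ->
  qop i j (qop k l q) = qop k l (qop i j q) + ((j == k)%:R *: qop i l q - (l == i)%:R *: qop k j q).
Proof.
move=> ij kl; rewrite -[q]toqK !qopE nop_swap // linearD linearB.
by congr (_ + (_ - _)); rewrite linearZ.
Qed.

Lemma qop_ge i j q : (j <= i)%N -> qop i j q = 0.
Proof. by move=> ji; rewrite -[q]toqK qopE nop_ge // linear0. Qed.

Definition nquot : nrep K := NRep qop_linear qop_ge qop_swap.

Definition toq' (z : M) : nquot := toq G z.

Lemma toq'_linear : linear toq'. Proof. exact: linearP. Qed.
HB.instance Definition _ := GRing.isLinear.Build K M nquot _ toq' toq'_linear.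

Lemma e_toq i j z : toq' (e i j z) = e i j (toq' z).
Proof. by rewrite /= /toq' qopE. Qed.

Lemma toq_eq0 z : toq' z = 0 <-> z \in lspanp G.
Proof.
rewrite /toq' -[0 : nquot](linear0 (toq G)) -[X in _ <-> X \in _]subr0.
exact: toqE.
Qed.

End QuotientAndSum.

Section DirectSum.
Variables (K : fieldType) (M M' : nrep K).

Definition sumact i j (z : M * M') : M * M' := (e i j z.1, e i j z.2).

Lemma sumact_linear i j : linear (sumact i j).
Proof. by move=> a u v; rewrite /sumact /= !linearP. Qed.

Lemma sumact_swap i j k l z : (i < j)%N -> (k < l)%N ->
  sumact i j (sumact k l z) = sumact k l (sumact i j z) +
    ((j == k)%:R *: sumact i l z - (l == i)%:R *: sumact k j z).
Proof.
move=> ij kl; rewrite [RHS]surjective_pairing; congr pair; exact: nop_swap.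
Qed.

Lemma sumact_ge i j z : (j <= i)%N -> sumact i j z = 0.
Proof. by move=> ji; rewrite /sumact !nop_ge. Qed.

Definition nsum : nrep K := @NRep K (M * M')%type sumact sumact_linear sumact_ge sumact_swap.

Lemma ev_sum p (z : M) (z' : M') : ev p ((z, z') : nsum) = (ev p z, ev p z').
Proof.
have evwE q : evw q ((z, z') : nsum) = (evw q z, evw q z') by elim: q => //= ij q ->.
rewrite /ev; elim: p => [|q p IH]; first by rewrite !big_nil.
by rewrite !big_cons IH evwE.
Qed.

Lemma iter_sum k i j (z : M) (z' : M') :
  iter k (e i j) ((z, z') : nsum) = (iter k (e i j) z, iter k (e i j) z').
Proof. by elim: k => //= k ->. Qed.

End DirectSum.

(** Nonempty words kill z, so c is the constant term of p. It is the same for all modules, which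
    lets a relation be carried from Fock space to any M. *)
Lemma ev_const (K : fieldType) (p : ncpoly K) : exists c : K,
  forall (M : nrep K) (z : M), (forall i j, e i j z = 0) -> ev p z = c *: z.
Proof.
exists (\sum_(q <- p | q.2 == [::]) q.1) => M z ez.
rewrite scaler_suml /ev (bigID (fun q => q.2 == [::])) /= [X in _ + X]big1 ?addr0 => [|[a q] /= q0].
  by apply: eq_bigr => -[a q] /= /eqP ->.
case: (lastP q) q0 => // s ij _; rewrite -cats1 evw_cat /= ez.
by rewrite [evw s 0]linear0 scaler0.
Qed.

Lemma fperm_lt (w : fperm) N i : (pbound w <= N)%N -> (i < N)%N -> (w i < N)%N.
Proof.
move=> bN iN; rewrite ltnNge; apply/negP => Nw.
have := pfix (leq_trans bN Nw) => /pval_inj wi; lia.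
Qed.

Lemma inv_increasing (w : fperm) n i j : increasing_from n w -> (i < j)%N -> (w j < w i)%N -> (i < n)%N.
Proof. by move=> incw ij wji; rewrite ltnNge; apply/negP => ni; have := incw i j ni ij; lia. Qed.

(** * Boxes of the diagram under row and column operators *)

Section Core.
Variables (K : fieldType) (charK0 : [pchar K] =i pred0) (n N : nat).

Local Notation X := ('I_n * 'I_N)%type.
Local Notation FK := (fockb K n N).

(** The Rothe diagram with its columns numbered by values: the inversion (i, j) gives the box (i, w
    j). *)
Definition diagram (w : fperm) : {set X} := [set x : X | (x.2 < w x.1)%N && (x.1 < pvalV w x.2)%N].
Definition uvec (w : fperm) : FK := st K (diagram w).

Lemma card_count (P : pred nat) (A : {set 'I_N}) : (forall c : 'I_N, (c \in A) = P c) ->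
  #|A| = count P (iota 0 N).
Proof.
move=> AP; rewrite -val_enum_ord count_map cardE -size_filter enumT.
rewrite /enum_mem size_filter size_filter; apply: eq_count => c; exact: AP.
Qed.

Section RowMoves.
Variables (a b : 'I_n) (ab : (a < b)%N) (w : fperm).

Let src (c : 'I_N) : X := (b, c).
Let tgt (c : 'I_N) : X := (a, c).

Let src_inj : injective src. Proof. by move=> c d []. Qed.
Let tgt_inj : injective tgt. Proof. by move=> c d []. Qed.
Let src_tgt c d : src c != tgt d.
Proof. by rewrite xpair_eqE negb_and -val_eqE /= gtn_eqF. Qed.

Definition rowset : {set 'I_N} := movable src tgt (diagram w).
Definition rowmoved : {set X} := moved src tgt (diagram w).

Lemma in_rowset c : (c \in rowset) = [&& w a < c, c < w b & b < pvalV w c]%N.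
Proof.
rewrite !inE /=; have := posP w c a; have := posP w c b; move=> *; lia.
Qed.

Lemma in_rowmoved p c : ((p, c) \in rowmoved) =
  ((p == a) && (c \in rowset)) || (((p, c) \in diagram w) && ~~ ((p == b) && (c \in rowset))).
Proof.
rewrite /rowmoved /moved inE [_ \in _ :\: _]inE -/rowset.
have tE : ((p, c) \in [set tgt x | x in rowset]) = (p == a) && (c \in rowset).
  apply/imsetP/andP => [[d dr [-> ->]]|[/eqP -> cr]]; first by rewrite eqxx.
  by exists c.
have sE : ((p, c) \in [set src x | x in rowset]) = (p == b) && (c \in rowset).
  apply/imsetP/andP => [[d dr [-> ->]]|[/eqP -> cr]]; first by rewrite eqxx.
  by exists c.
by rewrite tE sE [_ && (_ \in diagram w)]andbC.
Qed.

Lemma rowmoved_sum (phi : X -> nat) :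
  (\sum_(x in rowmoved) phi x + \sum_(c in rowset) phi (b, c) =
   \sum_(x in diagram w) phi x + \sum_(c in rowset) phi (a, c))%N.
Proof. exact: moved_sum. Qed.

Lemma card_rowset : #|rowset| = mm N w a b.
Proof. by apply: card_count => c; rewrite in_rowset. Qed.

Lemma rowmoves_pow : (exists2 k : K, k != 0 & iter (mm N w a b) (e a b) (uvec w) = k *: (st K rowmoved : FK)) /\
  iter (mm N w a b).+1 (e a b) (uvec w) = 0.
Proof.
have itE k : iter k (e a b) (uvec w) = iter k (moves src tgt) (st K (diagram w)).
  by elim: k => // k IH; rewrite !iterS IH e_rowop.
rewrite !itE -card_rowset; exact: (moves_pow charK0 src_inj tgt_inj src_tgt (diagram w)).
Qed.

End RowMoves.

Section ColMoves.
Variables (c1 c2 : 'I_N) (c12 : (c1 < c2)%N) (D : {set X}).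

Let src (a : 'I_n) : X := (a, c2).
Let tgt (a : 'I_n) : X := (a, c1).

Let src_inj : injective src. Proof. by move=> c d []. Qed.
Let tgt_inj : injective tgt. Proof. by move=> c d []. Qed.
Let src_tgt c d : src c != tgt d.
Proof. by rewrite xpair_eqE negb_and -!val_eqE /= (gtn_eqF c12) orbT. Qed.

Definition colset : {set 'I_n} := movable src tgt D.
Definition colmoved : {set X} := moved src tgt D.

Lemma in_colset a : (a \in colset) = ((a, c2) \in D) && ((a, c1) \notin D).
Proof. by rewrite inE. Qed.

Lemma in_colmoved p c : ((p, c) \in colmoved) =
  ((c == c1) && (p \in colset)) || (((p, c) \in D) && ~~ ((c == c2) && (p \in colset))).
Proof.
rewrite /colmoved /moved inE [_ \in _ :\: _]inE -/colset.
have tE : ((p, c) \in [set tgt x | x in colset]) = (c == c1) && (p \in colset).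
  apply/imsetP/andP => [[d dr [-> ->]]|[/eqP -> cr]]; first by rewrite eqxx.
  by exists p.
have sE : ((p, c) \in [set src x | x in colset]) = (c == c2) && (p \in colset).
  apply/imsetP/andP => [[d dr [-> ->]]|[/eqP -> cr]]; first by rewrite eqxx.
  by exists p.
by rewrite tE sE [_ && (_ \in D)]andbC.
Qed.

Lemma colmoved_sum (phi : X -> nat) :
  (\sum_(x in colmoved) phi x + \sum_(a in colset) phi (a, c2) =
   \sum_(x in D) phi x + \sum_(a in colset) phi (a, c1))%N.
Proof. exact: moved_sum. Qed.

Lemma colmoves_pow : (exists2 k : K, k != 0 & iter #|colset| (@colop K n N c1 c2) (st K D) = k *: st K colmoved) /\
  iter #|colset|.+1 (@colop K n N c1 c2) (st K D) = 0.
Proof. exact: (moves_pow charK0 src_inj tgt_inj src_tgt D). Qed.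

End ColMoves.

Lemma uvec_rel w : increasing_from n w -> kprel N w (uvec w).
Proof.
move=> incw a b ab; have [bn|nb] := ltnP b n.
  have an := ltn_trans ab bn.
  have [_] := @rowmoves_pow (Ordinal an) (Ordinal bn) ab w; exact.
apply: (@iter_eq0_le _ _ _ 1) => //; apply: e_fock0.
by rewrite negb_and -!leqNgt nb orbT.
Qed.

Lemma e_colop c d i j (f : FK) : e i j (colop c d f : FK) = colop c d (e i j f) :> fock K X.
Proof.
have [/andP[ij jn]|ij] := boolP ((i < j) && (j < n))%N; last by rewrite !e_fock0 // linear0.
have i_n := ltn_trans ij jn.
by rewrite (@e_rowop _ _ _ (Ordinal i_n) (Ordinal jn)) // (@e_rowop _ _ _ (Ordinal i_n) (Ordinal jn)) // row_colop.
Qed.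

Definition low (r : nat) (f : FK) : Prop := forall (b : 'I_n) d, (r < b)%N -> an (b, d) f = 0.

Lemma low_e r i j f : low r f -> low r (e i j f).
Proof.
move=> lf b d rb; have [/andP[ij jn]|ij] := boolP ((i < j) && (j < n))%N; last by rewrite e_fock0 // linear0.
have i_n := ltn_trans ij jn; rewrite (@e_rowop _ _ _ (Ordinal i_n) (Ordinal jn)) // an_rowop (lf b d rb) linear0 add0r.
case: eqP => [/= bi|_]; last by rewrite scale0r.
by rewrite lf ?scaler0 //= (leq_ltn_trans _ ij) // ltnW //; move: rb; rewrite bi.
Qed.

(** The commutator with e_ij is the annihilation at (j, c) if i = r and zero otherwise; as j > r, it
    vanishes on a vector without boxes below row r. *)
Lemma an_e (r : 'I_n) c i j f : low r f -> an (r, c) (e i j f) = e i j (an (r, c) f : FK) :> fock K X.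
Proof.
move=> lf; have [/andP[ij jn]|ij] := boolP ((i < j) && (j < n))%N; last by rewrite !e_fock0 // linear0.
have i_n := ltn_trans ij jn; rewrite !(@e_rowop _ _ _ (Ordinal i_n) (Ordinal jn)) // an_rowop.
case: eqP => [/= ri|_]; last by rewrite scale0r addr0.
have rj : (r < Ordinal jn)%N by rewrite ri.
by rewrite (lf _ _ rj) scaler0 addr0.
Qed.

Lemma an_ev (r : 'I_n) c p f : low r f -> an (r, c) (ev p f) = ev p (an (r, c) f : FK) :> fock K X.
Proof.
move=> lf; rewrite /ev linear_sum; apply: eq_bigr => q _; rewrite linearZ /=; congr (_ *: _).
suff [] : low r (evw q.2 f) /\ an (r, c) (evw q.2 f) = evw q.2 (an (r, c) f : FK) by [].
elim: q.2 => // ij s [ls IH]; rewrite !evw_cons -IH; split; first exact: low_e.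
exact: an_e.
Qed.

End Core.

(** * The relations define the cyclic module *)

Lemma lt_false (a b : nat) : (a < b)%N -> (b < a)%N = false.
Proof. by move=> ab; rewrite ltnNge (ltnW ab). Qed.

(** The induction parameter: it drops when a box is removed, as for v, and when boxes move up, as
    for the v t_lr. The successor makes the boxes of row 0 count. *)
Definition measure (N n : nat) (w : fperm) : nat := (\sum_(x in diagram n N w) x.1.+1)%N.

Section CoreStep.
Variables (K : fieldType) (charK0 : [pchar K] =i pred0) (n N : nat).
Variables (w : fperm) (incw : increasing_from n w) (wN : (pbound w <= N)%N).
Variables (r s : nat) (tr : transition w r s) (rn : (r < n)%N) (sN : (s < N)%N).

Local Notation X := ('I_n * 'I_N)%type.
Local Notation FK := (fockb K n N).
Local Notation v := (fswap w r s).

Let rs : (r < s)%N. Proof. exact: tr_rs tr. Qed.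
Let ws : (w s < w r)%N. Proof. exact: tr_ws tr. Qed.
Let inc a b : (r < a)%N -> (a < b)%N -> (w a < w b)%N. Proof. exact: tr_inc tr _ _. Qed.
Let wmax k : (r < k)%N -> (w k < w r)%N -> (w k <= w s)%N. Proof. exact: tr_max tr _. Qed.
Let ro : 'I_n := Ordinal rn.
Let wsN : (w s < N)%N. Proof. exact: fperm_lt. Qed.

Lemma swap_bound : (pbound v <= N)%N.
Proof. rewrite fswap_bound; have := sN; have := rs; lia. Qed.

Lemma swap_increasing : increasing_from n v.
Proof.
move=> a b na ab; have ra : (r < a)%N by apply: leq_trans na.
have wab := inc ra ab.
have Hb : (w b < w r)%N -> (w b <= w s)%N by apply: wmax; apply: ltn_trans ab.
have Ha : (w a < w r)%N -> (w a <= w s)%N by exact: wmax.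
have nbr : w b <> w r by move/pval_inj; lia.
by case: (fswapP w r s a) => *; case: (fswapP w r s b) => *; have := ws; lia.
Qed.

Lemma diagram_swap : diagram n N w :\ (ro, Ordinal wsN) = diagram n N v.
Proof.
apply/setP => -[a c]; rewrite !inE xpair_eqE -!val_eqE /=; set p := pvalV w c.
have cp : c = w p :> nat by rewrite /p pvalVK.
have [ar|ra] := leqP a r.
  have Hp : (r < p)%N -> (w p < w r)%N -> (w p <= w s)%N by exact: wmax.
  move: cp Hp; rewrite /p; have := rs; have := ws; case: (fswapVP w r s c);
    by case: (fswapP w r s a) => *; lia.
have L : ~ ((c < w a) && (a < p))%N by move=> /andP[ca ap]; have := inc ra ap; lia.
have -> : (c < w a)%N && (a < p)%N = false by apply/negP.
rewrite andbF; symmetry; apply/negP => /andP[].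
have Hp : (r < p)%N -> (w p < w r)%N -> (w p <= w s)%N by exact: wmax.
have Ha : (w a < w r)%N -> (w a <= w s)%N by exact: wmax.
have i1 : (s < p)%N -> (w s < w p)%N by apply: inc; have := rs; lia.
have i2 : (a < s)%N -> (w a < w s)%N by exact: inc.
have i3 : (a < p)%N -> (w a < w p)%N by exact: inc.
move: cp Hp i1 i3 L; rewrite /p; have := rs; have := ws; case: (fswapVP w r s c);
  by case: (fswapP w r s a) => *; lia.
Qed.

Lemma uvec_low : low r (uvec K n N w).
Proof.
move=> b d rb; apply: an_st0; rewrite inE /=; apply/negP => /andP[db bd].
by have := inc rb bd; rewrite pvalVK; lia.
Qed.

(** Annihilating the box (r, w s), the only one by which the diagrams of w and v differ, commutes
    with U(n) on vectors without boxes below row r, and sends u_w to a nonzero multiple of u_v. *)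
Lemma ev_swap p : ev p (uvec K n N w) = 0 -> ev p (uvec K n N v) = 0.
Proof.
move=> H; have := @an_ev K n N ro (Ordinal wsN) p _ uvec_low; rewrite H linear0.
have rsD : (ro, Ordinal wsN) \in diagram n N w by rewrite inE /= ws pvalK rs.
have [b b0] := an_st K rsD; rewrite diagram_swap => E.
rewrite [an _ _]E -[b *: _]/(b *: uvec K n N v) linearZ /= => /esym/eqP.
by rewrite scaler_eq0 (negPf b0) => /eqP.
Qed.

Section Cover.
Variables (i : nat) (ci : covers w r s i).
Let ir : (i < r)%N. Proof. by case: ci. Qed.
Let wis : (w i < w s)%N. Proof. by case: ci. Qed.
Let cov k : (i < k)%N -> (k < r)%N -> ~ (w i < w k < w s)%N. Proof. by case: ci => _ _; apply. Qed.
Let i_n : (i < n)%N. Proof. exact: ltn_trans ir rn. Qed.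
Let io : 'I_n := Ordinal i_n.
Let wiN : (w i < N)%N. Proof. exact: ltn_trans wsN. Qed.
Local Notation u := (fswap v r i).
Let c1 : 'I_N := Ordinal wiN.
Let c2 : 'I_N := Ordinal wsN.
Let c12 : (c1 < c2)%N. Proof. exact: wis. Qed.

Lemma top_bound : (pbound u <= N)%N.
Proof. rewrite fswap_bound; have := swap_bound; have := sN; have := rs; have := ir; lia. Qed.

Lemma top_increasing : increasing_from n u.
Proof.
move=> a b na ab; have := swap_increasing na ab; have := rn; have := i_n.
by case: (fswapP v r i a) => *; case: (fswapP v r i b) => *; lia.
Qed.

Section Row.
Variables (l : nat) (cl : covers w r s l).
Let lr : (l < r)%N. Proof. by case: cl. Qed.
Let wls : (w l < w s)%N. Proof. by case: cl. Qed.
Let l_n : (l < n)%N. Proof. exact: ltn_trans lr rn. Qed.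
Let lo : 'I_n := Ordinal l_n.

Definition rowD : {set X} := @rowmoved n N lo ro w.
(** The rows in which a box of the basis vector underlying e_lr^(m_lr) u_w can move from column w s
    to column w i. *)
Definition colA : {set 'I_n} := colset c1 c2 rowD.

Lemma in_colA a : (a \in colA) =
  (((a == l :> nat) || ((w s < w a) && (a < r))) && ~~ ((w i < w a) && (a < i)))%N.
Proof.
rewrite in_colset /rowD !in_rowmoved // !in_rowset // !inE -!val_eqE /= !pvalK.
have i1 : (r < a)%N -> (a < s)%N -> (w a < w s)%N by move=> ra; exact: inc.
have -> : (r < i)%N = false by rewrite ltnNge (ltnW ir).
rewrite wls ws rs !andbF !andbT orFb; congr ((_ || _) && _).
apply/andP/andP => [[/andP[wa as_] ar]|[wa ar]]; last first.
  by rewrite wa (ltn_trans ar rs) ltn_eqF.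
split=> //; rewrite ltn_neqAle ar leqNgt; apply/negP => ra.
by have := i1 ra as_; rewrite ltnNge (ltnW wa).
Qed.

Lemma y_row : exists2 k : K, k != 0 &
  iter (mm N w l r) (e l r) (uvec K n N w) = k *: (st K rowD : FK).
Proof. by have [] := @rowmoves_pow K charK0 n N lo ro lr w. Qed.

Lemma rowD_sum : (\sum_(x in rowD) x.1.+1 < measure N n w)%N.
Proof.
have H := @rowmoved_sum n N lo ro w (fun x => x.1.+1).
rewrite -(ltn_add2r (\sum_(c in rowset N lo ro w) r.+1)) [X in (X < _)%N]H ltn_add2l.
rewrite /= !sum_nat_const ltn_mul2l ltnS lr andbT; apply/card_gt0P; exists c2.
by rewrite in_rowset //; apply/and3P; split; rewrite /= ?pvalK.
Qed.

End Row.

Definition g := #|colA ci|.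

(** Two covers l < i satisfy w i < w l, so row l already has a box in column w i and cannot be
    moved, whereas row i can be moved in the set attached to i. The two sets agree otherwise. *)
Lemma colA_lt l (cl : covers w r s l) : (l < i)%N -> (#|colA cl| < g)%N.
Proof.
move=> li; have wil : (w i < w l)%N.
  have [lr wls covl] := cl; have := covl i li ir; have := posP w (w i) l; rewrite !pvalK.
  by have := wis; move=> *; lia.
apply: proper_card; apply/properP; split.
  apply/subsetP => a; rewrite !in_colA; have [->|_] := eqVneq (a : nat) l.
    by rewrite wil li.
  by case/andP => /= -> ->; rewrite orbT.
by exists io; rewrite !in_colA /= ?eqxx ?ltnn ?andbF //= ltnNge (ltnW wis) orbF gtn_eqF.
Qed.

(** Checked box by box, with c sorted among w i, w r, w s and the other values, and a among i, r, s
    and the other rows; the remaining inequalities come from the choice of s and from i being a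
    cover. *)
Lemma colmoved_top : colmoved c1 c2 (rowD ci) = diagram n N u.
Proof.
apply/setP => -[a c]; rewrite in_colmoved // -/(colA ci) in_colA /rowD in_rowmoved // !in_rowset // !inE -!val_eqE /=.
have cp : c = w (pvalV w c) :> nat by rewrite pvalVK.
have covp : (i < pvalV w c)%N -> (pvalV w c < r)%N -> ~ (w i < c < w s)%N.
  by move=> h1 h2; have := cov h1 h2; rewrite -cp.
have maxp : (r < pvalV w c)%N -> (c < w r)%N -> (c <= w s)%N by move=> h; have := wmax h; rewrite -cp.
have cova : (i < a)%N -> (a < r)%N -> ~ (w i < w a < w s)%N by exact: cov.
have maxa : (r < a)%N -> (w a < w r)%N -> (w a <= w s)%N by exact: wmax.
have i1 : (r < a)%N -> (a < s)%N -> (w a < w s)%N by move=> ra; exact: inc.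
have i2 : (s < a)%N -> (w s < w a)%N by move=> sa; exact: inc.
have i3 : (r < a)%N -> (a < pvalV w c)%N -> (w a < c)%N by move=> h1 h2; have := inc h1 h2; rewrite -cp.
have i4 : (r < pvalV w c)%N -> (pvalV w c < a)%N -> (c < w a)%N.
  by move=> h1 h2; have := inc h1 h2; rewrite -cp.
have winj x y : x <> y -> w x <> w y by move=> xy /pval_inj.
have wir := ltn_trans wis ws; have is_ := ltn_trans ir rs.
have simp := (eqxx, ltnn, andbF, andbT, orbF, orbT, andFb, andTb, orFb, orTb,
  (gtn_eqF wis, ltn_eqF wis, gtn_eqF ws, ltn_eqF ws, gtn_eqF wir, ltn_eqF wir),
  (gtn_eqF ir, ltn_eqF ir, gtn_eqF rs, ltn_eqF rs, gtn_eqF is_, ltn_eqF is_),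
  (wis, ws, wir, ir, rs, is_),
  (lt_false wis, lt_false ws, lt_false wir, lt_false ir, lt_false rs, lt_false is_)).
move: cp covp maxp i3 i4; case: (topVP tr ci c) => [cE|cE|cE|p cE pi pr ps ci' cr' cs'] cp covp maxp i3 i4;
  (have [ai|ai] := eqVneq (a : nat) i; [rewrite ai (top_i ci) | have [ar|ar] := eqVneq (a : nat) r;
  [rewrite ar (top_r tr ci) | have [as_|as_] := eqVneq (a : nat) s; [rewrite as_ (top_s tr ci)|
    rewrite (@topE w r s i _ ai ar as_); have was := winj a s (elimN eqP as_)]]]);
  rewrite ?cE !simp ?(negPf ai) ?(negPf ar) ?simp //.
- by clear - cova was ai ir wis; lia.
- by clear - i1 ar ws rs; lia.
- by clear - i1 ar ai cova was wis rs ir; lia.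
- by clear - covp maxp cE ci' cr' cs' pi pr ps wis ws ir rs; lia.
- by clear - covp maxp cE ci' cr' cs' pi pr ps wis ws ir rs; lia.
- by clear - maxp cE cs' cr' ws rs; lia.
by rewrite -cE (negPf (introN eqP ci')) (negPf (introN eqP cs')) !simp.
Qed.

(** This separates the graded pieces: g is the largest power of the column operator that does not
    kill e_ir^(m_ir) u_w. It sends that vector to a nonzero multiple of the diagram vector of v t_ir
    and kills the corresponding vectors for the covers l < i. *)
Definition topop (f : FK) : FK := iter g (@colop K n N c1 c2) f.

Lemma topop_linear : linear topop.
Proof. by move=> a f f'; rewrite /topop iterDlin iterZlin. Qed.
HB.instance Definition _ := GRing.isLinear.Build K FK FK _ topop topop_linear.

Lemma topop_ev p f : topop (ev p f) = ev p (topop f).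
Proof.
apply: ev_hom => [|a b z /=]; first exact: linearP.
rewrite /topop; elim: g => // k IH.
by rewrite !iterS IH -e_colop.
Qed.

Lemma topop_lt l q : covers w r s l -> (l < i)%N ->
  topop (ev q (iter (mm N w l r) (e l r) (uvec K n N w))) = 0.
Proof.
move=> cl li; have [k _ yE] := y_row cl; rewrite topop_ev yE linearZ /=.
have [_ C0] := colmoves_pow charK0 c12 (rowD cl).
by rewrite [topop _](iter_eq0_le (colA_lt cl li) C0) scaler0 linear0.
Qed.

Lemma topop_eq q : topop (ev q (iter (mm N w i r) (e i r) (uvec K n N w))) = 0 ->
  ev q (uvec K n N u) = 0.
Proof.
have [k k0 yE] := y_row ci; rewrite topop_ev yE linearZ /=.
have [[k' k'0 C0] _] := colmoves_pow charK0 c12 (rowD ci).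
rewrite [topop _]C0 colmoved_top scalerA linearZ /= => /eqP.
by rewrite scaler_eq0 mulf_eq0 (negPf k0) (negPf k'0) => /eqP.
Qed.

Lemma measure_top : (measure N n u < measure N n w)%N.
Proof.
rewrite /measure -colmoved_top.
have /addIn -> := colmoved_sum c1 c2 (rowD ci) (fun x => x.1.+1).
exact: rowD_sum.
Qed.

End Cover.

Lemma measure_swap : (measure N n v < measure N n w)%N.
Proof.
rewrite /measure -diagram_swap [X in (_ < X)%N](big_setD1 (ro, Ordinal wsN)) /=; last first.
  by rewrite inE /= ws pvalK rs.
by rewrite addSn ltnS leq_addl.
Qed.

End CoreStep.

Section Core.
Variables (K : fieldType) (charK0 : [pchar K] =i pred0) (n N : nat).
Local Notation FK := (fockb K n N).

(** Here r is the last row of the diagram that has a box, and w s the largest column with a box in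
    that row. *)
Lemma transition_exists (w : fperm) : increasing_from n w -> (pbound w <= N)%N ->
  (exists r s, [/\ transition w r s, (r < n)%N & (s < N)%N]) \/ diagram n N w = set0.
Proof.
move=> incw wN; have [->|[x0 x0D]] := set_0Vmem (diagram n N w); first by right.
left; have [[r c0] rD rmax] := @arg_maxnP _ x0 (fun x => x \in diagram n N w) (fun x => x.1 : nat) x0D.
have [c cD cmax] := @arg_maxnP _ c0 (fun c => (r, c) \in diagram n N w) (fun c => c : nat) rD.
exists r, (pvalV w c); move: (cD); rewrite inE /= => /andP[cr rc].
have cN : (pvalV w c < N)%N.
  by rewrite ltnNge; apply/negP => Nc; have := pfix (leq_trans wN Nc); rewrite pvalVK; have := ltn_ord c; lia.
split=> //; split=> [//||a b ra ab|k rk kr]; rewrite ?pvalVK //.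
  rewrite ltn_neqAle (inj_eq (@pval_inj w)) ltn_eqF //= leqNgt; apply/negP => wba.
  have an := inv_increasing incw ab wba.
  have bN : (b < N)%N.
    by apply: leq_trans wN; apply: (@inversion_bound w a); rewrite /inversion ab.
  have := rmax (Ordinal an, Ordinal (fperm_lt wN bN)); rewrite inE /= wba pvalK ab => /(_ isT).
  by rewrite /= leqNgt ra.
have kN : (k < N)%N.
  by apply: leq_trans wN; apply: (@inversion_bound w r); rewrite /inversion rk.
by apply: (cmax (Ordinal (fperm_lt wN kN))); rewrite inE /= kr pvalK.
Qed.

(* In the direct sum with the Fock space, the filtration by the submodules generated by the
   e_{lr}^(m_l) z has, by induction, subquotients mapping injectively to Fock space. *)
Theorem kprel_ev (w : fperm) : increasing_from n w -> (pbound w <= N)%N ->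
  forall (M : nrep K) (x : M), kprel N w x ->
  forall p, ev p (uvec K n N w) = 0 -> ev p x = 0.
Proof.
have [d] := ubnP (measure N n w); elim: d w => // d IH w wd incw wN M x Rx p pu.
have [[r [s [tr rn sN]]]|D0] := transition_exists incw wN; last first.
  (* With an empty diagram w has no inversion, so the relations say that every e_ij kills x, as it
     kills u_w. Then p acts on both vectors by its constant term, which is zero because u_w is
     not. *)
  have [c cE] := ev_const p.
  have e0 i j : e i j (uvec K n N w) = 0.
    have [/andP[ij jn]|ij] := boolP ((i < j) && (j < n))%N; last by rewrite e_fock0.
    have i_n := ltn_trans ij jn; rewrite (@e_rowop _ _ _ (Ordinal i_n) (Ordinal jn)) // /rowop.
    rewrite big1 // => c' _; rewrite hop_st0 //; last by rewrite D0 inE.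
    by rewrite xpair_eqE negb_and -val_eqE /= ltn_eqF.
  have D0x j k : (j < k)%N -> ~ (w k < w j)%N.
    move=> jk wkj; have jn := inv_increasing incw jk wkj.
    have kN : (k < N)%N.
      by apply: leq_trans wN; apply: (@inversion_bound w j); rewrite /inversion jk.
    have : (Ordinal jn, Ordinal (fperm_lt wN kN)) \in diagram n N w by rewrite inE /= wkj pvalK.
    by rewrite D0 inE.
  have u0 : uvec K n N w != 0 by exact: st_neq0.
  move: pu; rewrite cE // => /eqP; rewrite scaler_eq0 (negPf u0) orbF => /eqP c0.
  rewrite cE ?c0 ?scale0r // => i j; have [ij|ji] := ltnP i j; last exact: nop_ge.
  have := Rx i j ij; rewrite mm_eq0 // => k jk /andP[_ wkj]; exact: D0x jk wkj.
pose m l := mm N w l r.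
pose z : nsum M FK := (x, uvec K n N w).
have Rz : kprel N w z.
  by move=> i j ij; rewrite iter_sum Rx // uvec_rel.
pose y l := iter (m l) (e l r) z.
pose G k (z' : nsum M FK) := exists l q, [/\ covers w r s l, (l < k)%N & z' = ev q (y l)].
have Gst k i j z' : G k z' -> e i j z' \in lspanp (G k).
  move=> [l [q [cl lk ->]]]; apply: lspanp_gen; exists l, (pmulw [:: (i, j)] q).
  by split=> //; rewrite ev_mulw.
have yG k l : covers w r s l -> (l < k)%N -> y l \in lspanp (G k).
  move=> cl lk; apply: lspanp_gen; exists l, [:: (1, [::])]; split=> //.
  by rewrite /ev big_seq1 scale1r.
pose Q k := nquot (Gst k).
have Rq k : kprel N w (toq' (Gst k) z).
  move=> i j ij; have -> : iter (mm N w i j).+1 (e i j) (toq' (Gst k) z) =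
      toq' (Gst k) (iter (mm N w i j).+1 (e i j) z).
    by elim: (mm N w i j).+1 => // d' IHd; rewrite !iterS IHd e_toq.
  by rewrite Rz // linear0.
have toq_y k l : iter (m l) (e l r) (toq' (Gst k) z) = toq' (Gst k) (y l).
  by rewrite /y; elim: (m l) => // d' IHd; rewrite !iterS IHd e_toq.
have toq_y0 k l : covers w r s l -> (l < k)%N -> iter (m l) (e l r) (toq' (Gst k) z) = 0.
  by move=> cl lk; rewrite toq_y; apply/toq_eq0/yG.
have ev_toq k q z' : toq' (Gst k) (ev q z') = ev q (toq' (Gst k) z').
  by apply: ev_hom => [|i j z'']; [exact: linearP|exact: e_toq].
(* On the submodule spanned by [G k] the Fock component is injective; in the step from k to k.+1,
   [topop] isolates the contribution of y k. *)
have peel k z' : z' \in lspanp (G k) -> z'.2 = 0 -> z' = 0.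
  elim: k z' => [|k IHk] z' z'G z'0.
    move/asboolP: z'G => {z'0}; elim=> // [_ [l [q []]] //|u v _ -> _ ->|a u _ ->].
      by rewrite addr0.
    by rewrite scaler0.
  suff : z' \in lspanp (G k) by move/IHk; apply.
  have [ck|nck] := pselect (covers w r s k); last first.
    move/asboolP: z'G => {z'0}; elim=> [|u [l [q [cl lk ->]]]|u v _ uG _ vG|a u _ uG].
    - exact: rpred0.
    - apply: lspanp_gen; exists l, q; split=> //; rewrite ltn_neqAle -ltnS lk andbT.
      by apply/eqP => lk'; rewrite lk' in cl.
    - exact: rpredD.
    - exact: rpredZ.
  have [q [z'' [z''G z'E]]] : exists q z'', z'' \in lspanp (G k) /\ z' = ev q (y k) + z''.
    move/asboolP: z'G => {z'0}; elim=> [|u [l [q [cl]]]|u v _ [q [u' [u'G ->]]] _ [q' [v' [v'G ->]]]|a u _ [q [u' [u'G ->]]]].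
    - by exists [::], 0; rewrite rpred0 /ev big_nil addr0.
    - rewrite ltnS leq_eqVlt => /orP[/eqP -> ->|lk ->]; first by exists q, 0; rewrite rpred0 addr0.
      exists [::], (ev q (y l)); split; last by rewrite /ev big_nil add0r.
      by apply: lspanp_gen; exists l, q.
    - by exists (q ++ q'), (u' + v'); rewrite rpredD // ev_cat addrACA.
    - by exists (pscale a q), (a *: u'); rewrite rpredZ // ev_scale scalerDr.
  have topz : topop wN rn sN ck z''.2 = 0.
    move/asboolP: z''G => {z'E}; elim=> [|u [l [q' [cl lk ->]]]|u v _ uG _ vG|a u _ uG].
    - exact: linear0.
    - rewrite /y /z iter_sum ev_sum; exact: topop_lt.
    - by rewrite -[(u + v).2]/(u.2 + v.2) linearD [X in X + _]uG [X in _ + X]vG addr0.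
    - by rewrite -[(a *: u).2]/(a *: u.2) linearZ /= [topop _ _ _ _ _]uG scaler0.
  (* As [topop] kills the earlier generators, the vanishing of the Fock component of z' becomes the
     relation q for the diagram vector of v t_rk. By induction q then kills y k modulo the span of
     [G k]. *)
  have qu : ev q (uvec K n N (fswap (fswap w r s) r k)) = 0.
    apply: (topop_eq charK0 tr (wN := wN) (rn := rn) (sN := sN) (ci := ck)).
    have := congr1 (topop wN rn sN ck) z'0; rewrite z'E linear0 -[(_ + z'').2]/((ev q (y k)).2 + z''.2) linearD [X in _ + X]topz addr0.
    by rewrite /y /z iter_sum ev_sum.
  rewrite z'E rpredD //; apply/(toq_eq0 (Gst k)); rewrite ev_toq -toq_y.
  have um : (measure N n (fswap (fswap w r s) r k) < d)%N.
    by apply: leq_trans (measure_top wN tr rn sN ck) _.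
  apply: (IH _ um (top_increasing wN tr rn sN ck) (top_bound wN tr rn sN ck)) qu.
  by apply: transition_rel_top => // l cl lk; exact: toq_y0.
have vm : (measure N n (fswap w r s) < d)%N.
  by apply: leq_trans (measure_swap wN tr rn sN) _.
have vR : kprel N (fswap w r s) (toq' (Gst r) z).
  by apply: transition_rel => // l cl; apply: toq_y0 => //; case: cl.
(* Modulo the whole filtration z satisfies the relations of v, and p kills u_v. So p z lies in the
   filtration; its Fock component p u_w is zero, and [peel] concludes. *)
have := IH _ vm (swap_increasing wN tr rn sN) (swap_bound wN tr rn sN) _ _ vR _ (ev_swap wN tr rn sN pu).
rewrite -ev_toq => /toq_eq0 pG.
have := peel _ _ pG; rewrite ev_sum /= => /(_ pu) [].
exact.
Qed.

End Core.

(** * KP modules in Fock space *)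

Lemma lspan_kill (K : fieldType) (L L' : lmodType K) (G : L -> Prop) (f : {linear L -> L'}) :
  (forall x, G x -> f x = 0) -> forall z, z \in lspanp G -> f z = 0.
Proof.
move=> fG z /asboolP; elim=> [|x /fG //|x y _ fx _ fy|a x _ fx].
- exact: linear0.
- by rewrite linearD fx fy addr0.
- by rewrite linearZ /= fx scaler0.
Qed.

Section TensorLift.
Variables (K : fieldType) (n : nat) (M N : bmodule K n) (L : lmodType K) (f : M -> N -> L).
Hypotheses (fl : forall v, linear (f^~ v)) (fr : forall m, linear (f m)).

Definition tlift (t : tens M N) : L := fglift (fun p : M * N => f p.1 p.2) (repr t).

Lemma tlift_toq z : tlift (toq _ z) = fglift (fun p : M * N => f p.1 p.2) z.
Proof.
apply/eqP; rewrite -subr_eq0 -linearB; apply/eqP.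
apply: (@lspan_kill _ _ _ (@tens_rel K n M N)); last by apply/toqE; rewrite toqK.
move=> {}z [a m m' v|a m v v']; rewrite linearB /= linearP /= linearD linearZ /= !fglift_gen /=.
- by rewrite fl scalerN -opprD subrr.
- by rewrite fr scalerN -opprD subrr.
Qed.

Lemma tlift_linear : linear tlift.
Proof.
by move=> a s t; rewrite -[s]toqK -[t]toqK -linearP !tlift_toq linearP.
Qed.
HB.instance Definition _ := GRing.isLinear.Build K (tens M N) L _ tlift tlift_linear.

Lemma tlift_pure m v : tlift (tpure m v) = f m v.
Proof. by rewrite /tpure tlift_toq fglift_gen. Qed.

End TensorLift.

Section KPtoFock.
Variables (K : fieldType) (charK0 : [pchar K] =i pred0) (n N : nat).
Local Notation X := ('I_n * 'I_N)%type.
Local Notation F := (fock K X).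
Local Notation V := (vecb K n).

(* Creation of v in the column c, zero when c is out of range. *)
Definition crv (c : nat) (v : V) (f : F) : F :=
  if insub c is Some d then \sum_i (v : 'cV_n) i 0 *: cr (i, d : 'I_N) f else 0.

Lemma crv_linear c v : linear (crv c v).
Proof.
move=> a f g; rewrite /crv; case: insub => [d|]; last by rewrite scaler0 addr0.
rewrite scaler_sumr -big_split; apply: eq_bigr => i _.
by rewrite linearP scalerDr !scalerA mulrC.
Qed.
HB.instance Definition _ c v := GRing.isLinear.Build K F F _ (crv c v) (crv_linear c v).

Lemma crv_linearl c f : linear (fun v : V => crv c v f).
Proof.
move=> a u v; rewrite /crv; case: insub => [d|]; last by rewrite scaler0 addr0.
rewrite scaler_sumr -big_split; apply: eq_bigr => i _ /=.
by rewrite !mxE scalerDl scalerA.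
Qed.

Lemma crv_anti c u v f : crv c u (crv c v f) = - crv c v (crv c u f).
Proof.
rewrite /crv; case: insub => [d|]; last by rewrite oppr0.
have E (p q : 'cV[K]_n) : \sum_i p i 0 *: cr (i, d) (\sum_j q j 0 *: cr (j, d) f) =
  \sum_i \sum_j (p i 0 * q j 0) *: cr (i, d) (cr (j, d) f).
  apply: eq_bigr => i _; rewrite linear_sum scaler_sumr; apply: eq_bigr => j _.
  by rewrite linearZ /= scalerA.
rewrite !E [X in _ = - X]exchange_big -sumrN; apply: eq_bigr => i _.
rewrite -sumrN; apply: eq_bigr => j _.
by rewrite cr_cr scalerN mulrC.
Qed.

(** Anticommutation gives twice this vector equal to zero, and 2 is invertible in K. *)
Lemma crv_sq c v f : crv c v (crv c v f) = 0.
Proof.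
have /eqP := crv_anti c v v f; rewrite -addr_eq0 -mulr2n -scaler_nat scaler_eq0.
by have /pcharf0P -> := charK0; rewrite /= => /eqP.
Qed.

Lemma fact_cr (x : borel K n) p d f : fact x (cr (p, d : 'I_N) f) =
  \sum_a bval x a p *: cr (a, d) f + cr (p, d) (fact x f).
Proof.
rewrite {1}/fact; under eq_bigr => a _ do under eq_bigr => b _ do rewrite rowop_cr scalerDr.
under eq_bigr => a _ do rewrite big_split /=; rewrite big_split /= addrC; congr (_ + _).
  apply: eq_bigr => a _; rewrite -(sum_delta p (fun b => bval x a b *: cr (a, d) f)).
  by apply: eq_bigr => b _; rewrite !scalerA mulrC (eq_sym b).
by rewrite linear_sum; apply: eq_bigr => a _; rewrite linear_sum; apply: eq_bigr => b _; rewrite linearZ.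
Qed.

Lemma fact_crv (x : borel K n) c v f : fact x (crv c v f) = crv c (bact x v) f + crv c v (fact x f).
Proof.
rewrite /crv; case: insub => [d|]; last by rewrite linear0 addr0.
rewrite linear_sum; under eq_bigr => i _ do rewrite linearZ /= fact_cr scalerDr.
rewrite big_split /=; congr (_ + _).
under eq_bigr => i _ do rewrite scaler_sumr.
rewrite exchange_big; apply: eq_bigr => a _; rewrite mxE scaler_suml.
by apply: eq_bigr => i _; rewrite scalerA mulrC.
Qed.

Fixpoint prodcr (c l : nat) (v : nat -> V) (f : F) : F :=
  if l is l'.+1 then crv c (v 0%N) (prodcr c l' (fun a => v a.+1) f) else f.

Lemma prodcr_linear c l v : linear (prodcr c l v).
Proof. by move=> a f g; elim: l v => //= l IH v; rewrite IH linearP. Qed.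
HB.instance Definition _ c l v := GRing.isLinear.Build K F F _ (prodcr c l v) (prodcr_linear c l v).

Lemma prodcr_head c l p v b f : (b < l)%N -> v b = p -> crv c p (prodcr c l v f) = 0.
Proof.
elim: l v b => // l IH v [|b] bl vb /=; first by rewrite vb crv_sq.
by rewrite crv_anti (IH _ b) ?linear0 ?oppr0.
Qed.

Lemma prodcr_alt c l v a b f : (a < b < l)%N -> v a = v b -> prodcr c l v f = 0.
Proof.
elim: l v a b => [|l IH] v a b; first by rewrite ltn0 andbF.
case: b => // b; rewrite /= !ltnS => /andP[ab bl] vab.
case: a => [|a] in ab vab *; first by apply: (@prodcr_head _ _ _ _ b).
by rewrite (IH _ a b) ?linear0 // ab.
Qed.

(* The action of the l-th tensor power on Fock space by successive creations. *)
Fixpoint tphi (c l : nat) : tpow V l -> F -> F :=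
  if l is l'.+1 return tpow V l -> F -> F then
    tlift (fun (v : V) (t : tpow V l') => (fun f => crv c v (tphi c t f)) : F -> F)
  else fun (a : K^o) f => a *: f.

(** Proved jointly by induction on l: [tlift] can be computed on pure tensors only for a bilinear
    map, so linearity in degree l is needed before anything can be said in degree l + 1. *)
Lemma tphi_bilinear c l : [/\ linear (tphi c (l := l)) , forall t, linear (tphi c (l := l) t),
  forall v, linear (fun t => (fun f => crv c v (tphi c (l := l) t f)) : F -> F) &
  forall t, linear (fun v => (fun f => crv c v (tphi c (l := l) t f)) : F -> F)].
Proof.
have step l' : linear (tphi c (l := l')) ->
    (forall v, linear (fun t => (fun f => crv c v (tphi c (l := l') t f)) : F -> F)) /\
    (forall t, linear (fun v => (fun f => crv c v (tphi c (l := l') t f)) : F -> F)).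
  move=> lin; split=> [v a s t|t a u v]; apply/funext => f.
    by rewrite lin !fctE linearP.
  by rewrite !fctE; exact: (crv_linearl c (tphi c t f)).
elim: l => [|l [IH1 IH2 IH3 IH4]].
  have lin : linear (tphi c (l := 0)).
    by move=> a s t; apply/funext => f; rewrite /= !fctE scalerDl scalerA.
  split=> //; [|by case: (step 0%N lin)|by case: (step 0%N lin)].
  by move=> t a f g /=; rewrite scalerDr !scalerA mulrC.
have lin : linear (tphi c (l := l.+1)) by apply: tlift_linear; [exact: IH4|exact: IH3].
split=> //; [|by case: (step l.+1 lin)|by case: (step l.+1 lin)].
move=> t a f g; elim/tens_ind: t => [|s t Hs Ht|m v].
- rewrite (linear_at0 lin).
  exact: esym (etrans (addr0 (a *: (0 : F))) (scaler0 F a)).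
- have E h : tphi c (l := l.+1) (s + t) h = tphi c (l := l.+1) s h + tphi c (l := l.+1) t h.
    by have := lin 1 s t; rewrite !scale1r => ->.
  by rewrite !E Hs Ht addrACA -scalerDr.
- by rewrite /= tlift_pure ?IH2 ?linearP.
Qed.

Lemma tphi_linear c l : linear (tphi c (l := l)). Proof. by case: (tphi_bilinear c l). Qed.
HB.instance Definition _ c l :=
  GRing.isLinear.Build K (tpow V l) (F -> F) _ (tphi c (l := l)) (@tphi_linear c l).

Lemma tphi_linearr c l (t : tpow V l) : linear (tphi c t).
Proof. by case: (tphi_bilinear c l) => _ lin _ _; exact: lin. Qed.
HB.instance Definition _ c l t :=
  GRing.isLinear.Build K F F _ (tphi c (l := l) t) (@tphi_linearr c l t).

Lemma tphi_tpure c l v (t : tpow V l) f :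
  tphi c (l := l.+1) (tpure v t) f = crv c v (tphi c t f).
Proof. by have [_ _ IH3 IH4] := tphi_bilinear c l; rewrite /= tlift_pure. Qed.

Lemma tphiD c l (s t : tpow V l) f : tphi c (s + t) f = tphi c s f + tphi c t f.
Proof. by rewrite linearD. Qed.

Lemma tphi0 c l f : tphi c (0 : tpow V l) f = 0.
Proof. by rewrite linear0. Qed.

Lemma tphi_seq c l v f : tphi c (tpure_seq l v) f = prodcr c l v f.
Proof.
elim: l v => [|l IH] v; first by rewrite /= scale1r.
by rewrite -[tpure_seq _ _]/(tpure (v 0%N) (tpure_seq l (fun a => v a.+1))) tphi_tpure IH.
Qed.

Lemma fact_tphi (x : borel K n) c l (t : tpow V l) f :
  fact x (tphi c t f) = tphi c (bact x t) f + tphi c t (fact x f).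
Proof.
elim: l t f => [|l IH] t f.
  rewrite /= linearZ /= [pairing _ _](_ : _ = 0) ?scale0r ?add0r //.
  by rewrite /pairing big1 // => i _; rewrite mxE mul0r.
elim/tens_ind: t => [|s t Hs Ht|m v].
- have E : bact x (0 : tpow V l.+1) = 0 by exact: linear_at0 (bact_linear x).
  by rewrite E (tphi0 c l.+1) (tphi0 c l.+1) linear0 add0r.
- have E : bact x (s + t : tpow V l.+1) = bact x (s : tpow V l.+1) + bact x (t : tpow V l.+1).
    by have := bact_linear x 1 (s : tpow V l.+1) t; rewrite !scale1r.
  by rewrite E !(@tphiD c l.+1) [fact x (_ + _)]linearD /= Hs Ht addrACA.
rewrite [bact x _]tact_pure tphiD !tphi_tpure fact_crv IH linearD -!addrA; congr (_ + _).
Qed.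

Definition ephi c l (t : extpow V l) (f : F) : F := tphi c (repr t : tpow V l) f.

Lemma ephi_toq c l (z : tpow V l) f : ephi c (toq (@alt_rel K n V l) z) f = tphi c z f.
Proof.
rewrite /ephi; apply/eqP; rewrite -subr_eq0; apply/eqP.
have -> : tphi c (repr (toq (@alt_rel K n V l) z)) f - tphi c z f =
    tphi c (repr (toq (@alt_rel K n V l) z) - z) f by rewrite linearB.
have := @lspan_kill K (tpow V l) (F -> F) (@alt_rel K n V l) (tphi c (l := l)) => /(_ _ _ _) ->//.
  by move=> _ [v a b ab vab]; apply/funext => g; rewrite -[LHS]/(tphi c (tpure_seq l v) g) tphi_seq (prodcr_alt _ _ ab vab).
by apply/toqE; rewrite toqK.
Qed.

Lemma ephi_linear c l f : linear (fun t : extpow V l => ephi c t f).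
Proof. by move=> a s t; rewrite -[s]toqK -[t]toqK -linearP !ephi_toq tphi_linear. Qed.

Lemma ephi_linearr c l (t : extpow V l) : linear (ephi c t).
Proof. exact: tphi_linearr. Qed.

Lemma fact_ephi (x : borel K n) c l (t : extpow V l) f :
  fact x (ephi c t f) = ephi c (bact x t) f + ephi c t (fact x f).
Proof. by rewrite -[t]toqK [bact x _]extactE !ephi_toq fact_tphi. Qed.

Section Amb.
Variable w : fperm.

(** The exterior factor of index j is created in column w j, in accordance with the box (i, w j) of
    an inversion (i, j). The map is equivariant and takes u_w to a multiple of the diagram
    vector. *)
Fixpoint kphi (js : seq nat) : KPamb K n w js -> fockb K n N :=
  if js is j :: js' return KPamb K n w js -> fockb K n N then
    tlift (fun (m : KPext K n w j) (y : KPamb K n w js') => ephi (w j) m (kphi y))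
  else fun a : K^o => a *: (st K set0 : F).

Lemma kphi_linear js : linear (kphi (js := js)).
Proof.
elim: js => [|j js IH]; first by move=> a b c /=; rewrite scalerDl scalerA.
apply: tlift_linear => [v|m]; first exact: ephi_linear.
by move=> a u v; rewrite -[LHS]/(ephi (w j) m (kphi (a *: u + v))) IH ephi_linearr.
Qed.
HB.instance Definition _ js :=
  GRing.isLinear.Build K (KPamb K n w js) (fockb K n N) _ (kphi (js := js)) (@kphi_linear js).

Lemma kphi_tpure j js (m : KPext K n w j) (y : KPamb K n w js) :
  kphi (js := j :: js) (tpure m y) = ephi (w j) m (kphi y).
Proof.
rewrite /= tlift_pure // => [v|{}m]; first exact: ephi_linear.
by move=> a u v; rewrite -[LHS]/(ephi (w j) m (kphi (a *: u + v))) kphi_linear ephi_linearr.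
Qed.

Lemma kphi_act (x : borel K n) js (y : KPamb K n w js) : kphi (bact x y) = bact x (kphi y).
Proof.
elim: js y => [|j js IH] y.
  rewrite /= [pairing _ _](_ : _ = 0); last by rewrite /pairing big1 // => i _; rewrite mxE mul0r.
  rewrite !scale0r linearZ /= /fact big1 ?scaler0 // => a _; rewrite big1 // => b _.
  rewrite /rowop big1 ?scaler0 // => c _; rewrite /hop an_st0 ?linear0 //.
  by rewrite inE.
have kphiD (s t : KPamb K n w (j :: js)) : kphi (s + t) = kphi s + kphi t by exact: linearD.
elim/tens_ind: y => [|s t Hs Ht|m v].
- have E : bact x (0 : KPamb K n w (j :: js)) = 0 by exact: linear_at0 (bact_linear x).
  by rewrite E (linear_at0 (@kphi_linear (j :: js))) linear0.
- have E : bact x (s + t : KPamb K n w (j :: js)) = bact x (s : KPamb K n w (j :: js)) + bact x (t : KPamb K n w (j :: js)).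
    by have := bact_linear x 1 (s : KPamb K n w (j :: js)) t; rewrite !scale1r.
  by rewrite E !kphiD Hs Ht linearD.
rewrite [bact x _]tact_pure kphiD !kphi_tpure IH.
by rewrite -[RHS]/(fact x (ephi (w j) m (kphi v))) fact_ephi.
Qed.

Lemma prodcr_nth c (s : seq V) f : prodcr c (size s) (nth 0 s) f = foldr (crv c) f s.
Proof. by elim: s => //= v s IH; rewrite IH. Qed.

Lemma kphi_wedge j f : ephi (w j) (KPwedge K n w j) f =
  foldr (fun i : 'I_n => crv (w j) (delta_mx i 0)) f [seq i : 'I_n <- enum 'I_n | inversion w i j].
Proof.
rewrite /KPwedge /wedge ephi_toq tphi_seq prodcr_nth /KPcol.
by elim: (filter _ _) => //= i s ->.
Qed.

Lemma crv_delta (c : 'I_N) i f : crv c (delta_mx i 0 : V) f = cr (i, c) f.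
Proof.
rewrite /crv valK -(sum_delta i (fun i => cr (i, c) f)).
by apply: eq_bigr => j _; rewrite mxE eqxx andbT eq_sym.
Qed.

Lemma foldr_cr (c : 'I_N) (l : seq 'I_n) (D : {set X}) : uniq l -> (forall i, (i, c) \notin D) ->
  exists2 b : K, b != 0 & foldr (fun i : 'I_n => crv c (delta_mx i 0)) (st K D) l =
    b *: st K ([set (i, c) | i in l] :|: D).
Proof.
move=> ul Dc; elim: l ul => [|i l IH] /=.
  exists 1; rewrite ?oner_neq0 // scale1r; congr st; apply/setP => x; rewrite inE.
  by case: imsetP => // -[].
move=> /andP[il /IH[b b0 ->]]; rewrite linearZ /= crv_delta.
have [|d d0 ->] := @cr_st K _ (i, c) ([set (i, c) | i in l] :|: D).
  rewrite inE (negPf (Dc i)) orbF; apply/imsetP => -[k kl [ik]].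
  by rewrite ik kl in il.
exists (b * d); rewrite ?mulf_neq0 // scalerA setUA; congr (_ *: st _ (_ :|: _)).
apply/setP => x; rewrite in_setU1; apply/orP/imsetP => [[/eqP ->|/imsetP[k kl ->]]|[k]].
- by exists i; rewrite // mem_head.
- by exists k; rewrite // inE kl orbT.
- by rewrite inE => /orP[/eqP ->|kl] ->; [left|right; apply/imsetP; exists k].
Qed.

Definition jdiagram (js : seq nat) : {set X} :=
  [set x : X | (pvalV w x.2 \in js) && ((x.2 < w x.1)%N && (x.1 < pvalV w x.2)%N)].

Lemma kphi_vec js : uniq js -> (forall j, j \in js -> (w j < N)%N) ->
  exists2 b : K, b != 0 & kphi (KPvec K n w js) = b *: st K (jdiagram js).
Proof.
elim: js => [_ _|j js IH /andP[jjs ujs] jN].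
  exists 1; rewrite ?oner_neq0 // /=; congr (_ *: st _ _); apply/setP => x;
    by rewrite !inE.
have [|b b0 bE] := IH ujs; first by move=> k kjs; apply: jN; rewrite inE kjs orbT.
rewrite -[KPvec _ _ _ _]/(tpure (KPwedge K n w j) (KPvec K n w js)) kphi_tpure bE.
have ephiZ (m : KPext K n w j) c f : ephi (w j) m (c *: f) = c *: ephi (w j) m f.
  by have := ephi_linearr (w j) m c f 0; rewrite (linear_at0 (ephi_linearr _ _)) !addr0.
rewrite ephiZ kphi_wedge.
have wjN : (w j < N)%N by apply: jN; rewrite mem_head.
have [||d d0 dE] := @foldr_cr (Ordinal wjN) [seq i : 'I_n <- enum 'I_n | inversion w i j] (jdiagram js).
- by rewrite filter_uniq // enum_uniq.
- by move=> i; rewrite inE /= pvalK (negPf jjs).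
rewrite -[w j]/(Ordinal wjN : nat) dE scalerA; exists (b * d); first by rewrite mulf_neq0.
congr (_ *: st _ _); apply/setP => -[i c]; rewrite in_setU [in RHS]inE inE /= inE.
have [cj|cj] := eqVneq (pvalV w c) j.
  rewrite cj (negPf jjs) !orbF /= ?orbF andbC.
  apply/imsetP/idP => [[k]|ij]; first by rewrite mem_filter => /andP[H _] [-> ->].
  exists i; first by rewrite mem_filter mem_enum andbT /inversion -[w j](_ : c = w j :> nat) // -cj pvalVK.
  by congr pair; apply: val_inj; rewrite /= -cj pvalVK.
case: imsetP => [[k _ [_ cE]]|_]; last by [].
by move: cj; rewrite cE /= pvalK eqxx.
Qed.

Lemma kphi_KPvec : (pbound w <= N)%N ->
  exists2 b : K, b != 0 & kphi (KPvec K n w (iota 0 (pbound w))) = b *: uvec K n N w.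
Proof.
move=> wN; have [||b b0 ->] := @kphi_vec (iota 0 (pbound w)); first exact: iota_uniq.
  move=> j; rewrite mem_iota add0n /= => jb; apply: leq_trans wN.
  exact: (@fperm_lt w (pbound w)).
exists b => //; congr (_ *: st _ _); apply/setP => x; rewrite !inE.
rewrite mem_iota add0n /=; apply: andb_idl => /andP[h1 h2].
by apply: (@inversion_bound w x.1); rewrite /inversion h2 pvalVK.
Qed.
End Amb.

End KPtoFock.

(** * Weight and relations of the vector u_w *)

Section KPVector.
Variables (K : fieldType) (n : nat).
Local Notation V := (vecb K n).

Lemma wt_tpure (M N : bmodule K n) mu nu (m : M) (v : N) :
  wtspace mu m -> wtspace nu v -> wtspace (mu + nu) (tpure m v : tens M N).
Proof.
move=> Hm Hv h hd; rewrite [bact h _]tact_pure Hm // Hv // pairingDl scalerDl.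
rewrite [X in _ + X]linearZ; congr (_ + _).
by have := tpure_linearl v (pairing mu h) m 0; rewrite (linear_at0 (tpure_linearl v)) !addr0.
Qed.

Lemma wt_toq l (z : tpow V l) mu : wtspace mu z -> wtspace mu (toq (@alt_rel K n V l) z : extpow V l).
Proof. by move=> Hz h hd; rewrite [bact h _]extactE Hz // linearZ. Qed.

Lemma wt_charb0 : wtspace 0 (1 : charb K (0 : 'rV[int]_n)).
Proof. by move=> h hd. Qed.

Lemma wt_delta (i : 'I_n) : wtspace (eps n i) (delta_mx i 0 : V).
Proof.
move=> h /is_diag_mxP hd; apply/matrixP => a b; rewrite !mxE (bigD1 i) //= big1 => [|c ci].
  rewrite !mxE (ord1 b) !eqxx mulr1 addr0; have [->|ai] := eqVneq a i.
    rewrite /= mulr1 /pairing (bigD1 i) //= big1 ?mxE ?eqxx ?mul1r ?addr0 // => c ci.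
    by rewrite mxE (inj_eq val_inj) (negPf ci) mul0r.
  by rewrite hd // mulr0.
by rewrite mxE (negPf ci) mulr0.
Qed.

Lemma wt_tpure_seq (l : seq 'I_n) :
  wtspace (\sum_(i <- l) eps n i) (tpure_seq (size l) (nth 0 [seq delta_mx i 0 : V | i <- l])).
Proof.
elim: l => [|i l IH]; first by rewrite big_nil; exact: wt_charb0.
rewrite big_cons; exact: (wt_tpure (wt_delta i) IH).
Qed.

Definition codewt (w : fperm) : 'rV[int]_n := \row_i (code w i)%:Z.

Lemma wt_KPvec w js : wtspace (\sum_(j <- js) \sum_(i <- enum 'I_n | inversion w i j) eps n i)
  (KPvec K n w js).
Proof.
elim: js => [|j js IH]; first by rewrite big_nil; exact: wt_charb0.
rewrite big_cons; apply: (wt_tpure (M := KPext K n w j)) => //.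
rewrite -big_filter; apply: wt_toq.
by rewrite /KPcol size_map; exact: wt_tpure_seq.
Qed.

Lemma codewtE w : \sum_(j <- iota 0 (pbound w)) \sum_(i <- enum 'I_n | inversion w i j) eps n i =
  codewt w.
Proof.
apply/rowP => a; rewrite summxE mxE /code; elim: (iota 0 _) => [|j s IH]; first by rewrite big_nil.
rewrite big_cons {}IH /= PoszD; congr (_ + _); rewrite summxE big_enum_cond /=.
rewrite (eq_bigr (fun i => (a == i)%:Z)) => [|i _]; last by rewrite mxE.
rewrite big_mkcond (bigD1 a) //= eqxx big1 ?addr0; first by case: inversion.
by move=> i ia; rewrite eq_sym (negPf ia); case: inversion.
Qed.

Lemma KPvec_wt w : wtspace (codewt w) (KPvec K n w (iota 0 (pbound w))).
Proof. by rewrite -codewtE; exact: wt_KPvec. Qed.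

(* Leibniz rule for nilpotency orders. *)
Lemma iter_tpure (M N : bmodule K n) (x : borel K n) d a b (m : M) (v : N) : (a + b <= d.+1)%N ->
  iter a (bact x) m = 0 -> iter b (bact x) v = 0 -> iter d (bact x) (tpure m v : tens M N) = 0.
Proof.
have t0l v' : tpure 0 v' = 0 :> tens M N by exact: linear_at0 (tpure_linearl v').
elim: d a b m v => [|d IH] a b m v abd mk vk.
  case: a abd mk => [_ /= ->|a abd _]; first exact: t0l.
  case: b abd vk => [_ /= ->|b]; last by lia.
  exact: linear0.
case: a abd mk => [_ /= ->|a abd mk]; first by rewrite t0l -iterS; exact: iter_linear0.
case: b abd vk => [_ /= ->|b abd vk]; first by rewrite linear0 -iterS; exact: iter_linear0.
rewrite iterSr [bact x _]tact_pure iterDlin (IH a b.+1) ?(IH a.+1 b) ?addr0 //; try lia.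
  by rewrite -iterSr.
by rewrite -iterSr.
Qed.

Section Wedge.
Variables (a b : 'I_n) (ab : (a < b)%N).
Let x := E K n a b.

Lemma unit_delta (i : 'I_n) : bact x (delta_mx i 0 : V) = (i == b)%:R *: (delta_mx a 0 : V).
Proof.
apply/matrixP => p q; rewrite !mxE (bigD1 b) //= big1 => [|k kb]; last first.
  by rewrite !mxE [k == b :> nat](negPf kb) !andbF mul0r.
by rewrite !mxE ab eqxx (ord1 q) !andbT addr0 -natrM !mulnb -natrM mulnb andbC eq_sym.
Qed.

Lemma tpure_seq0 l (v : nat -> V) p : (p < l)%N -> tpure_seq l (upd v p 0) = 0.
Proof.
move=> pl; have := tpure_seqP v (-1) 0 0 pl; rewrite scaler0 addr0 scaleN1r => H.
by rewrite H addNr.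
Qed.

Lemma bact_seq0 l (v : nat -> V) : (forall p, (p < l)%N -> bact x (v p) = 0) ->
  bact x (tpure_seq l v) = 0.
Proof.
by move=> H; rewrite bact_tpure_seq big1 // => p _; rewrite H // tpure_seq0.
Qed.

Variables (l : seq 'I_n) (ul : uniq l).
Let v := nth (0 : V) [seq delta_mx i 0 : V | i <- l].

Let vE p : (p < size l)%N -> v p = delta_mx (nth a l p) 0.
Proof. by move=> pl; rewrite /v (nth_map a). Qed.

Let bact_v p : (p < size l)%N -> nth a l p != b -> bact x (v p) = 0.
Proof. by move=> pl pb; rewrite vE // unit_delta (negPf pb) scale0r. Qed.

(** The operator e_ab only replaces u_b by u_a: it kills a wedge without u_b, produces a repeated
    factor if u_a is present, and cannot act twice. *)
Lemma wedge_nil k : k = size l ->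
  iter ((b \in l) && (a \notin l)).+1 (bact x) (wedge k v : extpow V k) = 0.
Proof.
move=> ->.
have ext0 z : bact x (toq (@alt_rel K n V (size l)) z : extpow V _) = toq _ (bact x z) by exact: extactE.
have [bl|bl] := boolP (b \in l); last first.
  rewrite -[LHS]/(bact x (toq _ _ : extpow V _)) ext0 bact_seq0 ?linear0 // => p pl; apply: bact_v => //.
  by apply: contraNneq bl => <-; exact: mem_nth.
pose p := index b l; have pl : (p < size l)%N by rewrite index_mem.
have lp : nth a l p = b by rewrite nth_index.
have xv : bact x (tpure_seq (size l) v) = tpure_seq (size l) (upd v p (delta_mx a 0)).
  rewrite bact_tpure_seq (bigD1 (Ordinal pl)) // big1 ?addr0 => [|q /andP[_ qp]]; last first.
    rewrite bact_v ?tpure_seq0 //; apply: contra_neq qp => qb; apply: val_inj => /=.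
    by apply/eqP; rewrite -(nth_uniq a _ pl ul) // qb lp.
  by rewrite [LHS]addr0 -[nat_of_ord _]/p vE // unit_delta lp eqxx scale1r.
have [al|al] := boolP (a \in l).
  rewrite -[LHS]/(bact x (toq _ _ : extpow V _)) ext0 xv -[RHS](linear0 (toq _)); apply/toqE; rewrite subr0.
  pose q := index a l; have ql : (q < size l)%N by rewrite index_mem.
  have lq : nth a l q = a by rewrite nth_index.
  have pq : p != q by apply/eqP => pq; move: lp; rewrite pq lq => abE; move: ab; rewrite abE ltnn.
  have eq_pq : upd v p (delta_mx a 0) p = upd v p (delta_mx a 0) q.
    by rewrite /upd eqxx eq_sym (negPf pq) vE // lq.
  apply: lspanp_gen; have [lt|lt|/eqP] := ltngtP p q; last by rewrite (negPf pq).
    by apply: (@AltRel _ _ _ _ _ p q) => //; rewrite lt.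
  by apply: (@AltRel _ _ _ _ _ q p) => //; rewrite lt.
rewrite -[LHS]/(bact x (bact x (toq _ _ : extpow V _))) !ext0 xv bact_seq0 ?linear0 // => q ql; rewrite /upd.
case: eqP => [_|/eqP qp]; first by rewrite unit_delta -val_eqE /= ltn_eqF // scale0r.
by apply: bact_v => //; apply: contra_neq qp => qb; apply/eqP; rewrite -(nth_uniq a _ pl ul) // qb lp.
Qed.

End Wedge.

(** Each exterior factor has order at most two, and at most one unless it contains u_b and not u_a;
    by the Leibniz rule the excesses over one add up. *)
Lemma KPvec_nil w js (a b : 'I_n) : (a < b)%N ->
  iter (count (fun j => inversion w b j && ~~ inversion w a j) js).+1 (bact (E K n a b)) (KPvec K n w js) = 0.
Proof.
move=> ab; elim: js => [|j js IH].
  by rewrite /= [pairing _ _](_ : _ = 0) ?scale0r // /pairing big1 // => i _; rewrite mxE mul0r.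
pose l := [seq i : 'I_n <- enum 'I_n | inversion w i j].
have W : iter ((b \in l) && (a \notin l)).+1 (bact (E K n a b)) (KPwedge K n w j) = 0.
  exact: (@wedge_nil a b ab l (filter_uniq _ (enum_uniq _)) _ (size_map _ _)).
apply: (iter_tpure (M := KPext K n w j) _ W IH).
have lE (i : 'I_n) : (i \in l) = inversion w i j by rewrite mem_filter mem_enum andbT.
by rewrite !lE /= addSn addnS.
Qed.

Lemma KPvec_rel w N : increasing_from n w -> (pbound w <= N)%N ->
  kprel N w (KPvec K n w (iota 0 (pbound w))).
Proof.
move=> incw wN a b ab; have [nb|bn] := leqP n b.
  apply: (@iter_eq0_le _ _ _ 1) => //; rewrite /= -[LHS]/(bact (E K n a b) _) unit_mx_ge //.
  exact: bact0l.
have an := ltn_trans ab bn.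
have := @KPvec_nil w (iota 0 (pbound w)) (Ordinal an) (Ordinal bn) ab.
apply: (@iter_eq0_le _ _ (bact (E K n a b))); rewrite ltnS /mm -!size_filter.
(* The indices j counted on the left go injectively to the values c = w j counted by [mm]. *)
rewrite -(size_map w); apply: uniq_leq_size.
  by rewrite map_inj_uniq ?filter_uniq ?iota_uniq //; exact: pval_inj.
move=> c /mapP[j]; rewrite mem_filter mem_iota add0n /= => /andP[/andP[h1 h2] jb] ->.
rewrite mem_filter mem_iota add0n /= pvalK; move: h1 h2; rewrite /inversion => /andP[bj wjb].
rewrite bj wjb (ltn_trans ab bj) /= -leqNgt => h2.
rewrite (@fperm_lt w N) ?(leq_trans jb) // ltn_neqAle h2 !andbT.
by rewrite (inj_eq (@pval_inj w)) ltn_eqF // (ltn_trans ab).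
Qed.

End KPVector.

(** * The order on weights *)

Section CodesAndPositions.
Local Open Scope nat_scope.

Lemma count_uniq_eq (T1 T2 : eqType) (f : T1 -> T2) (P : pred T1) (Q : pred T2) s t :
  injective f -> uniq s -> uniq t ->
  (forall x, x \in s -> P x -> f x \in t /\ Q (f x)) ->
  (forall y, y \in t -> Q y -> exists x, [/\ x \in s, P x & y = f x]) ->
  count P s = count Q t.
Proof.
move=> finj us ut PQ QP; rewrite -!size_filter -(size_map f).
apply/perm_size/uniq_perm; rewrite ?map_inj_uniq ?filter_uniq // => y.
apply/mapP/idP => [[x]|]; rewrite mem_filter => /andP[].
  by move=> Px xs ->; have [ft Qf] := PQ x xs Px; rewrite mem_filter ft Qf.
by move=> Qy yt; have [x [xs Px ->]] := QP y yt Qy; exists x; rewrite // mem_filter Px.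
Qed.

Section Positions.
Variable n : nat.
Implicit Types w v : fperm.

(* The position of the value c among the first n ones, or n if there is none. *)
Definition bpos w (c : nat) : nat := minn n (pvalV w c).

Lemma bpos_le w c : bpos w c <= n. Proof. exact: geq_minl. Qed.

Lemma bpos_val w i : i < n -> bpos w (w i) = i.
Proof. by move=> i_n; rewrite /bpos pvalK; apply/minn_idPr/ltnW. Qed.

Lemma val_bpos w c : bpos w c < n -> w (bpos w c) = c.
Proof. rewrite /bpos; case: (leqP n (pvalV w c)) => [_|_ _]; rewrite ?ltnn ?pvalVK //. Qed.

Lemma lt_bpos w i c : i < n -> (i < bpos w c) = (i < pvalV w c).
Proof. by move=> i_n; rewrite /bpos leq_min i_n. Qed.

Lemma code_values w i : code w i = count (fun c => i < pvalV w c) (iota 0 (w i)).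
Proof.
apply: (@count_uniq_eq _ _ w); rewrite ?iota_uniq //; first exact: pval_inj.
  by move=> j _ /andP[ij wji]; rewrite mem_iota add0n wji pvalK.
move=> c; rewrite mem_iota add0n /= => ci ic; exists (pvalV w c); rewrite pvalVK.
have inv : inversion w i (pvalV w c) by rewrite /inversion ic pvalVK.
by rewrite mem_iota add0n (inversion_bound inv).
Qed.

Lemma code_bpos w i : i < n -> code w i = count (fun c => i < bpos w c) (iota 0 (w i)).
Proof. by move=> i_n; rewrite code_values; apply: eq_count => c; rewrite lt_bpos. Qed.

Lemma code_val w i : code w i + count (fun k => w k < w i) (iota 0 i) = w i.
Proof.
rewrite code_values -[RHS](size_iota 0) -(count_predC (fun c => i < pvalV w c)); congr (_ + _).
apply: (@count_uniq_eq _ _ w); rewrite ?iota_uniq //; first exact: pval_inj.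
  by move=> k; rewrite !mem_iota !add0n /= => ki wki; rewrite wki pvalK -leqNgt ltnW.
move=> c; rewrite mem_iota add0n /= -leqNgt => ci ic; exists (pvalV w c); rewrite pvalVK.
rewrite mem_iota add0n /= ltn_neqAle ic andbT; split=> //; apply/eqP => cE.
by move: ci; rewrite -cE pvalVK ltnn.
Qed.

(** For two solutions x < y, all y - x numbers of [x, y) would have to occur among the earlier
    values, but x does not. *)
Lemma code_fixpoint (w : nat -> nat) i C x y : {in gtn i &, injective w} ->
  (forall k, k < i -> w k <> x) -> (forall k, k < i -> w k <> y) ->
  C + count (fun k => w k < x) (iota 0 i) = x -> C + count (fun k => w k < y) (iota 0 i) = y ->
  x = y.
Proof.
move=> winj; wlog xy : x y / x < y.
  by move=> H hx hy ex ey; have [lt|lt|//] := ltngtP x y; [exact: (H x y)|apply/esym; exact: (H y x)].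
move=> hx hy ex ey; suff : count (fun k => w k < y) (iota 0 i) <
    count (fun k => w k < x) (iota 0 i) + (y - x) by lia.
have -> : count (fun k => w k < y) (iota 0 i) =
    count (fun k => w k < x) (iota 0 i) + count (fun k => x <= w k < y) (iota 0 i).
  rewrite -count_predUI [X in _ = _ + X](_ : _ = 0) ?addn0; last first.
    by apply/eqP; rewrite -leqn0 leqNgt -has_count; apply/hasPn => k _ /=; lia.
  by apply: eq_count => k /=; lia.
rewrite ltn_add2l -size_filter -(size_map w).
apply: (@leq_ltn_trans (size (iota x.+1 (y - x.+1)))); last by rewrite size_iota; lia.
apply: uniq_leq_size.
  rewrite map_inj_in_uniq ?filter_uniq ?iota_uniq // => k l; rewrite !mem_filter !mem_iota !add0n.
  by move=> /and3P[_ _ ki] /and3P[_ _ li]; exact: winj.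
move=> z /mapP[k]; rewrite mem_filter mem_iota add0n => /and3P[/andP[h1 h2] _ ki] ->.
by rewrite mem_iota; have := hx k ki; move=> *; lia.
Qed.

(** The code and the earlier values determine the next value; permutations with related codes are
    compared in this way, position by position. *)
Lemma val_of_code w (f : nat -> nat) i :
  (forall k, k < i -> w k = f k) -> {in gtn i.+1 &, injective f} ->
  code w i + count (fun k => f k < f i) (iota 0 i) = f i -> w i = f i.
Proof.
move=> wf finj H; apply: (@code_fixpoint f i (code w i)).
- by move=> k l ki li; apply: finj; rewrite inE ltnW.
- by move=> k ki; rewrite -wf // => /pval_inj; lia.
- by move=> k ki /finj; rewrite !inE ltnS (ltnW ki) leqnn => /(_ isT isT); lia.
- rewrite -[RHS](code_val w i); congr (_ + _).
  by apply: eq_in_count => k; rewrite mem_iota add0n /= => ki; rewrite (wf k ki).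
- exact: H.
Qed.

(** If c sat beyond n in both, at different positions, the permutation placing it later would have a
    smaller value at its earlier position, as it increases there; but on smaller values the two
    agree. So the order on inverse permutations can be read off from [bpos]. *)
Lemma first_diff w v c : increasing_from n w -> increasing_from n v ->
  (forall d, d < c -> pvalV w d = pvalV v d) -> pvalV w c <> pvalV v c -> bpos w c <> bpos v c.
Proof.
wlog lt : w v / pvalV w c < pvalV v c.
  move=> H iw iv eqd ne; have [lt|lt|//] := ltngtP (pvalV w c) (pvalV v c); first exact: H.
  by move=> /esym; apply: H => // [d dc|/esym//]; rewrite eqd.
move=> iw iv eqd _; rewrite /bpos; have [nw|wn] := leqP n (pvalV w c); last first.
  by lia.
have := iv _ _ nw lt; rewrite pvalVK => H.
by have := eqd _ H; rewrite pvalK => /(congr1 w); rewrite !pvalVK; lia.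
Qed.

Lemma bpos_lex w v : increasing_from n w -> increasing_from n v ->
  lex_le (pvalV w) (pvalV v) <-> lex_le (bpos w) (bpos v).
Proof.
move=> iw iv; split=> [[eq|[c eq lt]]|[eq|[c eq lt]]].
- by left=> c; rewrite /bpos eq.
- right; exists c; first by move=> d dc; rewrite /bpos eq.
  have : bpos w c <> bpos v c by apply: first_diff => //; lia.
  by rewrite /bpos; lia.
- left=> c; have [d] := ubnP c; elim: d c => // d IH c cd.
  apply/eqP/negP => /negP/eqP ne; apply: (first_diff iw iv _ ne (eq c)) => c' c'c.
  by apply: IH; lia.
- right; exists c; last by move: lt; rewrite /bpos; lia.
  move=> d; have [m] := ubnP d; elim: m d => // m IH d dm dc.
  apply/eqP/negP => /negP/eqP ne; apply: (first_diff iw iv _ ne (eq d dc)) => c' c'c.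
  by apply: IH; lia.
Qed.

Lemma lex_le_by (f g : nat -> nat) :
  (forall c, (forall d, d < c -> f d = g d) -> f c <> g c -> f c < g c) -> lex_le f g.
Proof.
move=> H; have [eq|] := pselect (f =1 g); first by left.
move=> ne; have ex : exists c, f c != g c.
  by apply: contrapT => nex; apply: ne => c; apply/eqP/negPn/negP => fg; apply: nex; exists c.
right; case: (ex_minnP ex) => c /eqP fgc cmin; exists c => [d dc|].
  by apply/eqP/negPn/negP => /cmin; lia.
by apply: H => // d dc; apply/eqP/negPn/negP => /cmin; lia.
Qed.

(* As long as v and w agree, the columns T c are forced to be those of the diagram of w. *)
Lemma weight_bound w v N (T : nat -> nat -> bool) :
  (forall c i, T c i -> c < N) -> (forall c i, T c i -> i < bpos w c) ->
  (forall c, count (T c) (iota 0 n) = count (fun i => (i < bpos w c) && (c < w i)) (iota 0 n)) ->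
  (forall i, i < n -> code v i = count (T ^~ i) (iota 0 N)) ->
  lex_le (bpos w) (bpos v).
Proof.
move=> TN Tb Tsz Tcode; apply: lex_le_by => c eqd ne.
rewrite ltn_neqAle (introF eqP ne) /= leqNgt; apply/negP => lt.
have Tcode' i N' : i < n -> N <= N' -> code v i = count (T ^~ i) (iota 0 N').
  move=> i_n NN'; rewrite Tcode // -(subnKC NN') iotaD count_cat add0n.
  rewrite [X in _ = _ + X](_ : _ = 0) ?addn0 //.
  apply/eqP; rewrite -leqn0 leqNgt -has_count; apply/hasPn => d; rewrite mem_iota => /andP[Nd _].
  by apply/negP => /TN; lia.
(* If column q avoids the rows in which w takes values below q, it can only use the rows of the
   diagram of w, and its size leaves no choice. *)
have forced q : (forall q', q' < q -> bpos w q' < n -> ~~ T q (bpos w q')) ->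
    forall i, i < n -> T q i = (i < bpos w q) && (q < w i).
  move=> Hq i i_n; have sub k : k < n -> T q k -> (k < bpos w q) && (q < w k).
    move=> kn Tk; rewrite (Tb _ _ Tk) ltnNge leq_eqVlt; apply/negP => /orP[/eqP wk|wk].
      by have := Tb _ _ Tk; rewrite -wk bpos_val // ltnn.
    by have := Hq _ wk; rewrite bpos_val // kn Tk => /(_ isT).
  apply/idP/idP; first exact: sub.
  move=> Hi; apply: contraT => nT.
  have := Tsz q; suff : count (T q) (iota 0 n) < count (fun i => (i < bpos w q) && (q < w i)) (iota 0 n) by lia.
  rewrite -!size_filter; apply: (@leq_ltn_trans (size [seq k <- [seq k <- iota 0 n | (k < bpos w q) && (q < w k)] | k != i])).
    apply: uniq_leq_size; first by rewrite filter_uniq // iota_uniq.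
    move=> k; rewrite !mem_filter mem_iota add0n => /and3P[Tk _ kn]; rewrite sub // kn /= andbT.
    by apply: contraNneq nT => <-.
  rewrite [X in _ < X](_ : _ = (size [seq k <- [seq k <- iota 0 n | (k < bpos w q) && (q < w k)] | k != i]).+1) //.
  rewrite -rem_filter ?filter_uniq ?iota_uniq // size_rem ?prednK //.
    by rewrite -has_predT; apply/hasP; exists i => //; rewrite mem_filter Hi mem_iota.
  by rewrite mem_filter Hi mem_iota.
(* The row [bpos w q] has its full length, the code of v, already in the columns before q, since v
   takes the value q there too; so it meets no column from q on. *)
have used q : q < c -> bpos w q < n -> forall q', q <= q' -> ~~ T q' (bpos w q).
  have [m] := ubnP q; elim: m q => // m IH q qm qc pn q' qq'.
  have eq_bq d : d < q -> T d (bpos w q) = (bpos w q < bpos v d).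
    move=> dq; rewrite forced // => [|d' d'd d'n]; last by apply: IH => //; lia.
    by rewrite val_bpos // dq andbT (eqd d) //; lia.
  have := Tcode' _ (maxn N q'.+1) pn (leq_maxl _ _).
  have vp : v (bpos w q) = q by rewrite eqd // val_bpos // -eqd.
  rewrite code_bpos // vp.
  have -> : maxn N q'.+1 = q + (maxn N q'.+1 - q) by lia.
  rewrite iotaD count_cat add0n (eq_in_count (a1 := T^~ (bpos w q)) (a2 := fun d => bpos w q < bpos v d)); last first.
    by move=> d; rewrite mem_iota add0n => /andP[_ dq]; exact: eq_bq.
  move=> H; have : count (T^~ (bpos w q)) (iota q (maxn N q'.+1 - q)) = 0.
    apply: (@addnI (count (fun c => bpos w q < bpos v c) (iota 0 q))); rewrite addn0; exact: esym H.
  move=> /eqP; rewrite -leqn0 leqNgt -has_count => /hasPn; apply.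
  by rewrite mem_iota; lia.
(* In the row [bpos v c] the columns before c exhaust the code of v, yet column c would have a box
   there as well. *)
have jn : bpos v c < n by apply: leq_trans (bpos_le w c).
set j := bpos v c in lt jn; have vj : v j = c by apply: val_bpos.
have cwj : c < w j.
  rewrite ltnNge leq_eqVlt; apply/negP => /orP[/eqP wj|wj].
    by move: lt; rewrite -wj bpos_val // ltnn.
  by have := eqd _ wj; rewrite bpos_val // => E; have := @val_bpos v (w j); rewrite -E jn => /(_ isT); lia.
have Tj q : q <= c -> T q j = (j < bpos w q).
  move=> qc; rewrite forced // => [|d dq dn]; last by apply: used => //; lia.
  by rewrite (leq_ltn_trans qc cwj) andbT.
have := Tcode' _ (maxn N c.+1) jn (leq_maxl _ _).
rewrite code_bpos // vj; have -> : maxn N c.+1 = c + (maxn N c.+1 - c).-1.+1 by lia.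
rewrite iotaD count_cat add0n /= Tj // lt.
rewrite (eq_in_count (a1 := T^~ j) (a2 := fun d => j < bpos v d)); last first.
  by move=> d; rewrite mem_iota add0n => /andP[_ dc]; rewrite Tj ?eqd //; lia.
by move=> /eqP; rewrite -[X in X == _]addn0 eqn_add2l.
Qed.

End Positions.

End CodesAndPositions.

(** * Changes of the code that do not lower a permutation in the order *)

Section ForbiddenMoves.
Local Open Scope nat_scope.

Section NotBelow.
Variable n : nat.
Implicit Types w v : fperm.

Lemma count_iota_le x N (P : pred nat) : x <= N ->
  count P (iota 0 x) = count (fun d => (d < x) && P d) (iota 0 N).
Proof.
move=> xN; rewrite -(subnKC xN) iotaD count_cat add0n [X in _ = _ + X](_ : _ = 0) ?addn0.
  by apply: eq_in_count => d; rewrite mem_iota => /andP[_ ->].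
apply/eqP; rewrite -leqn0 leqNgt -has_count; apply/hasPn => d; rewrite mem_iota => /andP[xd _] /=.
by rewrite ltnNge xd.
Qed.

(** Let c be the least value placed differently and p its position in w. Values below c contribute
    equally to both codes at p, and v counts c as well, since in v it lies beyond p while v p >
    c. *)
Lemma lex_first_code w v : lex_le (bpos n w) (bpos n v) ->
  (exists2 p, p < n & code w p <> code v p) ->
  exists p, [/\ p < n, code w p < code v p, p < bpos n v (w p) &
    forall d, d < w p -> bpos n w d = bpos n v d].
Proof.
move=> [eq|[c eq lt]] [p0 p0n ne].
  case: ne; have vw : v p0 = w p0 by rewrite -{1}(@bpos_val n w p0) // eq val_bpos // -eq bpos_val.
  by rewrite !(code_bpos _ p0n) vw; apply: eq_count => d; rewrite eq.
have pn : bpos n w c < n by apply: leq_trans lt (bpos_le _ _ _).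
exists (bpos n w c); have wp := val_bpos pn; rewrite wp; split=> //.
set p := bpos n w c in lt pn wp *.
have cv : c < v p.
  rewrite ltnNge leq_eqVlt; apply/negP => /orP[/eqP vp|vp].
    by move: lt; rewrite -vp bpos_val // ltnn.
  have := eq _ vp; rewrite bpos_val // => E.
  by have := @val_bpos n w (v p); rewrite E pn => /(_ isT); lia.
rewrite !(code_bpos _ pn) wp (count_iota_le _ (ltnW cv)) -[X in X < _]addn0.
apply: (@leq_trans (count (fun d => (d < c) && (p < bpos n v d)) (iota 0 (v p)) +
   count (fun d => d == c) (iota 0 (v p)))).
  rewrite (count_uniq_mem c (iota_uniq _ _)) mem_iota cv /= addn0 addn1 ltnS.
  by apply: sub_count => d /= /andP[dc]; rewrite dc eq.
by apply: count_geD => d; [move=> /andP[]|move=> /eqP ->|move=> /andP[dc _]; rewrite ltn_eqF].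
Qed.

Lemma bpos_same w v c x : (forall d, d < c -> bpos n w d = bpos n v d) -> x < n ->
  (w x < c) || (v x < c) -> w x = v x.
Proof.
move=> eq xn /orP[h|h]; have := eq _ h; rewrite bpos_val //.
  by move=> E; have := @val_bpos n v (w x); rewrite -E => /(_ xn) ->.
by move=> E; have := @val_bpos n w (v x); rewrite E => /(_ xn).
Qed.

Lemma code_same w v c x : (forall d, d < c -> bpos n w d = bpos n v d) -> x < n ->
  w x < c -> code w x = code v x.
Proof.
move=> eq xn wx; have vx : w x = v x by apply: (bpos_same eq) => //; rewrite wx.
rewrite !(code_bpos _ xn) -vx; apply: eq_in_count => d; rewrite mem_iota add0n => /andP[_ dx].
by rewrite eq // (ltn_trans dx).
Qed.

(** Otherwise the first difference is at p = i, the only index where the code grows, so v and w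
    agree on the values below w i. If w j < w i, the codes at j agree. If w i < w j, the code of w
    at j exceeds that of v by at most m_ij(w), since besides the common values it counts only those
    between w i and w j that lie beyond j. *)
Lemma raise_not_below w v N i j : i < j -> j < n -> w j < N ->
  (forall p, p < n -> p <> i -> p <> j -> code v p = code w p) ->
  code v i = code w i + (mm N w i j).+1 -> code v j + (mm N w i j).+1 = code w j ->
  ~ lex_le (bpos n w) (bpos n v).
Proof.
move=> ij jn wjN same ci cj lex; have i_n := ltn_trans ij jn.
have [|p [pn cp bp eq]] := lex_first_code lex; first by exists i => //; lia.
have pi : p = i.
  have [//|/eqP npi] := eqVneq p i; have [pj|/eqP npj] := eqVneq p j; first by move: cp; rewrite pj; lia.
  by move: cp; rewrite same // ltnn.
subst p; have [wji|] := ltnP (w j) (w i).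
  by have := code_same eq jn wji; lia.
rewrite leq_eqVlt => /orP[/eqP/pval_inj|wij]; first by lia.
have vj : w i <= v j.
  by rewrite leqNgt; apply/negP => h; have := @bpos_same w v _ j eq jn; rewrite h orbT => /(_ isT); lia.
have h1 : code w j <= count (fun d => (d < w i) && (j < bpos n w d)) (iota 0 N) + mm N w i j.
  rewrite (code_bpos _ jn) (count_iota_le _ (ltnW wjN)); apply: count_leU => d.
  rewrite lt_bpos // => /andP[dj jd]; have := posP w d i; rewrite dj jd !andbT; move=> *; lia.
have h2 : count (fun d => (d < w i) && (j < bpos n w d)) (iota 0 N) <= code v j.
  rewrite (code_bpos _ jn) -(@count_iota_le (w i) N); last by lia.
  rewrite (count_iota_le _ vj); apply: (@leq_trans (count (fun d => (d < w i) && (j < bpos n w d)) (iota 0 (v j)))).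
    by rewrite -(count_iota_le _ vj).
  by apply: sub_count => d /andP[dw]; rewrite eq.
lia.
Qed.

(** Reversing the values, now p = j. In the case w j < w i the code of v at i counts w j and the
    values below w j that lie beyond i. The values between w j and w i that lie beyond i are at most
    m_ij(u) in number, because by the minimality of (i, j) none of them sits between i and j. *)
Lemma lower_not_below w v (u : fperm) N i j : i < j -> j < n -> u i < N -> u j < N ->
  (forall k, k < n -> u k < N) ->
  (forall k, k < n -> w k = N.-1 - u k) ->
  (forall k, i < k -> k < j -> ~ (u i < u k < u j)) ->
  (forall p, p < n -> p <> i -> p <> j -> code v p = code w p) ->
  code v j = code w j + (mm N u i j).+1 -> code v i + (mm N u i j).+1 = code w i ->
  ~ lex_le (bpos n w) (bpos n v).
Proof.
move=> ij jn uiN ujN uN wE nok same cj ci lex; have i_n := ltn_trans ij jn.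
have [|p [pn cp bp eq]] := lex_first_code lex; first by exists i => //; lia.
have pj : p = j.
  have [//|/eqP npj] := eqVneq p j; have [pi|/eqP npi] := eqVneq p i; first by move: cp; rewrite pi; lia.
  by move: cp; rewrite same // ltnn.
subst p; have [wij|] := ltnP (w i) (w j).
  by have := code_same eq i_n wij; lia.
rewrite leq_eqVlt => /orP[/eqP/pval_inj|wji]; first by lia.
have wiN : w i < N by rewrite wE //; lia.
have vi : w j < v i.
  rewrite ltn_neqAle; apply/andP; split.
    by apply: contraTneq bp => ->; rewrite bpos_val // -leqNgt ltnW.
  by rewrite leqNgt; apply/negP => h; have := @bpos_same w v _ i eq i_n; rewrite h orbT => /(_ isT); lia.
pose L := count (fun d => i < bpos n w d) (iota 0 (w j)).
have h2 : L < code v i.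
  rewrite (code_bpos _ i_n) /L (count_iota_le _ (ltnW vi)) -[X in X < _]addn0.
  apply: (@leq_trans (count (fun d => (d < w j) && (i < bpos n v d)) (iota 0 (v i)) +
     count (fun d => d == w j) (iota 0 (v i)))).
    rewrite (count_uniq_mem (w j) (iota_uniq _ _)) mem_iota vi /= addn0 addn1 ltnS.
    by apply: sub_count => d /= /andP[dc]; rewrite dc eq.
  apply: count_geD => d; [by move=> /andP[]|move=> /eqP ->|by move=> /andP[dc _]; rewrite ltn_eqF].
  exact: ltn_trans bp.
have h3 : count (fun d => [&& w j < d, d < w i & i < bpos n w d]) (iota 0 N) <= mm N u i j.
  rewrite /mm -!size_filter -(size_map (fun d => N.-1 - d)); apply: uniq_leq_size.
    rewrite map_inj_in_uniq ?filter_uniq ?iota_uniq // => d d'.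
    by rewrite !mem_filter !mem_iota !add0n => /and3P[_ _ dN] /and3P[_ _ d'N]; lia.
  move=> _ /mapP[d + ->]; rewrite !mem_filter !mem_iota !add0n => /and3P[/and3P[d1 d2 d3] _ dN].
  have := wE i i_n; have := wE j jn => wj wi.
  have jd : j < pvalV u (N.-1 - d).
    rewrite ltnNge; apply/negP; rewrite leq_eqVlt => /orP[/eqP kj|kj].
      by move: d1; rewrite wj -kj pvalVK; lia.
    have kn := ltn_trans kj jn; have := wE _ kn; rewrite pvalVK => wk.
    have dk : d = w (pvalV u (N.-1 - d)) by rewrite wk; lia.
    have ik : i < pvalV u (N.-1 - d) by move: d3; rewrite {1}dk bpos_val.
    by apply: (nok _ ik kj); rewrite pvalVK; lia.
  by rewrite jd; have := uN i i_n; have := uN j jn; move=> *; lia.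
have h1 : code w i <= L + 1 + count (fun d => [&& w j < d, d < w i & i < bpos n w d]) (iota 0 N).
  rewrite (code_bpos _ i_n) (count_iota_le _ (ltnW wiN)).
  apply: (@leq_trans (count (fun d => (d <= w j) && (i < bpos n w d)) (iota 0 N) +
    count (fun d => [&& w j < d, d < w i & i < bpos n w d]) (iota 0 N))).
    by apply: count_leU => d; lia.
  rewrite leq_add2r /L.
  apply: (@leq_trans (count (fun d => (d < w j) && (i < bpos n w d)) (iota 0 N) +
    count (fun d => d == w j) (iota 0 N))); first by apply: count_leU => d; lia.
  apply: leq_add; last by rewrite count_iota_eq leq_b1.
  by rewrite -(@count_iota_le (w j) N) //; lia.
lia.
Qed.

End NotBelow.

End ForbiddenMoves.

(** * Shifting and complementing codes *)

Section WeightOrder.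
Variable n : nat.
Implicit Types lam mu nu : 'rV[int]_n.

Section Shift.
Variables (w w' : fperm) (d : nat).
Hypothesis cE : forall i, (i < n)%N -> code w' i = (code w i + d)%N.

Lemma shift_val i : (i < n)%N -> w' i = (w i + d)%N.
Proof.
have [m] := ubnP i; elim: m i => // m IH i im i_n.
apply: (@val_of_code w' (fun k => w k + d)%N) => [k ki|k l _ _ /addIn /pval_inj //|].
  by apply: IH; lia.
rewrite cE // addnAC -[in RHS](code_val w i); congr (_ + _ + _)%N.
by apply: eq_count => k; rewrite ltn_add2r.
Qed.

Lemma shift_bpos c : bpos n w' c = if (c < d)%N then n else bpos n w (c - d).
Proof.
have H : (bpos n w' c < n)%N -> (d <= c)%N /\ bpos n w (c - d) = bpos n w' c.
  move=> pn; have := val_bpos pn; rewrite shift_val // => cE'; split; first by lia.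
  by rewrite -{1}cE' addnK bpos_val.
have [pn|np] := ltnP (bpos n w' c) n; first by have [dc ->] := H pn; rewrite ltnNge dc.
have -> : bpos n w' c = n by apply/eqP; rewrite eqn_leq bpos_le.
case: ltnP => // dc; apply/eqP; rewrite eqn_leq bpos_le andbT leqNgt; apply/negP => pn.
have := val_bpos pn => wE; have := shift_val pn; rewrite wE subnK // => w'E.
by have := bpos_val w' pn; rewrite w'E => E; move: np; rewrite E leqNgt pn.
Qed.

End Shift.

Lemma shift_lex w v w' v' d :
  (forall i, i < n -> code w' i = code w i + d)%N -> (forall i, i < n -> code v' i = code v i + d)%N ->
  lex_le (bpos n w) (bpos n v) <-> lex_le (bpos n w') (bpos n v').
Proof.
have nlt e : (e + d < d)%N = false by lia.
move=> hw hv; have sw := shift_bpos hw; have sv := shift_bpos hv.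
split=> [[eq|[c eq lt]]|[eq|[c eq lt]]].
- by left=> c; rewrite sw sv eq.
- right; exists (c + d)%N => [e ed|]; last by rewrite sw sv nlt addnK.
  by rewrite sw sv; case: ltnP => // de; apply: eq; lia.
- by left=> c; have := eq (c + d)%N; rewrite sw sv nlt addnK.
- have dc : (d <= c)%N by rewrite leqNgt; apply/negP => cd; move: lt; rewrite sw sv cd ltnn.
  right; exists (c - d)%N => [e ed|]; last by move: lt; rewrite sw sv [(c < d)%N](_ : _ = false) //; lia.
  by have := eq (e + d)%N; rewrite sw sv nlt addnK; apply; lia.
Qed.

Lemma wt_inc lam : increasing_from n (perm_of_wt lam).
Proof. by case: (perm_of_codeP (fun i : 'I_n => `|lam 0%R i|%N)). Qed.

Lemma wt_code lam (i : 'I_n) : nonneg lam -> (code (perm_of_wt lam) i)%:Z = lam 0 i.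
Proof.
move=> nn; have [_ ->] := perm_of_codeP (fun i : 'I_n => `|lam 0%R i|%N).
by rewrite gez0_abs.
Qed.

Lemma wt_codeS lam k d (i : nat) : nonneg (lam + const_mx k) -> (i < n)%N ->
  code (perm_of_wt (lam + const_mx (k + d%:Z))) i = (code (perm_of_wt (lam + const_mx k)) i + d)%N.
Proof.
move=> nn i_n; apply/eqP; rewrite -eqz_nat PoszD.
rewrite (wt_code (Ordinal i_n) nn) (wt_code (Ordinal i_n)) => [|j].
  by rewrite !mxE addrA.
by have := nn j; rewrite !mxE; lia.
Qed.

Lemma wt_lex_shift lam mu k k' : nonneg (lam + const_mx k) -> nonneg (mu + const_mx k) ->
  nonneg (lam + const_mx k') -> nonneg (mu + const_mx k') ->
  lex_le (bpos n (perm_of_wt (lam + const_mx k))) (bpos n (perm_of_wt (mu + const_mx k))) ->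
  lex_le (bpos n (perm_of_wt (lam + const_mx k'))) (bpos n (perm_of_wt (mu + const_mx k'))).
Proof.
move=> l1 m1 l2 m2; have [kk|kk] := boolP (k <= k').
  have -> : k' = k + `|k' - k|%N%:Z by lia.
  by apply: (proj1 (@shift_lex _ _ _ _ _ _ _)) => i i_n; exact: wt_codeS.
have -> : k = k' + `|k - k'|%N%:Z by lia.
by apply: (proj2 (@shift_lex _ _ _ _ _ _ _)) => i i_n; exact: wt_codeS.
Qed.

(** [wt_le] quantifies over all admissible shifts; one suffices, because a shift of the code by d
    only translates the values ([shift_lex]). *)
Lemma wt_leI lam mu k : nonneg (lam + const_mx k) -> nonneg (mu + const_mx k) ->
  \sum_i lam 0 i = \sum_i mu 0 i ->
  lex_le (bpos n (perm_of_wt (lam + const_mx k))) (bpos n (perm_of_wt (mu + const_mx k))) ->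
  wt_le mu lam.
Proof.
move=> l1 m1 E lex k' m2 l2; split.
  under eq_bigr => i _ do rewrite mxE; under [RHS]eq_bigr => i _ do rewrite mxE.
  by rewrite !big_split /= E; congr (_ + _); apply: eq_bigr => i _; rewrite !mxE.
apply/(bpos_lex (wt_inc (lam + const_mx k')) (wt_inc (mu + const_mx k'))).
exact: wt_lex_shift lex.
Qed.

Lemma wt_leE lam mu k : nonneg (lam + const_mx k) -> nonneg (mu + const_mx k) -> wt_le mu lam ->
  lex_le (bpos n (perm_of_wt (lam + const_mx k))) (bpos n (perm_of_wt (mu + const_mx k))).
Proof.
by move=> l1 m1 /(_ k m1 l1) [_ lex]; apply/(bpos_lex (wt_inc (lam + const_mx k)) (wt_inc (mu + const_mx k))).
Qed.

Lemma exists_nonneg lam : exists k : nat, forall d, nonneg (lam + const_mx (k + d)%N%:Z).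
Proof.
exists (\sum_i `|(lam 0 i)%R|)%N => d i; rewrite !mxE (bigD1 i) //=; lia.
Qed.

Section Complement.
Variables (N : nat) (u w : fperm) (nN : (n <= N)%N) (uN : (pbound u <= N)%N).
Hypothesis cE : forall i, (i < n)%N -> (code w i + code u i + i.+1)%N = N.

(** Reversal turns the earlier values above u i into those below; as i values come earlier, the code
    of N - 1 - u at i is N - (i + 1) minus that of u, and [val_of_code] applies. *)
Lemma compl_val i : (i < n)%N -> w i = (N.-1 - u i)%N.
Proof.
have uN' k : (k < n)%N -> (u k < N)%N by move=> kn; apply: fperm_lt => //; lia.
have [m] := ubnP i; elim: m i => // m IH i im i_n.
apply: (@val_of_code w (fun k => N.-1 - u k)%N) => [k ki|k l|].
- by apply: IH; lia.
- rewrite !inE => ki li E; apply: (@pval_inj u); have := uN' k; have := uN' l; lia.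
- have := cE i_n; have := code_val u i; have := uN' i i_n.
  have -> : count (fun k => N.-1 - u k < N.-1 - u i)%N (iota 0 i) =
      count (predC (fun k => u k < u i)%N) (iota 0 i).
    apply: eq_in_count => k; rewrite mem_iota add0n /= => ki.
    have := uN' k; have := uN' i i_n; have : u k <> u i by move/pval_inj; lia.
    lia.
  have := count_predC (fun k => u k < u i)%N (iota 0 i); rewrite size_iota; lia.
Qed.

Lemma compl_bpos c : bpos n w c = if (c < N)%N then bpos n u (N.-1 - c) else n.
Proof.
have uN' k : (k < n)%N -> (u k < N)%N by move=> kn; apply: fperm_lt => //; lia.
have [pn|np] := ltnP (bpos n w c) n.
  have := val_bpos pn; rewrite compl_val //; have := uN' _ pn => h cw.
  rewrite (_ : (c < N)%N); last by lia.
  by rewrite (_ : N.-1 - c = u (bpos n w c))%N ?bpos_val //; lia.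
have -> : bpos n w c = n by apply/eqP; rewrite eqn_leq bpos_le.
case: ltnP => // cN; apply/eqP; rewrite eqn_leq bpos_le andbT leqNgt; apply/negP => pn.
have := val_bpos pn => uE; have wE := compl_val pn.
have wc : w (bpos n u (N.-1 - c)) = c by rewrite wE uE; lia.
by have := bpos_val w pn; rewrite wc => E; move: np; rewrite E leqNgt pn.
Qed.

End Complement.
End WeightOrder.

(** * Weight modules *)

Section Subspaces.
Variables (K : fieldType).

(** Among the matrices whose row space lies in A, one of maximal rank is taken; a vector of A
    outside its row space would raise the rank. *)
Lemma subspace_mx k (A : 'rV[K]_k -> Prop) : A 0 -> (forall a u v, A u -> A v -> A (a *: u + v)) ->
  exists B : 'M[K]_k, forall r, A r <-> (r <= B)%MS.
Proof.
move=> A0 Alin; pose P d := `[< exists2 B : 'M[K]_k, forall r, (r <= B)%MS -> A r & \rank B = d >].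
have exP : exists d, P d.
  by exists 0%N; apply/asboolP; exists 0; [move=> r; rewrite submx0 => /eqP ->|rewrite mxrank0].
have ubP d : P d -> (d <= k)%N by move=> /asboolP [B _ <-]; exact: rank_leq_row.
case: (ex_maxnP exP ubP) => d /asboolP [B BA dB] dmax; exists B => r; split=> [Ar|]; last exact: BA.
have BrA : forall r', (r' <= B + r)%MS -> A r'.
  move=> r' /sub_addsmxP [[u v] ->] /=.
  have Av : A (v *m r) by rewrite [v]mx11_scalar mul_scalar_mx -[_ *: _]addr0; apply: Alin.
  have AB : A (u *m B) by apply: BA; exact: submxMl.
  by rewrite -[u *m B]scale1r; apply: Alin.
have := dmax (\rank (B + r)%MS); have -> : P (\rank (B + r)%MS).
  by apply/asboolP; exists (B + r)%MS.
move=> /(_ isT); rewrite -dB => le.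
have : (B + r <= B)%MS by rewrite -(mxrank_leqif_sup (addsmxSl B r)) eqn_leq mxrankS ?addsmxSl.
by apply: submx_trans; exact: addsmxSr.
Qed.

Lemma findim_sub (V : lmodType K) k (f : {linear V -> 'rV[K]_k}) (P : V -> Prop) :
  injective f -> P 0 -> (forall a u v, P u -> P v -> P (a *: u + v)) ->
  exists s : seq V, forall v, P v <-> lspan (fun v => v \in s) v.
Proof.
move=> finj P0 Plin; pose A r := exists2 v, P v & f v = r.
have [||B BA] := @subspace_mx k A.
- by exists 0; rewrite ?linear0.
- move=> a _ _ [u Pu <-] [v Pv <-]; exists (a *: u + v); rewrite ?linearP //; exact: Plin.
have rowA i : A (row i B) by apply/BA; exact: row_sub.
pose z i := sval (cid2 (rowA i)).
have zP i : P (z i) /\ f (z i) = row i B by rewrite /z; case: cid2.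
exists (codom z) => v; split=> [Pv|].
  have : (f v <= B)%MS by apply/BA; exists v.
  move=> /submxP [x fv]; have -> : v = \sum_i x 0 i *: z i.
    apply: finj; rewrite fv linear_sum mulmx_sum_row; apply: eq_bigr => i _.
    by rewrite linearZ /=; have [_ ->] := zP i.
  elim/big_ind: _ => [|y y'|i _]; [exact: lspan0|exact: lspanD|].
  by apply/lspanZ/lspan_gen/codom_f.
elim=> [//|y /codomP [i ->]|y y' _ Py _ Py'|a y _ Py]; first by case: (zP i).
  by rewrite -[y]scale1r; apply: Plin.
by rewrite -[_ *: _]addr0; apply: Plin.
Qed.

End Subspaces.

Section Weights.
Variables (K : fieldType) (charK0 : [pchar K] =i pred0) (n : nat).
Implicit Types (M : bmodule K n) (mu nu : 'rV[int]_n).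

Lemma intr_inj0 (a b : int) : a%:~R = b%:~R :> K -> a = b.
Proof.
move=> /eqP; rewrite -subr_eq0 -intrB => H; apply/eqP; rewrite -subr_eq0.
move: H; case: (a - b) => m; rewrite ?NegzE ?mulrNz ?oppr_eq0 -pmulrn.
  by have /pcharf0P -> := charK0.
by have /pcharf0P -> := charK0.
Qed.

Lemma delta_upper (i : 'I_n) : (delta_mx i i : 'M[K]_n) \in upper (K:=K) (n:=n).
Proof.
apply/upperP => a b ba; rewrite mxE; have [ai|//] := eqVneq a i.
by have [bi|//] := eqVneq b i; move: ba; rewrite ai bi ltnn.
Qed.

Definition diag_unit_mx (i : 'I_n) : borel K n := Borel (delta_upper i).

Lemma diag_unit_diag i : Defs.diagonal (diag_unit_mx i).
Proof.
apply/is_diag_mxP => a b ab; rewrite mxE; have [ai|//] := eqVneq a i.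
by have [bi|//] := eqVneq b i; rewrite ai bi eqxx in ab.
Qed.

Lemma pairing_unit mu i : pairing mu (diag_unit_mx i) = (mu 0 i)%:~R.
Proof.
rewrite /pairing (bigD1 i) //= mxE !eqxx mulr1 big1 ?addr0 // => j ji.
by rewrite mxE (negPf ji) mulr0.
Qed.

Lemma pairing_inj mu nu : (forall h : borel K n, Defs.diagonal h -> pairing mu h = pairing nu h) -> mu = nu.
Proof.
move=> H; apply/rowP => i; apply: intr_inj0.
by rewrite -!pairing_unit; apply: H; exact: diag_unit_diag.
Qed.

Lemma wtspace_direct M (s : seq 'rV[int]_n) (v : 'rV[int]_n -> M) :
  uniq s -> (forall mu, mu \in s -> wtspace mu (v mu)) -> \sum_(mu <- s) v mu = 0 ->
  forall mu, mu \in s -> v mu = 0.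
Proof.
elim: s v => // nu s IH v /= /andP[nus us] Hv sum0.
have vs mu : mu \in s -> v mu = 0.
  move=> mus; apply/eqP/negPn/negP => vmu0.
  have mn : mu <> nu by move=> E; rewrite E (negPf nus) in mus.
  apply: mn; apply: pairing_inj => h hd; apply/eqP; rewrite -subr_eq0.
  (* Acting by h minus the scalar of nu removes the component of nu and rescales the others, which
     brings the sum down to s. *)
  have := IH (fun mu => (pairing mu h - pairing nu h) *: v mu) us.
  have wt' mu' : mu' \in s -> wtspace mu' ((pairing mu' h - pairing nu h) *: v mu').
    by move=> mus'; apply: wtspaceZ; apply: Hv; rewrite inE mus' orbT.
  move=> /(_ wt') H; have := H _ mu mus => {H} H.
  suff E : \sum_(mu <- s) (pairing mu h - pairing nu h) *: v mu = 0.
    by have /eqP := H E; rewrite scaler_eq0 (negPf vmu0) orbF.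
  have E1 : \sum_(mu <- nu :: s) pairing mu h *: v mu = 0.
    rewrite big_seq (eq_bigr (fun mu => bact h (v mu))) => [|mu' mus']; last by rewrite Hv.
    by rewrite -big_seq -linear_sum sum0 linear0.
  have E2 : \sum_(mu <- nu :: s) pairing nu h *: v mu = 0.
    by rewrite -scaler_sumr sum0 scaler0.
  rewrite big_cons in E1; rewrite big_cons in E2.
  under eq_bigr => mu' _ do rewrite scalerBl.
  rewrite sumrB; apply/eqP; rewrite subr_eq0; apply/eqP.
  by apply: (addrI (pairing nu h *: v nu)); rewrite E1 E2.
move=> mu; rewrite inE => /orP[/eqP ->|]; last exact: vs.
by move: sum0; rewrite big_cons [X in _ + X]big_seq big1 ?addr0.
Qed.

Section Projections.
Variables (M : bmodule K n) (wm : weight_module M).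
Implicit Types (s t : seq 'rV[int]_n) (v : 'rV[int]_n -> M) (m : M).

Lemma big_supp s t v : uniq s -> uniq t -> {subset s <= t} -> (forall mu, mu \notin s -> v mu = 0) ->
  \sum_(mu <- s) v mu = \sum_(mu <- t) v mu.
Proof.
move=> us ut st v0; rewrite [RHS](bigID (mem s)) /= [X in _ + X]big1 // addr0 -[RHS]big_filter.
apply: perm_big; apply: uniq_perm; rewrite ?filter_uniq // => mu.
by rewrite mem_filter; apply/idP/andP => [mus|[]//]; split=> //; exact: st.
Qed.

Definition wt_dec m s v : Prop :=
  [/\ uniq s, forall mu, wtspace mu (v mu), forall mu, mu \notin s -> v mu = 0 & m = \sum_(mu <- s) v mu].

Lemma wt_dec_exists m : exists s v, wt_dec m s v.
Proof.
(* The given list may repeat a weight; repetitions are collected as multiplicities. *)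
have [s [v [Hv ->]]] := wt_sum wm m; exists (undup s), (fun mu => v mu *+ count_mem mu s); split.
- exact: undup_uniq.
- by move=> mu; rewrite -scaler_nat; exact: wtspaceZ.
- by move=> mu; rewrite mem_undup => mus; rewrite (count_memPn mus) mulr0n.
- by rewrite -(@big_undup_iterop_count _ _ _ _ s); apply: eq_bigr.
Qed.

Lemma wt_dec_uniq m s v s' v' : wt_dec m s v -> wt_dec m s' v' -> v =1 v'.
Proof.
move=> [us wv v0 mE] [us' wv' v0' mE'] mu; apply/eqP; rewrite -subr_eq0; apply/eqP.
pose t := undup (s ++ s').
have [mut|mut] := boolP (mu \in t); last first.
  move: mut; rewrite mem_undup mem_cat negb_or => /andP[ms ms'].
  by rewrite v0 // v0' // subrr.
apply: (@wtspace_direct M t (fun mu => v mu - v' mu)) ; [exact: undup_uniq| | |exact: mut].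
  by move=> nu _; rewrite -scaleN1r; apply: wtspaceD => //; exact: wtspaceZ.
have sub1 : {subset s <= t} by move=> nu ns; rewrite mem_undup mem_cat ns.
have sub2 : {subset s' <= t} by move=> nu ns; rewrite mem_undup mem_cat ns orbT.
by rewrite sumrB -(big_supp us (undup_uniq _) sub1 v0) -(big_supp us' (undup_uniq _) sub2 v0') -mE -mE' subrr.
Qed.

Definition wtpr mu m : M := sval (cid (svalP (cid (wt_dec_exists m)))) mu.

Lemma wtprP m : exists s, wt_dec m s (wtpr ^~ m).
Proof.
exists (sval (cid (wt_dec_exists m))); rewrite /wtpr.
by case: (cid (svalP (cid (wt_dec_exists m)))).
Qed.

Lemma wtprE m s v mu : wt_dec m s v -> wtpr mu m = v mu.
Proof. by move=> H; have [s' H'] := wtprP m; exact: (wt_dec_uniq H' H). Qed.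

Lemma wtpr_wt mu m : wtspace mu (wtpr mu m).
Proof. by have [s [_ H _ _]] := wtprP m; exact: H. Qed.

Lemma wtpr_linear mu : linear (wtpr mu).
Proof.
move=> a m m'; have [s [us ws s0 mE]] := wtprP m; have [s' [us' ws' s0' mE']] := wtprP m'.
pose t := undup (s ++ s').
apply: (@wtprE _ t (fun mu => a *: wtpr mu m + wtpr mu m')); split=> [|nu|nu|].
- exact: undup_uniq.
- by apply: wtspaceD => //; exact: wtspaceZ.
- by rewrite mem_undup mem_cat negb_or => /andP[ns ns']; rewrite s0 // s0' // scaler0 addr0.
have sub1 : {subset s <= t} by move=> nu ns; rewrite mem_undup mem_cat ns.
have sub2 : {subset s' <= t} by move=> nu ns; rewrite mem_undup mem_cat ns orbT.
rewrite big_split -scaler_sumr /= -(big_supp us (undup_uniq _) sub1 s0).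
by rewrite -(big_supp us' (undup_uniq _) sub2 s0') -mE -mE'.
Qed.

Lemma wtpr_id mu m : wtspace mu m -> wtpr mu m = m.
Proof.
move=> Hm; rewrite (@wtprE _ [:: mu] (fun nu => if nu == mu then m else 0)) ?eqxx //; split=> // [nu|nu|].
- by case: eqP => [->//|_]; exact: wtspace0.
- by rewrite inE => /negPf ->.
- by rewrite big_seq1 eqxx.
Qed.

End Projections.

Lemma wtpr_hom M N (wM : weight_module M) (wN : weight_module N) (f : M -> N) mu m :
  is_bhom f -> wtpr wN mu (f m) = f (wtpr wM mu m).
Proof.
move=> [flin fe]; have [s [us ws s0 mE]] := wtprP wM m.
pose F := GRing.isLinear.Build K M N _ f flin; pose g : {linear M -> N} := HB.pack f F.
apply: (@wtprE _ _ _ s (fun mu => f (wtpr wM mu m))); split=> // [nu h hd|nu ns|].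
- by rewrite -fe ws // -[f]/(g : M -> N) linearZ.
- by rewrite s0 // -[f]/(g : M -> N) linear0.
- by rewrite {1}mE -[f]/(g : M -> N) linear_sum.
Qed.

End Weights.

Section MinimalRelations.
Variables (K : fieldType) (charK0 : [pchar K] =i pred0) (M : nrep K).

(* By induction on j - i: for the k strictly between i and j with w k least in (w i, w j), the
   nilpotency orders of e_{ik} and e_{kj} bound that of their commutator e_{ij}. *)
Lemma kprel_min N (w : fperm) (x : M) :
  (forall i j, (i < j)%N -> (forall k, i < k -> k < j -> ~ (w i < w k < w j))%N ->
    iter (mm N w i j).+1 (e i j) x = 0) -> kprel N w x.
Proof.
move=> H i j; have [d] := ubnP (j - i); elim: d i j => // d IH i j jid ij.
have [ex|nex] := pselect (exists c, [&& i < pvalV w c, pvalV w c < j & w i < c < w j]%N); last first.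
  by apply: H => // k ik kj wk; apply: nex; exists (w k); rewrite pvalK ik kj wk.
pose c := ex_minn ex; pose k := pvalV w c.
have [ik kj wk kmin] : [/\ (i < k)%N, (k < j)%N, (w i < w k < w j)%N &
    forall l, (i < l)%N -> (l < j)%N -> (w i < w l < w j)%N -> (w k <= w l)%N].
  rewrite /k /c; case: ex_minnP => a /and3P[h1 h2 h3] amin; rewrite pvalVK; split=> // l il lj wl.
  by apply: amin; rewrite pvalK il lj wl.
have xik := IH i k ltac:(lia) ik; have xkj := IH k j ltac:(lia) kj.
apply: (e_heis0 charK0 ik kj xik xkj); rewrite addSn addnS !ltnS.
apply: count_geD => a.
- move=> /and3P[h1 h2 h3]; have ja : (j < pvalV w a)%N; last by lia.
  rewrite ltnNge; apply/negP; rewrite leq_eqVlt => /orP[/eqP aj|aj].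
    by have := pvalVK w a; rewrite aj; lia.
  have := kmin (pvalV w a); rewrite pvalVK; lia.
- move=> /and3P[h1 h2 h3]; lia.
- move=> /and3P[h1 h2 h3]; lia.
Qed.

End MinimalRelations.

(** * Presentation of KP modules and homomorphisms out of them *)

Section KPStructure.
Variables (K : fieldType) (charK0 : [pchar K] =i pred0) (n : nat).

(** What the later arguments use of S_lambda: a weight generator with the same annihilator in U(n)
    as the diagram vector in Fock space. The weight lam is kept apart from the code of w to allow
    for the shift by k. *)
Record kp_like (S : bmodule K n) (lam : 'rV[int]_n) (w : fperm) (N : nat) (u : S) : Prop := KPLike {
  kp_wt : wtspace lam u;
  kp_gen : forall z : S, exists p, z = ev p u;
  kp_ker : forall p, ev p u = 0 <-> ev p (uvec K n N w) = 0 }.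

Lemma pairing_E (mu : 'rV[int]_n) i j : pairing mu (E K n i j) = 0.
Proof.
rewrite /pairing big1 // => a _; rewrite mxE.
by have -> : (i < j)%N && ((a == i :> nat) && (a == j :> nat)) = false; [lia|rewrite mulr0].
Qed.

(** One inclusion of annihilators comes from the map [kphi] to Fock space, the other from
    [kprel_ev], as u_w satisfies the relations of w. *)
Lemma KPperm_kp_like w N : increasing_from n w -> (pbound w <= N)%N ->
  exists u, @kp_like (KPperm K n w) (codewt n w) w N u.
Proof.
move=> incw wN; pose v := KPvec K n w (iota 0 (pbound w)).
have vU : v \in Ugenp v by apply/asboolP; exact: Ugen_base.
pose u : KPperm K n w := CyclicCar vU.
have cval_ev p : cval (ev p u) = ev p v.
  rewrite /ev; elim: p => [|q p IH]; first by rewrite !big_nil.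
  rewrite !big_cons -IH; congr (_ *: _ + _).
  by elim: q.2 => //= ij s <-.
have vwt : wtspace (codewt n w) v by exact: KPvec_wt.
exists u; split=> [h hd|[z zU]|p].
- by apply: val_inj; exact: vwt.
- have /asboolP zU' := zU; have [p zE] := Ugen_ev vwt zU'.
  by exists p; apply: val_inj; rewrite /= cval_ev.
have -> : ev p u = 0 <-> ev p v = 0.
  by split=> [H|H]; [rewrite -cval_ev H|apply: val_inj; rewrite /= cval_ev].
split=> H; last exact: (kprel_ev charK0 incw wN (KPvec_rel K incw wN) H).
have [b b0 phi_v] := kphi_KPvec charK0 n wN.
have phi_lin := @kphi_linear K charK0 n N w (iota 0 (pbound w)).
have E : kphi N (ev p v) = ev p (kphi N v).
  by apply: ev_hom => // i j z; exact: kphi_act.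
move: E; rewrite H (linear_at0 phi_lin) phi_v linearZ /= => /esym/eqP.
by rewrite scaler_eq0 (negPf b0) => /eqP.
Qed.

Lemma ev_tpure1 (M : bmodule K n) mu p (m : M) :
  ev p (tpure (1 : charb K mu) m : tens (charb K mu) M) = tpure (1 : charb K mu) (ev p m).
Proof.
pose f : M -> tens (charb K mu) M := tpure (1 : charb K mu).
apply/esym; apply: (@ev_hom _ _ _ f) => [|i j v]; first exact: linearP.
rewrite [RHS]tact_pure [bact _ (1 : charb K mu)](_ : _ = 0) => [|/=]; last by rewrite pairing_E scale0r.
by rewrite (linear_at0 (tpure_linearl _)) add0r.
Qed.

Lemma tpure1_inj (M : bmodule K n) mu (m : M) : tpure (1 : charb K mu) m = 0 -> m = 0.
Proof.
pose f (a : charb K mu) (m : M) : M := (a : K) *: m.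
have fl v : linear (f^~ v) by move=> a b c; rewrite /f scalerDl scalerA.
have fr a : linear (f a) by move=> b c d; rewrite /f scalerDr !scalerA mulrC.
move=> H; have := tlift_pure fl fr 1 m; rewrite H /f scale1r => <-.
exact: linear_at0 (tlift_linear fl fr).
Qed.

Lemma tpure1_surj (M : bmodule K n) mu (t : tens (charb K mu) M) : exists m, t = tpure (1 : charb K mu) m.
Proof.
elim/tens_ind: t => [|_ _ [m ->] [m' ->]|a m].
- by exists 0; rewrite linear0.
- by exists (m + m'); rewrite linearD.
exists ((a : K) *: m); rewrite linearZ /=.
have := tpure_linearl m (a : K) (1 : charb K mu) 0.
rewrite (linear_at0 (tpure_linearl m)) !addr0 => <-.
by rewrite [_ *: _](mulr1 (a : K)).
Qed.

Lemma codewt_perm (lam : 'rV[int]_n) : nonneg lam -> codewt n (perm_of_wt lam) = lam.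
Proof. by move=> nn; apply/rowP => i; rewrite mxE wt_code. Qed.

Lemma KP_kp_like k lam N : nonneg (lam + const_mx k) ->
  let w := perm_of_wt (lam + const_mx k) in (pbound w <= N)%N ->
  exists u, @kp_like (KP K k lam) lam w N u.
Proof.
move=> nn w wN; have [u [uwt ugen uker]] := KPperm_kp_like (wt_inc _) wN.
exists (tpure (1 : charb K (const_mx (- k))) u); split=> [|t|p].
- have E : const_mx (- k) + codewt n w = lam.
    by rewrite codewt_perm //; apply/rowP => i; rewrite !mxE; ring.
  have W : wtspace (const_mx (- k) + codewt n w) (tpure (1 : charb K (const_mx (- k))) u : tens _ _).
    by apply: wt_tpure => // h hd; rewrite /= /GRing.scale /= mulr1.
  by rewrite E in W.
- have [m ->] := tpure1_surj t; have [p ->] := ugen m.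
  by exists p; rewrite ev_tpure1.
rewrite ev_tpure1 -uker; split=> [|->]; [exact: tpure1_inj|exact: linear0].
Qed.

Section Cyclic.
Variables (S : bmodule K n) (lam : 'rV[int]_n) (w : fperm) (N : nat) (u : S) (Su : kp_like lam w N u).

Definition kpoly (z : S) : ncpoly K := sval (cid (kp_gen Su z)).
Lemma kpolyP z : z = ev (kpoly z) u. Proof. exact: svalP (cid (kp_gen Su z)). Qed.

Section Hom.
Variables (M : nrep K) (x : M) (xrel : forall p, ev p (uvec K n N w) = 0 -> ev p x = 0).

(** Computed from a chosen polynomial for z; the inclusion of annihilators makes the result
    independent of the choice ([ev_eq]). *)
Definition khom (z : S) : M := ev (kpoly z) x.

Lemma ev_eq p q : ev p u = ev q u -> ev p x = ev q x.
Proof.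
move=> E; have : ev (p ++ pscale (-1) q) u = 0 by rewrite ev_cat ev_scale E scaleN1r subrr.
move/(kp_ker Su)/xrel; rewrite ev_cat ev_scale scaleN1r => /eqP; rewrite subr_eq0.
by move/eqP.
Qed.

Lemma khom_ev p : khom (ev p u) = ev p x.
Proof. by apply: ev_eq; rewrite -kpolyP. Qed.

Lemma khom_linear : linear khom.
Proof.
move=> a z z'; rewrite {1}[z]kpolyP {1}[z']kpolyP -ev_scale -ev_cat khom_ev.
by rewrite ev_cat ev_scale.
Qed.

End Hom.

Lemma khom_bhom (M : bmodule K n) (x : M) (xrel : forall p, ev p (uvec K n N w) = 0 -> ev p x = 0) :
  wtspace lam x -> is_bhom (khom x).
Proof.
move=> wx; split; first exact: (khom_linear xrel).
by move=> b z; rewrite {1}[z]kpolyP -(ev_pact _ _ (kp_wt Su)) (khom_ev xrel) (ev_pact _ _ wx).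
Qed.

Definition kfock : S -> fockb K n N := khom (uvec K n N w).

Lemma kfock_linear : linear kfock. Proof. exact: khom_linear. Qed.
HB.instance Definition _ := GRing.isLinear.Build K S (fockb K n N) _ kfock kfock_linear.

Lemma kfock_ev p : kfock (ev p u) = ev p (uvec K n N w).
Proof. exact: khom_ev. Qed.

Lemma kfock_eq0 z : kfock z = 0 -> z = 0.
Proof. by move=> kz; rewrite [z]kpolyP; apply/(kp_ker Su); rewrite -kfock_ev -kpolyP. Qed.

End Cyclic.
End KPStructure.

(** * Weights of KP modules *)

Section Support.
Variables (K : fieldType) (charK0 : [pchar K] =i pred0) (n N : nat) (w : fperm).
Local Notation X := ('I_n * 'I_N)%type.
Local Notation FK := (fockb K n N).

Definition rowcard (D : {set X}) (a : 'I_n) : nat := #|[set c | (a, c) \in D]|.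
Definition colcard (D : {set X}) (c : 'I_N) : nat := #|[set a | (a, c) \in D]|.

(* Satisfied by the sets of boxes obtained from the diagram of w by moving boxes up inside their
   columns. *)
Definition raised (D : {set X}) : Prop := forall c,
  (forall a, (a, c) \in D -> (a < pvalV w c)%N) /\ colcard D c = colcard (diagram n N w) c.

Definition supp_raised (f : FK) : Prop := forall D, (f : fock K X) D <> 0 -> raised D.

(** A hop from row b to row a < b moves a box up inside its column, so the column sizes and the
    bound on the rows persist. *)
Lemma supp_rowop (a b : 'I_n) f : (a < b)%N -> supp_raised f -> supp_raised (rowop a b f).
Proof.
move=> ab Hf D; rewrite /rowop sum_ffunE => D0.
have [c] : exists c, hop (a, c) (b, c) f D <> 0.
  apply: contrapT => nex; apply: D0; rewrite big1 // => c _.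
  by apply: contrapT => c0; apply: nex; exists c.
rewrite !ffunE; case: ifP => // aD; case: ifP => [|bD]; first by rewrite mulr0.
move=> fD; have {fD} fD : f ((b, c) |: (D :\ (a, c))) <> 0 by move=> f0; apply: fD; rewrite f0 !mulr0.
have Hr := Hf _ fD; move=> d; have [h1 h2] := Hr d.
have abn : a != b by rewrite -val_eqE /= ltn_eqF.
split=> [p pD|].
  have [pE|pE] := eqVneq (p, d) (a, c).
    case: pE pD h1 => -> -> _ h1; apply: ltn_trans ab _; apply: h1.
    by rewrite !inE eqxx.
  by apply: h1; rewrite !inE pE pD orbT.
rewrite -h2 /colcard; have [dc|dc] := eqVneq d c; last first.
  by apply: eq_card => p; rewrite !inE !xpair_eqE (negPf dc) !andbF.
rewrite dc (cardsD1 a) inE aD [in RHS](cardsD1 b) !inE eqxx /=; congr (_ + _)%N.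
apply: eq_card => p; rewrite !inE !xpair_eqE eqxx !andbT.
have [->|pa] := eqVneq p a; first by rewrite (negPf abn) !andbF.
have [->|pb] /= := eqVneq p b; last by [].
by move: bD; rewrite !inE xpair_eqE eq_sym (negPf abn) /= => ->.
Qed.

Lemma supp_e i j f : supp_raised f -> supp_raised (e i j f).
Proof.
move=> Hf; have [/andP[ij jn]|ij] := boolP ((i < j) && (j < n))%N; last first.
  by rewrite e_fock0 // => D; rewrite ffunE.
have i_n := ltn_trans ij jn.
by rewrite (@e_rowop _ _ _ (Ordinal i_n) (Ordinal jn)) //; exact: supp_rowop.
Qed.

Lemma supp_uvec : supp_raised (uvec K n N w).
Proof.
move=> D; rewrite ffunE; case: eqP => // -> _ c; split=> // a.
by rewrite inE => /andP[].
Qed.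

Lemma supp_ev p : supp_raised (ev p (uvec K n N w)).
Proof.
rewrite /ev; elim/big_rec: _ => [D|q f _ Hf D]; first by rewrite ffunE.
rewrite !ffunE => D0; have [f0|] := pselect ((f : fock K X) D = 0); last exact: Hf.
have Hq : supp_raised (evw q.2 (uvec K n N w)).
  by elim: q.2 => [|ij s IH]; [exact: supp_uvec|exact: supp_e].
by apply: Hq => g0; apply: D0; rewrite f0 addr0 g0 scaler0.
Qed.

(** The diagonal unit at a acts on [st D] by the length of row a, and characteristic zero turns the
    equality in K into one of integers. *)
Lemma fock_wt mu (f : FK) D a : wtspace mu f -> (f : fock K X) D <> 0 -> (rowcard D a)%:Z = mu 0 a.
Proof.
move=> Hf fD; apply: (intr_inj0 charK0); rewrite -(pairing_unit K mu).
have := congr1 (fun g : fock K X => g D) (Hf _ (diag_unit_diag K a)).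
rewrite /= fact_diag; last exact: diag_unit_diag.
rewrite ffunE (bigD1 a) //= mxE !eqxx mul1r big1 ?addr0 => [|b ba]; last first.
  by rewrite mxE (negPf ba) mul0r.
by move=> /(mulIf (introN eqP fD)).
Qed.

Hypothesis (wN : (pbound w <= N)%N) (nN : (n <= N)%N).

Lemma val_lt i : (i < n)%N -> (w i < N)%N.
Proof. by move=> i_n; apply: fperm_lt => //; lia. Qed.

Lemma rowcard_diagram a : rowcard (diagram n N w) a = code w a.
Proof.
rewrite code_values (count_iota_le _ (ltnW (val_lt (ltn_ord a)))).
by apply: card_count => c; rewrite !inE.
Qed.

Lemma uvec_wt : wtspace (codewt n w) (uvec K n N w).
Proof.
move=> h hd; apply/ffunP => D; rewrite fact_diag // !ffunE.
case: eqP => [->|_]; last by rewrite mulr0 scaler0.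
rewrite mulr1 [RHS]mulr1; apply: eq_bigr => a _.
by rewrite mxE mulrC; congr (_ * _); rewrite -[#|_|]/(rowcard _ a) rowcard_diagram.
Qed.

(** Membership with coordinates in nat, the form required by [weight_bound]. *)
Definition boxes (D : {set X}) (c i : nat) : bool := [exists x in D, (x.1 == i :> nat) && (x.2 == c :> nat)].

Lemma boxesE (D : {set X}) (a : 'I_n) (c : 'I_N) : boxes D c a = ((a, c) \in D).
Proof.
apply/exists_inP/idP => [[[b d] bD /andP[/eqP/val_inj <- /eqP/val_inj <-]]//|aD].
by exists (a, c); rewrite ?eqxx.
Qed.

Lemma boxes_lt D c i : boxes D c i -> (c < N)%N /\ (i < n)%N.
Proof. by case/exists_inP => [[b d] _ /andP[/eqP <- /eqP <-]]; rewrite !ltn_ord. Qed.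

Lemma boxes_row D (a : 'I_n) : count ((boxes D)^~ a) (iota 0 N) = rowcard D a.
Proof. by apply/esym; apply: card_count => c; rewrite inE boxesE. Qed.

Lemma boxes_col D (c : 'I_N) : count (boxes D c) (iota 0 n) = colcard D c.
Proof. by apply/esym; apply: card_count => a; rewrite inE boxesE. Qed.

Lemma raised_bpos D c i : raised D -> boxes D c i -> (i < bpos n w c)%N.
Proof.
move=> rD bx; have [cN i_n] := boxes_lt bx; rewrite lt_bpos //.
by have [H _] := rD (Ordinal cN); apply: (H (Ordinal i_n)); rewrite -boxesE.
Qed.

Lemma raised_col D c : raised D -> count (boxes D c) (iota 0 n) =
  count (fun i => (i < bpos n w c) && (c < w i))%N (iota 0 n).
Proof.
move=> rD; have [cN|Nc] := ltnP c N.
  have [_] := rD (Ordinal cN); rewrite -boxes_col => ->.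
  apply: card_count => a; rewrite !inE /= lt_bpos // andbC //.
have -> : count (boxes D c) (iota 0 n) = 0%N.
  by apply/eqP; rewrite -leqn0 leqNgt -has_count; apply/hasPn => i _; apply/negP => /boxes_lt []; lia.
apply/esym/eqP; rewrite -leqn0 leqNgt -has_count; apply/hasPn => i; rewrite mem_iota add0n => i_n.
by apply/negP => /andP[_]; have := val_lt i_n; lia.
Qed.

Lemma raised_lex D v : raised D -> (forall a : 'I_n, code v a = rowcard D a) ->
  lex_le (bpos n w) (bpos n v).
Proof.
move=> rD vD; apply: (@weight_bound n w v N (boxes D)) => [c i /boxes_lt []//|c i|c|i i_n].
- exact: raised_bpos.
- exact: raised_col.
- by rewrite -[i]/(val (Ordinal i_n)) boxes_row vD.
Qed.

Lemma sum_rowcard D : raised D -> (\sum_a rowcard D a = \sum_(a < n) code w a)%N.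
Proof.
have dc D' : (\sum_a rowcard D' a = \sum_c colcard D' c)%N.
  under eq_bigr => a _ do rewrite /rowcard -sum1_card big_mkcond.
  rewrite exchange_big; apply: eq_bigr => c _; rewrite /colcard -sum1_card [RHS]big_mkcond.
  by apply: eq_bigr => a _; rewrite !inE.
move=> rD; rewrite dc (eq_bigr (fun c => colcard (diagram n N w) c)) => [|c _]; last by case: (rD c).
by rewrite -dc; apply: eq_bigr => a _; rewrite rowcard_diagram.
Qed.

Lemma rev_iota M : perm_eq [seq (M.-1 - c)%N | c <- iota 0 M] (iota 0 M).
Proof.
apply: uniq_perm; rewrite ?iota_uniq //.
  rewrite map_inj_in_uniq ?iota_uniq // => c d; rewrite !mem_iota !add0n /=; lia.
move=> c; apply/mapP/idP => [[d]|]; rewrite !mem_iota !add0n /= => H.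
  by move=> ->; lia.
by exists (M.-1 - c)%N; rewrite ?mem_iota; lia.
Qed.

(** The other values below N are those at the positions 0, ..., i. *)
Lemma count_high i : (i < n)%N -> (count (fun c => i < bpos n w c) (iota 0 N) + i.+1 = N)%N.
Proof.
move=> i_n; rewrite -[X in _ = X](size_iota 0) -(count_predC (fun c => i < bpos n w c)%N); congr (_ + _)%N.
rewrite -{1}[i.+1](size_iota 0) -count_predT.
apply: (@count_uniq_eq _ _ w); rewrite ?iota_uniq //; first exact: pval_inj.
  move=> k; rewrite !mem_iota !add0n /= => ki _; have kn : (k < n)%N by lia.
  by rewrite val_lt // bpos_val // -leqNgt.
move=> c; rewrite mem_iota add0n => cN ci.
have {}ci : (pvalV w c < i.+1)%N by move: ci; rewrite /= lt_bpos // -leqNgt.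
by exists (pvalV w c); rewrite pvalVK mem_iota add0n ci.
Qed.

(* The complementary columns, read with the values reversed. *)
Lemma raised_compl_lex D (v u : fperm) : raised D ->
  (forall i, i < n -> code u i + code w i + i.+1 = N)%N ->
  (forall a : 'I_n, code v a + rowcard D a + a.+1 = N)%N -> lex_le (bpos n u) (bpos n v).
Proof.
move=> rD uE vE.
have uval := compl_val nN wN uE; have ubpos := compl_bpos nN wN uE.
(* Column c consists of the rows before the position of N - 1 - c in w that column N - 1 - c of D
   leaves free. *)
pose T c i := [&& c < N, i < bpos n w (N.-1 - c) & ~~ boxes D (N.-1 - c) i]%N.
apply: (@weight_bound n u v N T) => [c i /and3P[]//|c i /and3P[cN h _]|c|i i_n].
- by rewrite ubpos cN.
- have [cN|Nc] := ltnP c N; last first.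
    rewrite (eq_count (a2 := pred0)) => [|i]; last by rewrite /T ltnNge Nc.
    rewrite count_pred0; apply/esym/eqP; rewrite -leqn0 leqNgt -has_count; apply/hasPn => i.
    rewrite mem_iota add0n => i_n; apply/negP => /andP[_]; rewrite uval //; lia.
  have -> : count (T c) (iota 0 n) = (count (fun i => i < bpos n w (N.-1 - c)) (iota 0 n) -
      count (boxes D (N.-1 - c)) (iota 0 n))%N.
    rewrite -[X in (X - _)%N](_ : count (T c) (iota 0 n) + count (boxes D (N.-1 - c)) (iota 0 n) = _)%N ?addnK //.
    rewrite -count_predUI [X in (_ + X)%N](_ : _ = 0%N) ?addn0; last first.
      apply/eqP; rewrite -leqn0 leqNgt -has_count; apply/hasPn => i _ /=.
      by rewrite /T; case: boxes; rewrite ?andbF.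
    apply: eq_count => i /=; rewrite /T cN /=; have := @raised_bpos D (N.-1 - c) i rD.
    by case: boxes => [->|_]; rewrite ?orbT // orbF andbT.
  rewrite raised_col // -[X in (X - _)%N](_ : count (fun i => (i < bpos n u c) && (c < u i)) (iota 0 n) +
     count (fun i => (i < bpos n w (N.-1 - c)) && (N.-1 - c < w i)) (iota 0 n) = _)%N ?addnK //.
  rewrite -count_predUI [X in (_ + X)%N](_ : _ = 0%N) ?addn0; last first.
    apply/eqP; rewrite -leqn0 leqNgt -has_count; apply/hasPn => i; rewrite mem_iota add0n => i_n /=.
    by rewrite uval //; lia.
  apply: eq_in_count => i; rewrite mem_iota add0n => i_n /=; rewrite ubpos cN uval //.
  have [ib|] := ltnP i (bpos n w (N.-1 - c)); last by [].
  have : w i <> (N.-1 - c)%N by move=> wi; move: ib; rewrite -wi bpos_val // ltnn.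
  have := val_lt i_n; rewrite /=; lia.
- have E : (count (T^~ i) (iota 0 N) + count ((boxes D)^~ i) (iota 0 N) = count (fun c => i < bpos n w c) (iota 0 N))%N.
    rewrite -[count (T^~ i) _](permP (rev_iota N)) count_map -count_predUI.
    rewrite [X in (_ + X)%N](_ : _ = 0%N) ?addn0; last first.
      apply/eqP; rewrite -leqn0 leqNgt -has_count; apply/hasPn => c; rewrite mem_iota add0n => cN /=.
      rewrite /T (_ : N.-1 - (N.-1 - c) = c)%N; last by lia.
      by case: boxes; rewrite ?andbF.
    apply: eq_in_count => c; rewrite mem_iota add0n => cN /=.
    rewrite /T (_ : N.-1 - (N.-1 - c) = c)%N; last by lia.
    have -> : (N.-1 - c < N)%N by lia.
    have := @raised_bpos D c i rD.
    by case: boxes => [->|_]; rewrite ?orbT // orbF andbT.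
  have E2 := count_high i_n; have := vE (Ordinal i_n); rewrite -boxes_row /=; lia.
Qed.

End Support.

Lemma ev_pact_shift (K : fieldType) (n : nat) (M : nrep K) (mu d : 'rV[int]_n) (x : borel K n) p (m : M) :
  ev (pact (mu + d) x p) m = ev (pact mu x p) m + pairing d x *: ev p m.
Proof.
rewrite /pact /ev; elim: p => [|q p IH]; first by rewrite /= !big_nil scaler0 addr0.
rewrite /= !big_cons !big_cat /= IH scalerDr.
have -> : pairing (mu + d + wtw n q.2) x * q.1 *: evw q.2 m =
    pairing (mu + wtw n q.2) x * q.1 *: evw q.2 m + pairing d x *: (q.1 *: evw q.2 m).
  by rewrite addrAC (pairingDl (mu + _)) mulrDl scalerDl scalerA.
by rewrite [X in _ + X = _]addrA addrACA.
Qed.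

Section Weights.
Variables (K : fieldType) (charK0 : [pchar K] =i pred0) (n N : nat).
Variables (S : bmodule K n) (lam : 'rV[int]_n) (w : fperm) (u : S) (Su : kp_like lam w N u).
Hypotheses (wN : (pbound w <= N)%N) (nN : (n <= N)%N).
Local Notation X := ('I_n * 'I_N)%type.
Local Notation kf := (kfock Su).

(** The generator has weight lam and its image has weight [codewt n w], so the diagonal part acts
    with this constant difference, while the e_ij commute with the map. *)
Lemma kfock_act x z : kf (bact x z) = bact x (kf z) - pairing (codewt n w - lam) x *: kf z.
Proof.
rewrite {1 2 3}[z](kpolyP Su) -(ev_pact _ _ (kp_wt Su)) !kfock_ev.
have Huw : wtspace (codewt n w) (uvec K n N w) by exact: uvec_wt.
rewrite -(ev_pact _ _ Huw).
have -> : pact (codewt n w) x (kpoly Su z) = pact (lam + (codewt n w - lam)) x (kpoly Su z).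
  by congr pact; rewrite addrC subrK.
by rewrite ev_pact_shift addrK.
Qed.

Lemma kp_support nu (z : S) : wtspace nu z -> z != 0 ->
  exists2 D : {set X}, raised w D & forall a : 'I_n, (rowcard D a)%:Z = nu 0 a + (code w a)%:Z - lam 0 a.
Proof.
move=> Hz z0; have kz0 : kf z != 0 by apply: contraNneq z0 => /kfock_eq0 ->.
have Hk : wtspace (nu + (codewt n w - lam)) (kf z).
  move=> h hd; have := kfock_act h z; rewrite Hz // linearZ /= => /eqP.
  by rewrite eq_sym subr_eq => /eqP E0; rewrite pairingDl scalerDl; exact: E0.
have [D kD] : exists D, (kf z : fock K X) D <> 0.
  apply: contrapT => nex; move/eqP: kz0; apply; apply/ffunP => D; rewrite ffunE.
  by apply: contrapT => kD; apply: nex; exists D.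
exists D => [|a].
  have := @supp_ev K n N w (kpoly Su z); rewrite -(kfock_ev Su) -kpolyP; exact.
by rewrite (fock_wt charK0 a Hk kD) !mxE addrA.
Qed.

Lemma kp_weights : exists s : seq 'rV[int]_n, forall nu, is_weight S nu -> nu \in s.
Proof.
exists (codom (fun D : {set X} => (\row_a (rowcard D a)%:Z) - codewt n w + lam)) => nu [z Hz z0].
have [D _ HD] := kp_support Hz z0; apply/codomP; exists D; apply/rowP => a.
by rewrite !mxE HD; ring.
Qed.

(** S embeds in Fock space, which has finite dimension. *)
Lemma kp_sub_findim (P : S -> Prop) : P 0 -> (forall a x y, P x -> P y -> P (a *: x + y)) ->
  exists s : seq S, forall z, P z <-> lspan (fun v => v \in s) z.
Proof.
pose f z : 'rV[K]_#|{set X}| := \row_i (kf z : fock K X) (enum_val i).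
have flin : linear f by move=> a x y; apply/rowP => i; rewrite !mxE linearP !ffunE.
pose F := GRing.isLinear.Build K S _ _ f flin; pose g : {linear S -> 'rV[K]_#|{set X}|} := HB.pack f F.
apply: (@findim_sub _ _ _ g) => x y fxy; apply/eqP; rewrite -subr_eq0; apply/eqP.
apply: (@kfock_eq0 _ _ _ _ _ _ _ Su); apply/ffunP => D; rewrite linearB !ffunE.
have := congr1 (fun r : 'rV[K]_#|{set X}| => r 0 (enum_rank D)) fxy.
by rewrite /= !mxE enum_rankK => ->; rewrite subrr.
Qed.

Lemma kp_weight_module : weight_module S.
Proof.
split=> [z|s v us Hv|mu].
(* The monomials of p are grouped by weight. *)
- pose p := kpoly Su z; pose s := undup [seq lam + wtw n q.2 | q <- p].
  exists s, (fun mu => ev [seq q <- p | lam + wtw n q.2 == mu] u); split=> [mu|].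
    rewrite /ev big_seq; elim/big_rec: _ => [|q y]; first exact: wtspace0.
    rewrite mem_filter => /andP[/eqP <- _] Hy; apply: wtspaceD => //; apply: wtspaceZ.
    by apply: evw_wt; exact: kp_wt Su.
  rewrite {1}[z](kpolyP Su) -/p /ev.
  under [RHS]eq_bigr => mu _ do rewrite big_filter big_mkcond.
  rewrite exchange_big /= [LHS]big_seq [RHS]big_seq; apply: eq_bigr => q qp.
  rewrite (bigD1_seq (lam + wtw n q.2)) ?undup_uniq //=; last by rewrite mem_undup; apply/mapP; exists q.
  by rewrite eqxx big1 ?addr0 // => mu /negPf; rewrite eq_sym => ->.
- by move=> H mu; apply: (wtspace_direct charK0 us _ H) => nu _; exact: Hv.
- apply: kp_sub_findim => [|a x y Hx Hy]; first exact: wtspace0.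
  by apply: wtspaceD => //; exact: wtspaceZ.
Qed.

End Weights.

Lemma rowcard_le n N w (D : {set 'I_n * 'I_N}) (a : 'I_n) :
  (pbound w <= N)%N -> (n <= N)%N -> raised w D -> (rowcard D a + a.+1 <= N)%N.
Proof.
move=> wN nN rD; rewrite -boxes_row -[X in (_ <= X)%N](count_high wN nN (ltn_ord a)) leq_add2r.
by apply: sub_count => c; exact: raised_bpos.
Qed.

Lemma raised_diagram n N w : raised w (diagram n N w).
Proof. by move=> c; split=> // a; rewrite inE => /andP[]. Qed.

Lemma sum_Posz n (f : 'I_n -> nat) : (\sum_a f a)%N%:Z = \sum_a (f a)%:Z :> int.
Proof. exact: (big_morph Posz PoszD (erefl _)). Qed.

Section KPWeights.
Variables (K : fieldType) (charK0 : [pchar K] =i pred0) (n : nat).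
Implicit Types lam nu : 'rV[int]_n.

Lemma KP_support (k : int) lam nu : nonneg (lam + const_mx k) -> is_weight (KP K k lam) nu ->
  let w := perm_of_wt (lam + const_mx k) in let N := maxn (pbound w) n in
  exists2 D : {set 'I_n * 'I_N}, raised w D & forall a, (rowcard D a)%:Z = nu 0 a + k.
Proof.
move=> nn [z zw z0] w N.
have [u Su] := KP_kp_like charK0 nn (leq_maxl (pbound w) n).
have [D rD HD] := kp_support charK0 Su (leq_maxl _ _) (leq_maxr _ _) zw z0.
by exists D => // a; rewrite HD (wt_code a nn) !mxE; ring.
Qed.

Lemma KP_weight_module (k : int) lam : nonneg (lam + const_mx k) -> weight_module (KP K k lam).
Proof.
move=> nn; have [u Su] := KP_kp_like charK0 nn (leq_maxl (pbound (perm_of_wt (lam + const_mx k))) n).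
exact (kp_weight_module charK0 Su).
Qed.

Lemma KP_wt_le (k : int) lam nu : nonneg (lam + const_mx k) -> is_weight (KP K k lam) nu -> wt_le nu lam.
Proof.
move=> nn nuw; have [D rD HD] := KP_support nn nuw.
have nn' : nonneg (nu + const_mx k) by move=> a; rewrite !mxE -HD.
apply: (wt_leI nn nn').
  have /(congr1 Posz) := sum_rowcard (leq_maxl _ _) (leq_maxr _ _) rD; rewrite !sum_Posz.
  under eq_bigr => a _ do rewrite HD; under [X in _ = X -> _]eq_bigr => a _ do rewrite (wt_code a nn) !mxE.
  by rewrite !big_split => /addIr ->.
apply: (raised_lex (leq_maxl _ _) (leq_maxr _ _) rD) => a.
apply/eqP; rewrite -eqz_nat HD (wt_code a nn') !mxE; exact/eqP.
Qed.

(** Up to a shift, rho - nu lists the row lengths left over by a raised set inside rows of length N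
    - (i + 1), and [raised_compl_lex] compares these with the ones left over by the diagram. *)
Lemma KP_dual_wt_le (k : int) lam nu : nonneg (rho n - lam + const_mx k) ->
  is_weight (KP K k (rho n - lam)) nu -> wt_le (rho n - nu) lam.
Proof.
move=> nn nuw; have [D rD HD] := KP_support nn nuw.
set w := perm_of_wt _ in D rD HD; set N := maxn _ _ in D rD HD.
have [wN nN] : (pbound w <= N)%N /\ (n <= N)%N by rewrite leq_maxl leq_maxr.
(* Chosen so that the entries of lam + k2 and rho - lam + k at i add up to N - (i + 1), as
   [raised_compl_lex] requires. *)
pose k2 : int := N%:Z - n%:Z - k.
have rho_k2 (a : 'I_n) : (n.-1 - a)%N%:Z + k2 + k + a.+1%:Z = N%:Z :> int.
  by rewrite /k2; have := ltn_ord a; lia.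
have wE a : (code w (a : 'I_n))%:Z = (n.-1 - a)%N%:Z - lam 0 a + k.
  by rewrite (wt_code a nn) !mxE.
have nn1 : nonneg (lam + const_mx k2).
  move=> a; have := wE a; have := rho_k2 a; have := rowcard_le a wN nN (@raised_diagram n N w).
  rewrite rowcard_diagram // !mxE; move: (lam 0%R a) (code w a) k2 rho_k2 => l c k2 _; lia.
have nn2 : nonneg (rho n - nu + const_mx k2).
  by move=> a; have := HD a; have := rho_k2 a; have := rowcard_le a wN nN rD; rewrite !mxE; move: (nu 0 a) => x; lia.
apply: (wt_leI nn1 nn2).
  have /(congr1 Posz) := sum_rowcard wN nN rD; rewrite !sum_Posz.
  under eq_bigr => a _ do rewrite HD; under [X in _ = X -> _]eq_bigr => a _ do rewrite (wt_code a nn) !mxE.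
  rewrite !big_split /= sumrN => /addIr E.
  under [RHS]eq_bigr => a _ do rewrite !mxE.
  by rewrite big_split sumrN E /= opprB addrC subrK.
apply: (raised_compl_lex wN nN rD) => [i i_n|a].
  have := wE (Ordinal i_n); have := rho_k2 (Ordinal i_n); have := wt_code (Ordinal i_n) nn1.
  by rewrite !mxE /=; move: (lam 0 _) => x; lia.
by have := HD a; have := rho_k2 a; have := wt_code a nn2; rewrite !mxE /=; move: (nu 0 a) => x; lia.
Qed.

End KPWeights.

(** * Twists and duals *)

Section Twist.
Variables (K : fieldType) (n : nat) (M : bmodule K n) (mu : 'rV[int]_n).
Local Notation T := (tens M (charb K mu)).

Definition twist (m : M) : T := tpure m (1 : charb K mu).

Lemma twist_linear : linear twist. Proof. exact: tpure_linearl. Qed.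
HB.instance Definition _ := GRing.isLinear.Build K M T _ twist twist_linear.

Definition untwist : T -> M := tlift (fun (m : M) (a : charb K mu) => (a : K) *: m).

Let scale_linearl (a : charb K mu) : linear (fun m : M => (a : K) *: m).
Proof. by move=> b m m'; rewrite scalerDr !scalerA mulrC. Qed.

Let scale_linearr (m : M) : linear (fun a : charb K mu => (a : K) *: m).
Proof. by move=> b a a'; rewrite scalerDl scalerA. Qed.

Lemma untwist_linear : linear untwist. Proof. exact: tlift_linear. Qed.
HB.instance Definition _ := GRing.isLinear.Build K T M _ untwist untwist_linear.

Lemma twistK : cancel twist untwist.
Proof. by move=> m; rewrite /untwist tlift_pure // scale1r. Qed.

Lemma untwistK : cancel untwist twist.
Proof.
elim/tens_ind=> [|t t' IH IH'|m a]; first by rewrite !linear0.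
  by rewrite !linearD /= IH IH'.
rewrite /untwist tlift_pure // /twist.
have := tpure_linearl (1 : charb K mu) (a : K) m 0.
rewrite (linear_at0 (tpure_linearl _)) !addr0 => ->; rewrite -linearZ; congr tpure.
by rewrite [LHS]mulr1.
Qed.

Lemma twist_act x m : bact x (twist m) = twist (bact x m + pairing mu x *: m).
Proof.
rewrite [LHS]tact_pure linearD; congr (_ + _).
have E : tpure m (pairing mu x *: (1 : charb K mu)) = pairing mu x *: twist m by rewrite linearZ.
rewrite [RHS]linearZ; exact: E.
Qed.

Lemma twist_wt nu m : wtspace (nu + mu) (twist m) <-> wtspace nu m.
Proof.
split=> Hm h hd; last by rewrite twist_act Hm // pairingDl -scalerDl linearZ.
have := Hm h hd; rewrite twist_act -linearZ => /(can_inj twistK).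
by rewrite pairingDl scalerDl => /addIr.
Qed.

Lemma is_weight_twist nu : is_weight T nu -> is_weight M (nu - mu).
Proof.
move=> [t Ht t0]; exists (untwist t); last by apply: contraNneq t0 => E; rewrite -[t]untwistK E linear0.
by apply/twist_wt; rewrite subrK untwistK.
Qed.

Lemma twist_weight_module : weight_module M -> weight_module T.
Proof.
move=> [wsum wdir wfin]; split=> [t|s v us Hv sum0 nu nus|nu].
- have [s [v [Hv tE]]] := wsum (untwist t).
  exists [seq nu + mu | nu <- s], (fun nu => twist (v (nu - mu))); split=> [nu|].
    by rewrite -[nu](subrK mu) addrK; apply/twist_wt.
  rewrite -[LHS]untwistK tE linear_sum big_map; apply: eq_bigr => nu _.
  by rewrite addrK.
- rewrite -[v nu]untwistK; suff -> : untwist (v nu) = 0 by rewrite linear0.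
  have := wdir [seq nu - mu | nu <- s] (fun nu => untwist (v (nu + mu))) _ _ _ (nu - mu).
  rewrite subrK; apply.
  + by rewrite map_inj_uniq //; exact: addIr.
  + by move=> nu'; apply/twist_wt; rewrite untwistK.
  + rewrite big_map; under eq_bigr => nu' _ do rewrite subrK.
    by rewrite -linear_sum sum0 linear0.
  + exact: map_f.
have [s Hs] := wfin (nu - mu); exists (map twist s) => t.
rewrite -[t]untwistK -[nu](subrK mu) twist_wt Hs; split.
  elim=> [|m ms|m m' _ IH _ IH'|a m _ IH].
  - by rewrite linear0; exact: lspan0.
  - exact/lspan_gen/map_f.
  - by rewrite linearD; exact: lspanD.
  - by rewrite linearZ; exact: lspanZ.
rewrite untwistK; elim=> [|_ /mapP[m ms ->]|m m' _ IH _ IH'|a m _ IH].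
- by rewrite linear0; exact: lspan0.
- by rewrite twistK; exact: lspan_gen.
- by rewrite linearD; exact: lspanD.
- by rewrite linearZ; exact: lspanZ.
Qed.

End Twist.

Section DualWeights.
Variables (K : fieldType) (charK0 : [pchar K] =i pred0) (n : nat) (M : bmodule K n) (wM : weight_module M).
Local Notation pr := (wtpr wM).

Lemma dval_linear (phi : dualb M) : linear (dval phi).
Proof. by case: phi => f /= /asboolP. Qed.
HB.instance Definition _ (phi : dualb M) := GRing.isLinear.Build K M K^o _ (dval phi) (dval_linear phi).

Definition mkdual (f : M -> K^o) (lf : linear f) : dualb M := DualCar (introT (asboolP _) lf).

Lemma dual_ext (phi psi : dualb M) : (forall m, dval phi m = dval psi m) -> phi = psi.
Proof. by move=> E; apply: val_inj; apply/funext. Qed.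

Lemma wtpr_diag mu h m : Defs.diagonal h -> pr mu (bact h m) = pairing mu h *: pr mu m.
Proof.
move=> hd; have [s [us ws s0 mE]] := wtprP wM m.
apply: (@wtprE _ charK0 _ _ wM _ s (fun mu => pairing mu h *: pr mu m)); split=> // [nu|nu ns|].
- exact: wtspaceZ.
- by rewrite s0 // scaler0.
- by rewrite {1}mE linear_sum; apply: eq_bigr => nu _; exact: ws.
Qed.

Lemma wtpr_sum (s : seq 'rV[int]_n) m : uniq s -> (forall nu, is_weight M nu -> nu \in s) ->
  m = \sum_(mu <- s) pr mu m.
Proof.
move=> us wts; have [t [ut wt t0 mE]] := wtprP wM m; rewrite {1}mE.
have s0 mu : mu \notin s -> pr mu m = 0.
  move=> mus; apply/eqP/negPn/negP => m0; move/negP: mus; apply; apply: wts.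
  by exists (pr mu m).
rewrite (@big_supp _ _ _ t (undup (t ++ s))) ?undup_uniq //; last first.
  by move=> nu nt; rewrite mem_undup mem_cat nt.
apply/esym/big_supp; rewrite ?undup_uniq // => nu ns.
by rewrite mem_undup mem_cat ns orbT.
Qed.

Lemma dual_wt_other mu nu (phi : dualb M) m : wtspace mu phi -> wtspace nu m -> nu != - mu -> dval phi m = 0.
Proof.
move=> Hphi Hm; apply: contraNeq => p0; apply/eqP; apply: (pairing_inj charK0) => h hd.
have := congr1 (fun f : dualb M => dval f m) (Hphi h hd).
rewrite /= Hm // linearZ /= pairingNl => /eqP; rewrite -mulNr => /eqP /(mulIf p0) <-.
by rewrite opprK.
Qed.

Lemma is_weight_dual nu : is_weight (dualb M) nu -> is_weight M (- nu).
Proof.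
move=> [phi Hphi p0]; apply: contrapT => nw; move/eqP: p0; apply; apply: dual_ext => m.
have [s [us ws s0 mE]] := wtprP wM m; rewrite mE linear_sum big1 //= => mu _.
have [muE|mun] := eqVneq mu (- nu); last exact: dual_wt_other (ws mu) mun.
have [->|m0] := eqVneq (pr mu m) 0; first exact: linear0.
by case: nw; exists (pr mu m); rewrite // -muE.
Qed.

(** As there are finitely many weights, a form is the finite sum of its compositions with the weight
    projections; the one through M_mu has weight - mu. The values on a finite spanning list embed
    the dual in a space of row vectors. *)
Lemma dual_weight_module (sp : seq M) (s : seq 'rV[int]_n) : (forall m, lspan (fun v => v \in sp) m) ->
  (forall nu, is_weight M nu -> nu \in s) -> weight_module (dualb M).
Proof.
move=> Hsp wts; split=> [phi|t v ut Hv|mu].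
- have lv nu : linear (fun m => dval phi (pr (- nu) m) : K^o) by move=> a m m'; rewrite (wtpr_linear charK0) linearP.
  exists [seq - nu | nu <- undup s], (fun nu => mkdual (lv nu)); split=> [nu h hd|].
    apply: dual_ext => m; rewrite /= fctE wtpr_diag // linearZ /= pairingNl.
    by rewrite scaleNr opprK.
  apply: dual_ext => m; rewrite [in LHS](@wtpr_sum (undup s) m) ?undup_uniq //; last first.
    by move=> nu /wts; rewrite mem_undup.
  rewrite linear_sum big_map; elim: (undup s) => [|nu r IH]; first by rewrite !big_nil.
  by rewrite !big_cons /= IH opprK.
- by move=> H mu; apply: (wtspace_direct charK0 ut _ H) => nu _; exact: Hv.
pose f (phi : dualb M) : 'rV[K]_(size sp) := \row_i dval phi sp`_i.
have flin : linear f by move=> a x y; apply/rowP => i; rewrite !mxE.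
pose F := GRing.isLinear.Build K (dualb M) _ _ f flin; pose g : {linear dualb M -> 'rV[K]_(size sp)} := HB.pack f F.
apply: (@findim_sub _ _ _ g) => [x y fxy||a x y Hx Hy]; last 2 first.
- exact: wtspace0.
- by apply: wtspaceD => //; exact: wtspaceZ.
apply: dual_ext => m; elim: (Hsp m) => [|v vs|v v' _ IH _ IH'|a v _ IH].
- by rewrite !linear0.
- have := congr1 (fun r : 'rV[K]_(size sp) => r 0 (Ordinal (introT idP (etrans (index_mem v sp) vs)))) fxy.
  by rewrite /= !mxE /= nth_index.
- by rewrite !linearD /= IH IH'.
- by rewrite !linearZ /= IH.
Qed.

End DualWeights.

Lemma mm_bound N (w : fperm) i j : (w j <= N)%N -> mm N w i j = mm (w j) w i j.
Proof.
move=> wN; rewrite /mm [RHS](count_iota_le _ wN); apply: eq_count => c /=.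
by lia.
Qed.

Lemma iter_e_wt (K : fieldType) (n : nat) (M : bmodule K n) mu i j k (m : M) :
  wtspace mu m -> wtspace (mu + (eps n i - eps n j) *+ k) (iter k (e i j) m).
Proof.
move=> Hm; elim: k => [|k IH]; first by rewrite addr0.
by rewrite iterS mulrSr addrA; exact: e_wt.
Qed.

(** * Weights excluded by the order *)

Section ForbiddenWeights.
Variable n : nat.
Implicit Types lam mu : 'rV[int]_n.

Lemma mm_shift N d (w w' : fperm) i j : (forall a, (a < n)%N -> code w' a = (code w a + d)%N) ->
  (i < n)%N -> (j < n)%N -> mm (d + N) w' i j = mm N w i j.
Proof.
move=> cE i_n j_n; rewrite /mm iotaD count_cat add0n (shift_val cE i_n) (shift_val cE j_n).
rewrite [X in (X + _)%N](_ : _ = 0%N); last first.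
  apply/eqP; rewrite -leqn0 leqNgt -has_count; apply/hasPn => c; rewrite mem_iota add0n /=; lia.
rewrite (_ : iota d N = map (addn d) (iota 0 N)) ?count_map; last by rewrite -iotaDl addn0.
apply: eq_count => c /=.
rewrite -!(lt_bpos _ _ j_n) (shift_bpos cE) addKn; have -> : (d + c < d)%N = false by lia.
lia.
Qed.

Lemma wt_moveE (lam : 'rV[int]_n) i j m (p : 'I_n) : i != j ->
  (lam + (eps n i - eps n j) *+ m) 0 p = lam 0 p + (if p == i :> nat then m%:Z else 0) -
   (if p == j :> nat then m%:Z else 0).
Proof.
move=> ij; rewrite !mxE mulmxnE !mxE -addrA; congr (_ + _).
have [->|pi] := eqVneq (p : nat) i; first by rewrite (negPf ij) !subr0; exact: natz.
by case: eqP => _ /=; rewrite ?subr0 ?mul0rn // !sub0r mulNrn; congr (- _); exact: natz.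
Qed.

Lemma wt_raise (k : int) lam N i j : nonneg (lam + const_mx k) ->
  let w := perm_of_wt (lam + const_mx k) in (pbound w <= N)%N -> (n <= N)%N ->
  (i < j)%N -> (j < n)%N -> ~ wt_le (lam + (eps n i - eps n j) *+ (mm N w i j).+1) lam.
Proof.
move=> nn w wN nN ij jn; set m := _.+1; set mu := lam + _ => le_mu.
(* The shift is enlarged until lam and mu both become nonnegative; by [mm_shift] this does not
   change m_ij. *)
have [kk Hkk] := exists_nonneg mu; pose d := (kk + `|k|)%N.
have nl : nonneg (lam + const_mx (k + d%:Z)) by move=> a; have := nn a; rewrite !mxE; lia.
have nm : nonneg (mu + const_mx (k + d%:Z)).
  have -> : k + d%:Z = (kk + `|(k + `|k|%:Z)%R|)%N%:Z by lia.
  exact: Hkk.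
have := wt_leE nl nm le_mu; set w2 := perm_of_wt (lam + _); set v := perm_of_wt (mu + _).
have cE a : (a < n)%N -> code w2 a = (code w a + d)%N by move=> an; exact: wt_codeS.
have i_n : (i < n)%N by lia.
have wj : (w j < N)%N by apply: val_lt wN nN _ _.
have mE : mm (d + N) w2 i j = mm N w i j by exact: mm_shift.
have ij' : i != j by lia.
apply: (@raise_not_below n w2 v (d + N) i j) => //; rewrite ?mE -/m.
- by rewrite (shift_val cE jn); lia.
- move=> p pn pi pj; apply/eqP; rewrite -eqz_nat; apply/eqP; rewrite (wt_code (Ordinal pn) nm) (wt_code (Ordinal pn) nl).
  by rewrite mxE wt_moveE // [in RHS]mxE /=; do 2 case: eqP => // _; rewrite addr0 subr0.
- apply/eqP; rewrite -eqz_nat PoszD; apply/eqP; rewrite (wt_code (Ordinal i_n) nm) (wt_code (Ordinal i_n) nl).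
  by rewrite mxE wt_moveE // [in RHS]mxE /= eqxx (negPf ij'); ring.
- apply/eqP; rewrite -eqz_nat PoszD; apply/eqP; rewrite (wt_code (Ordinal jn) nm) (wt_code (Ordinal jn) nl).
  by rewrite mxE wt_moveE // [in RHS]mxE /= eqxx eq_sym (negPf ij'); ring.
Qed.

Lemma wt_lower (k : int) lam N i j : nonneg (rho n - lam + const_mx k) ->
  let u := perm_of_wt (rho n - lam + const_mx k) in (pbound u <= N)%N -> (n <= N)%N ->
  (i < j)%N -> (j < n)%N -> (forall p, i < p -> p < j -> ~ (u i < u p < u j))%N ->
  ~ wt_le (lam - (eps n i - eps n j) *+ (mm N u i j).+1) lam.
Proof.
move=> nn u uN nN ij jn umin; set m := _.+1; rewrite -mulNrn opprB; set mu := lam + _ => le_mu.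
(* N2 is so large that the complementary shift k2 = N2 - n - k makes mu nonnegative; enlarging N
   does not change m_ij(u). *)
have [kk Hkk] := exists_nonneg mu; pose N2 := (N + kk + n + `|k|)%N.
have uN2 : (pbound u <= N2)%N by rewrite /N2; lia.
have nN2 : (n <= N2)%N by rewrite /N2; lia.
pose k2 : int := N2%:Z - n%:Z - k.
have rho_k2 (a : 'I_n) : (n.-1 - a)%N%:Z + k2 + k + a.+1%:Z = N2%:Z :> int.
  by rewrite /k2; have := ltn_ord a; lia.
have uE a : (code u (a : 'I_n))%:Z = (n.-1 - a)%N%:Z - lam 0 a + k.
  by rewrite (wt_code a nn) !mxE.
have nl : nonneg (lam + const_mx k2).
  move=> a; have := uE a; have := rho_k2 a; have := rowcard_le a uN2 nN2 (@raised_diagram n N2 u).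
  rewrite rowcard_diagram // !mxE; clear; move: (lam 0%R a) (code u a) k2 => l c k2; lia.
have nm : nonneg (mu + const_mx k2).
  have -> : k2 = (kk + `|(k2 - kk%:Z)%R|)%N%:Z by rewrite /k2 /N2; lia.
  exact: Hkk.
have := wt_leE nl nm le_mu; set w := perm_of_wt (lam + _); set v := perm_of_wt (mu + _).
have cE a : (a < n)%N -> (code w a + code u a + a.+1)%N = N2.
  move=> an; have := rho_k2 (Ordinal an); have := uE (Ordinal an); have := wt_code (Ordinal an) nl.
  by rewrite !mxE /= -/w; clear; move: (lam 0 _) (code u a) (code w a) => l c c'; lia.
have i_n : (i < n)%N by lia.
have uN' p : (p < n)%N -> (u p < N)%N by move=> pn; apply: val_lt uN nN _ _.
have mE : mm N2 u i j = mm N u i j.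
  by rewrite !(@mm_bound _ u) //; have := uN' j jn; rewrite /N2; lia.
have ij' : j != i by lia.
apply: (@lower_not_below n w v u N2 i j) => //; rewrite ?mE -/m.
- by have := uN' i i_n; rewrite /N2; lia.
- by have := uN' j jn; rewrite /N2; lia.
- by move=> p pn; have := uN' p pn; rewrite /N2; lia.
- by move=> p; exact: (@compl_val n N2 u w).
- move=> p pn pi pj; apply/eqP; rewrite -eqz_nat; apply/eqP; rewrite (wt_code (Ordinal pn) nm) (wt_code (Ordinal pn) nl).
  by rewrite mxE wt_moveE // [in RHS]mxE /=; do 2 case: eqP => // _; rewrite addr0 subr0.
- apply/eqP; rewrite -eqz_nat PoszD; apply/eqP; rewrite (wt_code (Ordinal jn) nm) (wt_code (Ordinal jn) nl).
  by rewrite mxE wt_moveE // [in RHS]mxE /= eqxx (negPf ij'); ring.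
- apply/eqP; rewrite -eqz_nat PoszD; apply/eqP; rewrite (wt_code (Ordinal i_n) nm) (wt_code (Ordinal i_n) nl).
  by rewrite mxE wt_moveE // [in RHS]mxE /= eqxx eq_sym (negPf ij'); ring.
Qed.

End ForbiddenWeights.

(** * Projectivity and injectivity *)

Section Categories.
Variables (K : fieldType) (charK0 : [pchar K] =i pred0) (n : nat).
Implicit Types lam nu : 'rV[int]_n.

Lemma KP_in_catle (k : int) lam : nonneg (lam + const_mx k) -> in_catle lam (KP K k lam).
Proof.
move=> nn; split; first exact: KP_weight_module.
by move=> nu; apply: KP_wt_le.
Qed.

Lemma dual_in_catle (k : int) lam : nonneg (rho n - lam + const_mx k) ->
  in_catle lam (tens (dualb (KP K k (rho n - lam))) (charb K (rho n))).
Proof.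
move=> nn; have wS := KP_weight_module charK0 nn.
have [u Su] := KP_kp_like charK0 nn (leq_maxl (pbound (perm_of_wt (rho n - lam + const_mx k))) n).
have [s Hs] := kp_weights charK0 Su (leq_maxl _ _) (leq_maxr _ _).
have [||sp Hsp] := @kp_sub_findim _ _ _ _ _ _ _ Su (fun _ => True); [by []|by []|].
split.
  apply: twist_weight_module; apply: (dual_weight_module charK0 wS _ Hs) => m.
  by apply/Hsp.
move=> nu /is_weight_twist /(is_weight_dual charK0 wS); rewrite opprB => H.
by have := KP_dual_wt_le charK0 nn H; rewrite subKr.
Qed.

Lemma e_large (M : bmodule K n) i j (m : M) : (n <= j)%N -> e i j m = 0.
Proof. by move=> nj; rewrite eE unit_mx_ge // bact0l. Qed.

Lemma not_weight (M : bmodule K n) lam nu (m : M) : in_catle lam M -> ~ wt_le nu lam ->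
  wtspace nu m -> m = 0.
Proof.
move=> [_ CM] nle Hm; apply: contrapT => m0; apply: nle; apply: CM.
by exists m => //; apply/eqP.
Qed.

Lemma catle_kprel (k : int) lam N (M : bmodule K n) (x : M) : nonneg (lam + const_mx k) ->
  (pbound (perm_of_wt (lam + const_mx k)) <= N)%N -> (n <= N)%N -> in_catle lam M -> wtspace lam x ->
  kprel N (perm_of_wt (lam + const_mx k)) x.
Proof.
move=> nn wN nN CM Hx i j ij; have [jn|nj] := ltnP j n; last by rewrite iterS e_large.
by apply: (not_weight CM (wt_raise nn wN nN ij jn)); exact: iter_e_wt.
Qed.

Lemma bhom_wt (M M' : bmodule K n) (f : M -> M') mu m : is_bhom f -> wtspace mu m -> wtspace mu (f m).
Proof.
move=> [flin fe] Hm h hd; rewrite -fe Hm //.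
by have := flin (pairing mu h) m 0; rewrite (linear_at0 flin) !addr0.
Qed.

Lemma KP_projective (k : int) lam : nonneg (lam + const_mx k) -> projective_in (in_catle lam) (KP K k lam).
Proof.
move=> nn M M' g f CM CM' ghom gsurj fhom.
set w := perm_of_wt (lam + const_mx k); pose N := maxn (pbound w) n.
have [wN nN] : (pbound w <= N)%N /\ (n <= N)%N by rewrite leq_maxl leq_maxr.
have [u Su] := KP_kp_like charK0 nn wN.
(* An arbitrary preimage of f u is projected to weight lam; it remains a preimage because g commutes
   with the weight projections. *)
have [x0 gx0] := gsurj (f u); pose x := wtpr CM.1 lam x0.
have Hx : wtspace lam x by exact: wtpr_wt.
have gx : g x = f u.
  rewrite -(wtpr_hom charK0 CM.1 CM'.1 _ _ ghom) gx0 (wtpr_id charK0) //.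
  exact: bhom_wt fhom (kp_wt Su).
have xrel p : ev p (uvec K n N w) = 0 -> ev p x = 0.
  by apply: (kprel_ev charK0 (wt_inc _) wN); exact: catle_kprel.
exists (khom Su x); first exact: khom_bhom.
move=> z; rewrite [in RHS](kpolyP Su z) /khom.
rewrite (ev_hom (f := g) ghom.1) => [|i j v]; last exact: ghom.2.
by rewrite (ev_hom (f := f) fhom.1) => [|i j v]; [rewrite gx|exact: fhom.2].
Qed.

End Categories.

(** * Inverting an injection on a finite-dimensional subspace *)

Section Retraction.
Variables (K : fieldType) (V W : lmodType K) (g : {linear W -> V}) (ginj : injective g).
Variables (Q : W -> Prop) (Q0 : Q 0) (Qlin : forall a x y, Q x -> Q y -> Q (a *: x + y)) (s : seq V).
Local Notation span := (lspan (fun v => v \in s)).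

Let comb (r : 'rV[K]_(size s)) : V := \sum_i r 0 i *: s`_i.

Let comb_linear : linear comb.
Proof.
move=> a r r'; rewrite /comb scaler_sumr -big_split; apply: eq_bigr => i _ /=.
by rewrite !mxE scalerDl scalerA.
Qed.

Let span_comb y : span y -> exists r, y = comb r.
Proof.
elim=> [|v vs|v v' _ [r ->] _ [r' ->]|a v _ [r ->]].
- by exists 0; rewrite (linear_at0 comb_linear).
- have vs' : (index v s < size s)%N by rewrite index_mem.
  exists (delta_mx 0 (Ordinal vs')); rewrite /comb (bigD1 (Ordinal vs')) //= big1 ?addr0 => [|i ii].
    by rewrite mxE !eqxx scale1r nth_index.
  by rewrite mxE (negPf ii) scale0r.
- by exists (1 *: r + r'); rewrite comb_linear scale1r.
- by exists (a *: r + 0); rewrite comb_linear (linear_at0 comb_linear) addr0.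
Qed.

(** [ret] is a function on all of V but linear only on the span of s, in the application a weight
    space. It chooses coordinates, projects them by the idempotent [pinvmx B *m B] onto the
    coordinates of vectors in the image of Q, and inverts g. *)
Lemma partial_retraction : exists ret : V -> W,
  (forall a x y, span x -> span y -> ret (a *: x + y) = a *: ret x + ret y) /\
  (forall m, Q m -> span (g m) -> ret (g m) = m).
Proof.
pose A r := exists2 m, Q m & g m = comb r.
have [||B BA] := @subspace_mx K _ A.
- by exists 0; rewrite // linear0 (linear_at0 comb_linear).
- move=> a r r' [m Qm gm] [m' Qm' gm']; exists (a *: m + m'); first exact: Qlin.
  by rewrite linearP gm gm' comb_linear.
pose pj r : 'rV[K]_(size s) := r *m pinvmx B *m B.
have pjA r : A (pj r) by apply/BA; exact: submxMl.
have pj_id r : A r -> pj r = r by move=> /BA; exact: mulmxKpV.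
have coef y : exists r, span y -> y = comb r.
  have [/span_comb [r yE]|ny] := pselect (span y); first by exists r.
  by exists 0.
pose c y := sval (cid (coef y)).
have cP y : span y -> y = comb (c y) by exact: (svalP (cid (coef y))).
pose ret y := sval (cid2 (pjA (c y))).
have retE y : g (ret y) = comb (pj (c y)) by rewrite /ret; case: cid2.
exists ret; split=> [a x y sx sy|m Qm sm]; apply: ginj; last first.
  by rewrite retE pj_id -?cP //; exists m; rewrite // -cP.
rewrite linearP !retE -comb_linear; apply/eqP; rewrite -subr_eq0; apply/eqP.
have combB r r' : comb (r - r') = comb r - comb r'.
  by rewrite [r - r']addrC -[- r']scaleN1r comb_linear scaleN1r addrC.
have sxy : span (a *: x + y) by apply: lspanD => //; exact: lspanZ.
(* The chosen coordinates are not linear in the vector. Their defect lies in the kernel of [comb],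
   which is contained in A because 0 is in Q, so the projection fixes it and [comb] kills the
   result. *)
have E : comb (c (a *: x + y) - (a *: c x + c y)) = 0.
  by rewrite combB comb_linear -!cP // subrr.
have Ad : A (c (a *: x + y) - (a *: c x + c y)) by exists 0; rewrite // linear0 E.
rewrite -combB -[RHS]E -[X in _ = comb X](pj_id _ Ad).
by rewrite /pj !mulmxBl !mulmxDl -!scalemxAl.
Qed.

End Retraction.

(** * Injectivity of the twisted dual *)

Section Injective.
Variables (K : fieldType) (charK0 : [pchar K] =i pred0) (n : nat) (k : int) (lam : 'rV[int]_n).
Hypothesis nn : nonneg (rho n - lam + const_mx k).
Local Notation S := (KP K k (rho n - lam)).
Local Notation w := (perm_of_wt (rho n - lam + const_mx k)).

(** A nonzero e_ij^(m+1) x with m = m_ij(w) would make lam - (m+1)(eps_i - eps_j) a weight of M.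
    [wt_lower] excludes this for minimal pairs (i, j), and [kprel_min] reduces to these. *)
Lemma dual_kprel N (M : bmodule K n) (x : dualb M) : (pbound w <= N)%N -> (n <= N)%N ->
  in_catle lam M -> wtspace (- lam) x -> kprel N w x.
Proof.
move=> wN nN CM Hx; apply: (kprel_min charK0) => i j ij ijmin.
have [jn|nj] := ltnP j n; last by rewrite iterS e_large.
apply: contrapT => /eqP x0; apply: (wt_lower nn wN nN ij jn ijmin); apply: CM.2.
rewrite -[lam - _]opprK opprB addrC; apply: (is_weight_dual charK0 CM.1).
by exists (iter (mm N w i j).+1 (e i j) x); first exact: iter_e_wt.
Qed.

Lemma dual_injective : injective_in (in_catle lam) (tens (dualb S) (charb K (rho n))).
Proof.
move=> M M' g f CM CM' ghom ginj fhom; pose N := maxn (pbound w) n.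
have [wN nN] : (pbound w <= N)%N /\ (n <= N)%N by rewrite leq_maxl leq_maxr.
have [u Su] := KP_kp_like charK0 nn wN.
pose phi m : dualb S := untwist (f m).
have phi_lin : linear phi by move=> a x y; rewrite /phi fhom.1 linearP.
have phi_act x m : phi (bact x m) = bact x (phi m) + pairing (rho n) x *: phi m.
  by rewrite /phi fhom.2 -{1}[f m]untwistK twist_act twistK.
have phi_wt mu m : wtspace mu m -> wtspace (mu - rho n) (phi m).
  by move=> /(bhom_wt fhom) H; apply/(twist_wt (rho n)); rewrite subrK untwistK.
(* This form determines f, because u generates S; as u has weight rho - lam, it sees only the
   component of m of weight lam. *)
pose xi m : K^o := dval (phi m) u.
have xi_lin : linear xi by move=> a x y; rewrite /xi phi_lin.
have xi_pr m : xi m = xi (wtpr CM.1 lam m).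
  have [s [us ws s0 mE]] := wtprP CM.1 m.
  pose F := GRing.isLinear.Build K M K^o _ xi xi_lin; pose xi' : {linear M -> K^o} := HB.pack xi F.
  have xi0 mu : mu != lam -> xi (wtpr CM.1 mu m) = 0.
    move=> mul; apply: (dual_wt_other charK0 (phi_wt _ _ (ws mu)) (kp_wt Su)).
    by apply: contraNneq mul; rewrite opprB => /addrI /oppr_inj ->.
  rewrite [in LHS]mE -[xi (\sum_(_ <- _) _)]/(xi' _) linear_sum /=.
  have [ls|ls] := boolP (lam \in s); last first.
    rewrite s0 // (linear_at0 xi_lin) big_seq big1 // => mu mus; apply: xi0.
    by apply: contraNneq ls => <-.
  by rewrite (bigD1_seq lam) //= big1 ?addr0 // => mu; exact: xi0.
have [s Hs] := wt_fin CM'.1 lam.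
pose F := GRing.isLinear.Build K M M' _ g ghom.1; pose gl : {linear M -> M'} := HB.pack g F.
have [||ret [ret_lin ret_id]] := @partial_retraction K M' M gl ginj (wtspace lam) _ _ s.
- exact: wtspace0.
- by move=> a x y Hx Hy; apply: wtspaceD => //; exact: wtspaceZ.
(* The extension to M': project to weight lam, retract to M, apply [xi]. *)
pose xi1 y : K^o := xi (ret (wtpr CM'.1 lam y)).
have prs y : lspan (fun v => v \in s) (wtpr CM'.1 lam y) by apply/Hs; exact: wtpr_wt.
have xi1_lin : linear xi1.
  by move=> a x y; rewrite /xi1 (wtpr_linear charK0) ret_lin // xi_lin.
pose xi2 : dualb M' := mkdual xi1_lin.
have xi1_g m : xi1 (g m) = xi m.
  rewrite /xi1 (wtpr_hom charK0 CM.1 CM'.1 _ _ ghom) [ret _]ret_id -?xi_pr //; first exact: wtpr_wt.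
  by apply/Hs/(bhom_wt ghom); exact: wtpr_wt.
have xi2_wt : wtspace (- lam) xi2.
  move=> h hd; apply: dual_ext => y; rewrite /= fctE pairingNl scaleNr; congr (- _).
  have -> : xi1 (bact h y) = xi1 (pairing lam h *: y + 0).
    rewrite /xi1 (wtpr_diag charK0) // (wtpr_linear charK0) (linear_at0 (wtpr_linear charK0 _ _)).
    by rewrite addr0.
  by rewrite xi1_lin (linear_at0 xi1_lin) addr0.
have xrel p : ev p (uvec K n N w) = 0 -> ev p xi2 = 0.
  by apply: (kprel_ev charK0 (wt_inc _) wN); exact: dual_kprel.
have kl := khom_linear Su xrel.
have psi_lin z : linear (fun v : S => dval (khom Su xi2 v) z : K^o).
  by move=> a v v'; rewrite kl.
(* The homomorphism from S to the dual of M' that sends u to [xi2] is transposed. *)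
pose psi z : dualb S := mkdual (psi_lin z).
have psi_linear : linear psi by move=> a z z'; apply: dual_ext => v; rewrite /= linearP.
(* The generator u has weight rho - lam and [xi2] has weight - lam; the difference is the twist by
   rho. *)
have khom_act x v : khom Su xi2 (bact x v) = bact x (khom Su xi2 v) + pairing (rho n) x *: khom Su xi2 v.
  rewrite {1}(kpolyP Su v) -(ev_pact _ _ (kp_wt Su)) (khom_ev Su xrel).
  rewrite /khom; move: (kpoly Su v) => p.
  by rewrite [rho n - lam]addrC ev_pact_shift (ev_pact _ _ xi2_wt).
have psi_act x z : psi (bact x z) = bact x (psi z) + pairing (rho n) x *: psi z.
  apply: dual_ext => v; rewrite -[LHS]/(dval (khom Su xi2 v) (bact x z)).
  rewrite -[RHS]/(- dval (khom Su xi2 (bact x v)) z + pairing (rho n) x * dval (khom Su xi2 v) z).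
  by rewrite khom_act /= !fctE opprD opprK addrNK.
exists (fun z => twist (rho n) (psi z)).
  split=> [a z z'|x z]; first by rewrite psi_linear linearP.
  by rewrite twist_act psi_act.
move=> m; rewrite -[RHS]untwistK -/(phi m); congr twist; apply: dual_ext => v.
(* The letters of a word are carried across the pairing one at a time; the twist by rho does not
   affect the e_ij. *)
have evwE q : forall m, dval (evw q xi2) (g m) = dval (phi m) (evw q u).
  elim: q => [|ij q IH] m'; first exact: xi1_g.
  rewrite !evw_cons !eE -[LHS]/(- dval (evw q xi2) (bact (E K n ij.1 ij.2) (g m'))).
  by rewrite -ghom.2 IH phi_act pairing_E scale0r addr0 /= opprK.
rewrite [in RHS](kpolyP Su v) -[LHS]/(dval (ev (kpoly Su v) xi2) (g m)).
rewrite /ev; elim: (kpoly Su v) => [|q p IH]; first by rewrite !big_nil linear0.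
rewrite !big_cons (dval_linear (phi m)) -IH -evwE.
by rewrite -[LHS]/(q.1 *: dval (evw q.2 xi2) (g m) + dval (\sum_(q <- p) q.1 *: evw q.2 xi2) (g m)).
Qed.

End Injective.

Theorem proposition6p4 (K : fieldType) (charK0 : [pchar K] =i pred0)
    (n : nat) (n_gt0 : (0 < n)%N) (lam : 'rV[int]_n) (k k' : int)
    (hk : nonneg (lam + const_mx k)) (hk' : nonneg (rho n - lam + const_mx k')) :
  let S := KP K k lam in
  let T := tens (dualb (KP K k' (rho n - lam))) (charb K (rho n)) in
  [/\ in_catle lam S, in_catle lam T,
      projective_in (in_catle lam) S & injective_in (in_catle lam) T].
Proof.
split.
- exact: KP_in_catle.
- exact: dual_in_catle.
- exact: KP_projective.
- exact: dual_injective.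
Qed.
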